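(* Let $R$ be a finite ring. Then the unitary Cayley graph $\mathrm{Cay}(R,U(R))$ is projective if and only if $R$ is isomorphic to $\mathbb{Z}_5$ or $\mathbb{Z}_3\times\mathbb{Z}_3$.
   Context: All rings are commutative with non-zero identity. $\mathbb{Z}_n$ is the ring of integers modulo $n$, and $U(R)$ is the group of units of $R$. The unitary Cayley graph $\mathrm{Cay}(R,U(R))$ is the simple graph with vertex set $R$ in which two distinct vertices $x,y$ are adjacent if and only if $x-y\in U(R)$. The nonorientable genus (crosscap number) of a finite simple graph is the minimum non-negative integer $k$ such that the graph can be embedded in the sphere with $k$ crosscaps (the case $k=0$ being the sphere itself). A graph is projective if its nonorientable genus equals $1$ (so planar graphs are not projective). *)

(* Defs.v *)
From HB Require Import structures.
From mathcomp Require Import all_boot all_order all_algebra.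
From mathcomp Require Import all_classical all_reals all_analysis.
From mathcomp Require Import zify ring lra.

Set Implicit Arguments.
Unset Strict Implicit.
Unset Printing Implicit Defensive.

Import Order.TTheory GRing.Theory Num.Theory.
Import numFieldTopology.Exports numFieldNormedType.Exports.

Local Open Scope classical_set_scope.
Local Open Scope ring_scope.

Definition ring_isomorphic (R S : nzRingType) : Prop :=
  exists f : {rmorphism R -> S}, bijective f.

Record simple_graph := SimpleGraph {
  vertex :> finType;
  adj : rel vertex;
  adj_sym : symmetric adj;
  adj_irrefl : irreflexive adj
}.

Section UnitaryCayley.
Variable R : finComUnitRingType.

Definition unitary_adj : rel R :=
  fun x y => (x != y) && (x - y \is a GRing.unit).

Lemma unitary_adj_sym : symmetric unitary_adj.
Proof. by move=> x y; rewrite /unitary_adj eq_sym -(opprB y x) unitrN. Qed.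

Lemma unitary_adj_irrefl : irreflexive unitary_adj.
Proof. by move=> x; rewrite /unitary_adj eqxx. Qed.

Definition unitary_cayley : simple_graph :=
  SimpleGraph unitary_adj_sym unitary_adj_irrefl.

End UnitaryCayley.

(* The sphere with k crosscaps: k disjoint open round caps are removed from
   the unit sphere of K^3 and antipodal points of each boundary circle are
   identified. The caps are centred at k equally spaced points of the equator
   and have angular radius pi / (2 k); in particular, for k = 0 this is the
   sphere, and for k = 1 it is a closed hemisphere with antipodal points of
   the boundary circle identified. *)
Section CrosscapSphere.
Variables (K : realType) (k : nat).
Implicit Types (u v w x y : 'rV[K]_3) (i j : 'I_k).

Definition dotp u v : K := \sum_(l < 3) u 0 l * v 0 l.

Definition cap_angle i : K := pi * (2 * i)%:R / k%:R.

Definition cap_center i : 'rV[K]_3 :=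
  \row_(l < 3) [:: cos (cap_angle i); sin (cap_angle i); 0]`_l.

(* The i-th cap is the set of points x of the sphere such that
   cap_height < dotp x (cap_center i). *)
Definition cap_height : K := cos (pi / (2 * k)%:R).

Definition holed_sphere : set 'rV[K]_3 :=
  [set x | dotp x x = 1 /\ forall i, dotp x (cap_center i) <= cap_height].

(* The centre of the boundary circle of the i-th cap is
   cap_height *: cap_center i. *)
Definition cap_antipode i x : 'rV[K]_3 :=
  (2 * cap_height) *: cap_center i - x.

Definition glue : rel holed_sphere :=
  fun p q => (p == q) ||
    [exists i : 'I_k, (dotp (val p) (cap_center i) == cap_height) &&
                      (val q == cap_antipode i (val p))].

Lemma dotpE u v :
  dotp u v = u 0 0 * v 0 0 + u 0 1 * v 0 1 + u 0 2%:R * v 0 2%:R.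
Proof.
rewrite /dotp !big_ord_recr big_ord0 /= add0r.
by congr (_ * _ + _ * _ + _ * _); congr (_ 0 _); apply/val_inj.
Qed.

Lemma dotp_center x i : dotp x (cap_center i) =
  x 0 0 * cos (cap_angle i) + x 0 1 * sin (cap_angle i).
Proof. by rewrite dotpE !mxE /= mulr0 addr0. Qed.

Lemma cap_center_unit i : dotp (cap_center i) (cap_center i) = 1.
Proof.
by rewrite dotp_center !mxE /= -!expr2 cos2Dsin2.
Qed.

Lemma cap_antipode_rim i x : dotp x (cap_center i) = cap_height ->
  dotp (cap_antipode i x) (cap_center i) = cap_height.
Proof.
have := cap_center_unit i.
rewrite !dotpE !mxE /=; move: cap_height => t.
move: (cos _) (sin _) => c s h1 h2.
move: (x 0 0) (x 0 1) (x 0 2%:R) h1 h2 => a b d h1 h2.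
transitivity (2 * t * (c * c + s * s + 0 * 0) - (a * c + b * s + d * 0)).
  ring.
by rewrite h1 h2; ring.
Qed.

Lemma cap_antipodeK i : involutive (cap_antipode i).
Proof. by move=> x; rewrite /cap_antipode subKr. Qed.

Lemma caps_disjoint x i j : dotp x x = 1 ->
  cap_height <= dotp x (cap_center i) ->
  cap_height <= dotp x (cap_center j) -> i = j.
Proof.
wlog lt_ji : i j / (j < i)%N.
  move=> hw h1 hi hj; case: (ltngtP i j) => [lt|lt|/val_inj//].
    by apply/esym/(hw j i).
  exact: (hw i j).
rewrite !dotp_center dotpE => x1 hi hj; exfalso.
have k0 : 0 < k%:R :> K by rewrite ltr0n (leq_trans _ (ltn_ord i)).
pose d := pi * (i - j)%:R / k%:R : K; pose g := pi * (i + j)%:R / k%:R : K.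
have ai : cap_angle i = g + d.
  rewrite /cap_angle /g /d -mulrDl -mulrDr -natrD; congr (_ * _%:R / _); lia.
have aj : cap_angle j = g - d.
  rewrite /cap_angle /g /d -mulrBl -mulrBr -natrB; last by lia.
  congr (_ * _%:R / _); lia.
have pi0 := pi_gt0 K.
have lt_cos (n : nat) : (0 < n < k)%N -> cos (pi * n%:R / k%:R) < cap_height.
  move=> /andP[n0 nk]; rewrite /cap_height.
  have n1 : 1 <= n%:R :> K by rewrite ler1n.
  have nk' : n%:R <= k%:R :> K by rewrite ler_nat ltnW.
  have ik0 : 0 < k%:R^-1 :> K by rewrite invr_gt0.
  have kk : k%:R * k%:R^-1 = 1 :> K by rewrite divff ?gt_eqF.
  rewrite natrM invfM; move: ik0 kk; set q := k%:R^-1 => ik0 kk.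
  have q1 : q <= 1 by rewrite /q invf_le1// (le_trans n1).
  have pq : 0 < pi * q by rewrite mulr_gt0.
  have pq1 : pi * q <= pi by rewrite ler_piMr// ltW.
  have hx : pi * n%:R * q \in `[0, pi].
    have nq0 : 0 <= n%:R * q by apply: mulr_ge0; lra.
    rewrite in_itv /= -mulrA; apply/andP; split; first by apply: mulr_ge0; lra.
    apply: ler_piMr; first exact: ltW.
    by rewrite -[leRHS]kk ler_pM2r.
  have hy : pi * (2^-1 * q) \in `[0, pi].
    by rewrite in_itv /=; apply/andP; split; lra.
  rewrite ltr_cos//.
  rewrite -subr_gt0 (_ : _ - _ = pi * q * (n%:R - 2^-1)); last by ring.
  by rewrite mulr_gt0//; lra.
have c1 : cos d < cap_height by apply: lt_cos; have := ltn_ord i; lia.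
have c2 : - cos d < cap_height.
  rewrite -cosDpi -cosN -(cosD2pi) (_ : _ + _ = pi * (k - (i - j))%:R / k%:R).
    by apply: lt_cos; have := ltn_ord i; lia.
  rewrite natrB; last by have := ltn_ord i; lia.
  rewrite /d; field; exact: lt0r_neq0.
move: hi hj; rewrite ai aj cosD sinD cosB sinB.
have := cos2Dsin2 g; move: c1 c2 x1.
move: (cos d) (sin d) (cos g) (sin g) => cd sd cg sg.
move: (x 0 0) (x 0 1) (x 0 2%:R) cap_height => a b c t.
move=> h1 h2 h3 h4 h5 h6.
have h7 : t <= cd * (a * cg + b * sg) by lra.
have h8 : (a * cg + b * sg) ^+ 2 <= 1.
  have := sqr_ge0 (a * sg - b * cg); have := sqr_ge0 c.
  have e1 : (a * cg + b * sg) ^+ 2 + (a * sg - b * cg) ^+ 2 + c ^+ 2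
            * (cg ^+ 2 + sg ^+ 2)
     = (a * a + b * b + c * c) * (cg ^+ 2 + sg ^+ 2) by ring.
  by move: e1; rewrite h3 h4; lra.
move: h7 h8; move: (a * cg + b * sg) => m h7 h8.
have hm : -1 <= m <= 1 by rewrite -ler_norml -(@ler_pXn2r _ 2)// ?nnegrE// expr1n real_normK// num_real.
case/andP: hm => m1 m2; nra.
Qed.

Lemma glue_equiv_proof : equiv_class_of glue.
Proof.
have sym : forall p q, glue p q -> glue q p.
  move=> p q /orP[/eqP->|/existsP[i /andP[/eqP hp /eqP hq]]].
    by rewrite /glue eqxx.
  apply/orP; right; apply/existsP; exists i.
  by rewrite hq cap_antipode_rim// cap_antipodeK !eqxx.
split; first by move=> p; rewrite /glue eqxx.
  by move=> p q; apply/idP/idP; exact: sym.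
move=> q p r hpq hqr.
case/orP: (hpq) => [/eqP->//|/existsP[i /andP[/eqP hp /eqP hq]]].
case/orP: (hqr) => [/eqP<-//|/existsP[j /andP[/eqP hq' /eqP hr]]].
have /set_mem[q1 _] := valP q.
have ij : i = j.
  by apply: (caps_disjoint q1); rewrite ?hq' // hq cap_antipode_rim.
apply/orP; left; apply/eqP/val_inj.
by rewrite hr -ij hq cap_antipodeK.
Qed.

Canonical glue_equiv := EquivRelPack glue_equiv_proof.

Definition crosscap_sphere : topologicalType :=
  quotient_topology {eq_quot glue_equiv}%qT.

End CrosscapSphere.

Section Embedding.
Variable K : realType.

Definition simple_arc (X : topologicalType) (a b : X) (A : set X) : Prop :=
  exists c : K -> X, [/\ {within `[0, 1], continuous c},
    {in `[0, 1] &, injective c}, c 0 = a, c 1 = b & A = c @` `[0, 1]].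

(* Vertices go to distinct points and edges to simple arcs joining their ends;
   an arc contains no other vertex, and arcs of distinct edges meet only at
   vertices. The first equation on e says that e x y depends only on the
   unordered pair {x, y}. *)
Definition embeds_in (G : simple_graph) (X : topologicalType) : Prop :=
  exists (p : G -> X) (e : G -> G -> set X),
  [/\ injective p,
      forall x y, adj x y -> e y x = e x y /\ simple_arc (p x) (p y) (e x y),
      forall x y z, adj x y -> e x y (p z) -> z = x \/ z = y
    & forall x y z w, adj x y -> adj z w ->
        ~ ((x = z /\ y = w) \/ (x = w /\ y = z)) ->
        e x y `&` e z w `<=` range p].

Definition nonorientable_genus_is (G : simple_graph) (k : nat) : Prop :=
  embeds_in G (crosscap_sphere K k) /\
  forall j : nat, embeds_in G (crosscap_sphere K j) -> (k <= j)%N.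

Definition projective (G : simple_graph) : Prop := nonorientable_genus_is G 1.

End Embedding.

(* Main.v *)
Require Import Defs.
From mathcomp Require Import all_boot all_order all_algebra.
From mathcomp Require Import all_reals.
From HB Require Import structures.
From mathcomp Require fingroup cyclic pgroup.
From mathcomp Require Import zify ring.

(** At least four units: nonprojectivity is detected by counting crossings modulo 2.
    A point of the sphere or of the projective plane is a unit vector of K^3, in the
    second case up to sign, and an arc becomes, after subdivision and a small generic
    perturbation, a polygonal chain of vectors. The parity of the number of crossings of
    two chains is a sum of terms each of which involves one chain and one end of the
    other, or two ends ([crossings_parity]). Disjoint edges of an embedded graph do not
    cross, so every pair of them gives an equation ([parity_data]):
    the product of the signs [sgn x y] and [sgn z w] equals a sum of such terms, where
    the sign of an edge records whether its lift to the sphere ends at the vector chosen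
    for its last vertex or at the antipode. Added over all pairs of disjoint edges of a
    subdivided K_{3,3}, the terms on the right cancel and leave 1 ([test_form_true]). On
    the sphere all signs vanish, which is the nonplanarity of K_{3,3}; the same
    computation excludes K_5. In the projective plane the signs can be made to vanish on
    a spanning tree ([switch]), and for each of seven small graphs a finite computation
    shows that no signs on the remaining edges are compatible with all the subdivided
    K_{3,3} in the graph ([certificate_obstruction]).

    A ring R with at least four units that is neither Z_5 nor Z_3 x Z_3 contains one of
    these seven graphs ([ring_classification]). A unit minus an element of the Jacobson
    radical J is a unit, so for #|J| >= 3 there is a K_{4,4} or a K_{3,5} between J and
    the units. For #|J| = 2 the nonzero element of J doubles the vertices of the six-cycle
    K_2 x K_3 given by two maximal ideals. For J = 0 the ring is a product of fields, and
    the Chinese remainder theorem provides K_2 x K_5, K_2 x K_3 x K_3 or K_3 x K_4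
    (tensor products), or else R is a field and K_7 appears as soon as it has seven
    elements.

    With at most three units, the additive subgroup generated by the units carries a
    subgraph of K_4, a cycle or a cube, and Cay(R, U(R)) is a disjoint union of copies of
    it, hence planar ([few_units_planar]). Finally, Z_5 gives K_5 and Z_3 x Z_3 gives
    K_3 x K_3; both are nonplanar, and drawings by projective line segments through
    explicit integer points show that they embed in the projective plane
    ([geodesic_embedding], [integer_projective_drawing]). *)

Set Implicit Arguments.
Unset Strict Implicit.
Unset Printing Implicit Defensive.

Import GRing.Theory.

Local Open Scope ring_scope.

(** * Maximal ideals of a finite commutative ring *)
Section FiniteRing.
Variable R : finComUnitRingType.
Implicit Types (x y z : R) (I M : {set R}).

Definition ideal I : bool :=
  [&& 0 \in I, [forall x in I, forall y in I, x - y \in I]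
    & [forall x, forall y in I, x * y \in I]].

(** Maximality in the form in which it is used: [R / M] is a field. *)
Definition max_ideal M : bool :=
  [&& ideal M, 1 \notin M & [forall x, (x \notin M) ==> [exists y, 1 - x * y \in M]]].

Section IdealTheory.
Variable I : {set R}.
Hypothesis I_ideal : ideal I.

Lemma ideal0 : 0 \in I. Proof. by case/and3P: I_ideal. Qed.

Lemma idealB x y : x \in I -> y \in I -> x - y \in I.
Proof.
by case/and3P: I_ideal => _ /forall_inP H _ /H /forall_inP; apply.
Qed.

Lemma idealMl x y : y \in I -> x * y \in I.
Proof. by case/and3P: I_ideal => _ _ /forallP /(_ x) /forall_inP; apply. Qed.

Lemma idealMr x y : x \in I -> x * y \in I.
Proof. by rewrite mulrC; apply: idealMl. Qed.

Lemma idealN x : x \in I -> - x \in I.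
Proof. by move=> xI; rewrite -sub0r idealB // ideal0. Qed.

Lemma idealD x y : x \in I -> y \in I -> x + y \in I.
Proof. by move=> xI yI; rewrite -(opprK y) idealB // idealN. Qed.

Lemma idealC x y : (x - y \in I) = (y - x \in I).
Proof. by apply/idP/idP => /idealN; rewrite opprB. Qed.

Lemma ideal_subr x y : x - y \in I -> (x \in I) = (y \in I).
Proof.
move=> xy; apply/idP/idP => h; first by rewrite -(subKr x y) idealB.
by rewrite -(subrK y x) idealD.
Qed.

End IdealTheory.

Lemma idealP I : 0 \in I -> (forall x y, x \in I -> y \in I -> x - y \in I) ->
  (forall x y, y \in I -> x * y \in I) -> ideal I.
Proof.
move=> h0 hB hM; apply/and3P; split => //.
  by apply/forall_inP => x xI; apply/forall_inP => y yI; exact: hB.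
by apply/forallP => x; apply/forall_inP => y; exact: hM.
Qed.

Lemma max_idealP M : ideal M -> 1 \notin M ->
  (forall x, x \notin M -> exists y, 1 - x * y \in M) -> max_ideal M.
Proof.
move=> iM M1 H; apply/and3P; split => //; apply/forallP => x; apply/implyP => xM.
by have [y yP] := H x xM; apply/existsP; exists y.
Qed.

Lemma max_ideal_ideal M : max_ideal M -> ideal M. Proof. by case/and3P. Qed.

Lemma max_ideal1 M : max_ideal M -> 1 \notin M. Proof. by case/and3P. Qed.

Lemma max_ideal_inv M x : max_ideal M -> x \notin M -> exists y, 1 - x * y \in M.
Proof. by case/and3P=> _ _ /forallP /(_ x) /implyP H /H /existsP. Qed.

Lemma max_ideal_prime M x y : max_ideal M -> x * y \in M -> (x \in M) || (y \in M).
Proof.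
move=> mM xy; case: (boolP (x \in M)) => //= xM; have iM := max_ideal_ideal mM.
have [z zP] := max_ideal_inv mM xM.
have -> : y = y * (1 - x * z) + (x * y) * z by ring.
by apply: idealD; [|apply: idealMl|apply: idealMr].
Qed.

Lemma max_ideal_unit M x : max_ideal M -> x \is a GRing.unit -> x \notin M.
Proof.
move=> mM xu; apply: contra (max_ideal1 mM) => xM.
by rewrite -(mulVr xu) idealMl // max_ideal_ideal.
Qed.

(** Among the ideals that contain [x] but not 1 there is a largest one, by finiteness;
    adjoining to it any [z] outside produces 1. *)
Lemma nonunit_max_ideal x : x \isn't a GRing.unit -> exists2 M, max_ideal M & x \in M.
Proof.
move=> xu; pose P I := [&& ideal I, 1 \notin I & x \in I].
pose X := [set x * y | y : R].
have PX : P X.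
  apply/and3P; split; last by apply/imsetP; exists 1; rewrite ?mulr1.
    apply: idealP; first by apply/imsetP; exists 0; rewrite ?mulr0.
      by move=> _ _ /imsetP[y _ ->] /imsetP[z _ ->]; rewrite -mulrBr imset_f.
    by move=> z _ /imsetP[y _ ->]; rewrite mulrCA imset_f.
  apply: contra xu => /imsetP[y _ e]; apply/unitrPr; exists y; by rewrite -e.
have [M /maxsetP[/and3P[iM M1 xM] Mmax] _] := maxset_exists PX.
exists M => //; apply: max_idealP => // z zM.
pose N := [set t | [exists y, t - z * y \in M]].
have inN t y : t - z * y \in M -> t \in N by move=> h; rewrite inE; apply/existsP; exists y.
have MN : M \subset N by apply/subsetP => a aM; apply: (inN a 0); rewrite mulr0 subr0.
have zN : z \in N by apply: (inN z 1); rewrite mulr1 subrr ideal0.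
have iN : ideal N.
  apply: idealP; first by apply: (subsetP MN); exact: ideal0.
    move=> a b; rewrite !inE => /existsP[y aM] /existsP[y' bM].
    apply/existsP; exists (y - y').
    have -> : a - b - z * (y - y') = (a - z * y) - (b - z * y') by ring.
    exact: idealB.
  move=> t a; rewrite !inE => /existsP[y aM]; apply/existsP; exists (t * y).
  have -> : t * a - z * (t * y) = t * (a - z * y) by ring.
  exact: idealMl.
have : 1 \in N.
  apply: contraR zM => N1; rewrite -(Mmax N) //; apply/and3P; split => //.
  exact: (subsetP MN).
by rewrite inE => /existsP[y]; exists y.
Qed.

Lemma unit_max_ideals x : (forall M, max_ideal M -> x \notin M) -> x \is a GRing.unit.
Proof.
move=> H; apply: contraT => /nonunit_max_ideal[M mM xM].
by have := H M mM; rewrite xM.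
Qed.

Lemma max_ideal_sub M N : max_ideal M -> max_ideal N -> M \subset N -> M = N.
Proof.
move=> mM mN MN; apply/eqP; rewrite eqEsubset MN /=; apply/subsetP => x xN.
apply: contraT => xM; have [y yP] := max_ideal_inv mM xM.
have iN := max_ideal_ideal mN.
have : 1 \in N by rewrite -(subrK (x * y) 1) idealD // ?idealMr // (subsetP MN).
by rewrite (negbTE (max_ideal1 mN)).
Qed.

(** The Chinese remainder theorem, reduced to one element: modulo the maximal ideals it
    behaves as the idempotent that belongs to [M]. A product of elements taken in the
    other maximal ideals, but outside [M], becomes such an element after division
    modulo [M]. *)
Lemma idempotent_like M : max_ideal M ->
  exists2 e, 1 - e \in M & forall N, max_ideal N -> N != M -> e \in N.
Proof.
move=> mM; have iM := max_ideal_ideal mM.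
suff [z zM zN] : exists2 z, z \notin M &
    forall N, N \in [set N | max_ideal N & N != M] -> z \in N.
  have [y yP] := max_ideal_inv mM zM; exists (z * y) => // N mN NM.
  by apply: idealMr; [exact: max_ideal_ideal|apply: zN; rewrite inE mN NM].
have : forall N, N \in enum [set N | max_ideal N & N != M] -> max_ideal N && (N != M).
  by move=> N; rewrite mem_enum inE.
have sE N : N \in [set N | max_ideal N & N != M] -> N \in enum [set N | max_ideal N & N != M].
  by rewrite mem_enum.
move: (enum _) sE => s sE.
suff : (forall N, N \in s -> max_ideal N && (N != M)) ->
    exists2 z, z \notin M & forall N, N \in s -> z \in N.
  by move=> H /H[z zM zs]; exists z => // N /sE /zs.
elim: s {sE} => [_|N s IHs Hs]; first by exists 1 => //; exact: max_ideal1.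
have [|z zM zs] := IHs; first by move=> N' N's; apply: Hs; rewrite inE N's orbT.
have /andP[mN NM] := Hs N (mem_head _ _).
have [t tN tM] : exists2 t, t \in N & t \notin M.
  by apply/subsetPn; apply: contra NM => /(max_ideal_sub mN mM) ->.
exists (z * t).
  by apply/negP => /(max_ideal_prime mM); rewrite (negbTE zM) (negbTE tM).
move=> N'; rewrite inE => /orP[/eqP ->|N's].
  by rewrite idealMl // max_ideal_ideal.
have /andP[mN' _] : max_ideal N' && (N' != M) by apply: Hs; rewrite inE N's orbT.
by rewrite idealMr ?zs // max_ideal_ideal.
Qed.

(** A representative of the class of [x]; it depends on the class alone, because the
    choice operator depends only on the extension of its predicate. *)
Definition residue M x : R := odflt x [pick y | x - y \in M].

Definition residues M : seq R := [seq x <- enum R | residue M x == x].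

Lemma residue_sub M x : 0 \in M -> x - residue M x \in M.
Proof.
move=> M0; rewrite /residue; case: pickP => [//|/(_ x)].
by rewrite subrr M0.
Qed.

Lemma residue_congr M x y : 0 \in M -> {in M &, forall a b, a - b \in M} ->
  x - y \in M -> residue M x = residue M y.
Proof.
move=> M0 MB xy; rewrite /residue.
have E : (fun z => x - z \in M) =1 (fun z => y - z \in M).
  move=> z; apply/idP/idP => h.
    have -> : y - z = (x - z) - (x - y) by ring.
    exact: MB.
  have -> : x - z = (y - z) - (0 - (x - y)) by ring.
  by apply: (MB) => //; exact: MB.
rewrite (eq_pick E); case: pickP => //= /(_ y).
by rewrite subrr M0.
Qed.

Lemma residueP M x : ideal M -> x - residue M x \in M.
Proof. by move=> /ideal0; exact: residue_sub. Qed.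

Lemma residue_eq M x y : ideal M -> x - y \in M -> residue M x = residue M y.
Proof. by move=> iM; apply: residue_congr; [exact: ideal0|exact: idealB]. Qed.

Lemma residue_mem M x : ideal M -> residue M x \in residues M.
Proof.
move=> iM; rewrite mem_filter mem_enum andbT; apply/eqP.
by apply: residue_eq => //; rewrite idealC // residueP.
Qed.

Lemma residues_congruent M i j : ideal M -> (i < size (residues M))%N ->
  (j < size (residues M))%N -> ((residues M)`_i - (residues M)`_j \in M) = (i == j).
Proof.
move=> iM i_n jn; apply/idP/eqP => [|->]; last by rewrite subrr ideal0.
have fix_residue k : (k < size (residues M))%N -> residue M (residues M)`_k = (residues M)`_k.
  by move/(mem_nth 0); rewrite mem_filter => /andP[/eqP].
move/(residue_eq iM); rewrite !fix_residue // => /eqP.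
by rewrite nth_uniq => // [/eqP|]; rewrite // filter_uniq // enum_uniq.
Qed.

Definition jacobson : {set R} := [set x | [forall M, max_ideal M ==> (x \in M)]].

Lemma jacobsonP x : reflect (forall M, max_ideal M -> x \in M) (x \in jacobson).
Proof.
rewrite inE; apply: (iffP forallP) => H M.
  by move=> mM; have := H M; rewrite mM.
by apply/implyP; exact: H.
Qed.

Lemma jacobson_ideal : ideal jacobson.
Proof.
apply: idealP.
- by apply/jacobsonP => M /max_ideal_ideal; exact: ideal0.
- move=> x y /jacobsonP xJ /jacobsonP yJ; apply/jacobsonP => M mM.
  by rewrite idealB ?max_ideal_ideal // ?xJ ?yJ.
- move=> x y /jacobsonP yJ; apply/jacobsonP => M mM.
  by rewrite idealMl ?max_ideal_ideal // yJ.
Qed.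

Lemma unitD_jacobson u x : u \is a GRing.unit -> x \in jacobson ->
  u + x \is a GRing.unit.
Proof.
move=> uu /jacobsonP xJ; apply: unit_max_ideals => M mM.
have iM := max_ideal_ideal mM.
rewrite (@ideal_subr M iM _ u) ?max_ideal_unit //.
by rewrite addrC addKr xJ.
Qed.

Definition units : {set R} := [set x | x \is a GRing.unit].

End FiniteRing.

(** * Subgraphs of unitary Cayley graphs *)

(** Besides K_{3,5}, K_{4,4} and K_7: the six-cycle K_2 x K_3 with every vertex doubled,
    and the tensor products K_2 x K_5, K_2 x K_3 x K_3 and K_3 x K_4. The
    coordinates of a vertex are its digits in a mixed radix. *)
Definition K35_adj : rel nat := fun i j => (i < 3)%N != (j < 3)%N.
Definition K44_adj : rel nat := fun i j => (i < 4)%N != (j < 4)%N.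
Definition K7_adj : rel nat := fun i j => i != j.
Definition C6x2_adj : rel nat := fun i j =>
  (i %/ 6 != j %/ 6)%N && (i %% 6 %/ 2 != j %% 6 %/ 2)%N.
Definition K2K5_adj : rel nat := fun i j => (i %/ 5 != j %/ 5)%N && (i %% 5 != j %% 5)%N.
Definition K2K3K3_adj : rel nat := fun i j =>
  [&& i %/ 9 != j %/ 9, i %% 9 %/ 3 != j %% 9 %/ 3 & i %% 3 != j %% 3]%N.
Definition K3K4_adj : rel nat := fun i j => (i %/ 4 != j %/ 4)%N && (i %% 4 != j %% 4)%N.

Lemma digits2_inj n v w : (v %/ n = w %/ n -> v %% n = w %% n -> v = w)%N.
Proof. by move=> d m; rewrite (divn_eq v n) (divn_eq w n) d m. Qed.

Lemma digits3_inj m n v w :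
  (v %/ (m * n) = w %/ (m * n) -> v %% (m * n) %/ n = w %% (m * n) %/ n ->
   v %% n = w %% n -> v = w)%N.
Proof.
move=> d1 d2 d3; apply: (digits2_inj d1); apply: (digits2_inj d2).
by rewrite !modn_dvdm ?dvdn_mull.
Qed.

Section Hosts.
Variable R : finComUnitRingType.
Implicit Types (x y z : R) (I M : {set R}).

(** The Cayley graph contains a copy, not necessarily induced, of the graph [e] on the
    numbers below [n]. *)
Definition hosts (n : nat) (e : rel nat) : Prop :=
  exists2 f : nat -> R, {in gtn n &, injective f} &
    forall i j, (i < n)%N -> (j < n)%N -> e i j -> f i - f j \is a GRing.unit.

Lemma pairwise_residues M s : ideal M -> pairwise (fun x y => x - y \notin M) s ->
  (size s <= size (residues M))%N.
Proof.
move=> iM h; rewrite -(size_map (residue M) s).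
apply: uniq_leq_size => [|_ /mapP[x _ ->]]; last exact: residue_mem.
rewrite uniq_pairwise pairwise_map; apply: sub_pairwise h => x y /=; apply: contra => /eqP e.
have -> : x - y = (x - residue M x) - (y - residue M y) by rewrite e; ring.
by apply: idealB; rewrite ?residueP.
Qed.

Lemma residues_gt1 M : max_ideal M -> (1 < size (residues M))%N.
Proof.
move=> mM; apply: (@pairwise_residues M [:: 1; 0]); first exact: max_ideal_ideal.
by rewrite /= subr0 max_ideal1.
Qed.

Lemma nat2_congruent M (i j : nat) : max_ideal M -> (i < 2)%N -> (j < 2)%N ->
  (i%:R - j%:R \in M) = (i == j).
Proof.
move=> mM; have iM := max_ideal_ideal mM; have M1 := negbTE (max_ideal1 mM).
by case: i => [|[|//]]; case: j => [|[|//]] //= _ _;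
  rewrite ?subrr ?ideal0 ?(idealC iM 0) ?subr0 ?M1.
Qed.

Let addKl x y : x + y - x = y. Proof. by rewrite addrC addKr. Qed.

(** The element [b + (c - b) * e] is [c] modulo [M] and [b] modulo the other maximal
    ideals. *)
Lemma interpolate_mem M e N b c : max_ideal M -> 1 - e \in M ->
  (forall N, max_ideal N -> N != M -> e \in N) -> max_ideal N ->
  (b + (c - b) * e \in N) = ((if N == M then c else b) \in N).
Proof.
move=> mM eM eN mN; apply: ideal_subr; first exact: max_ideal_ideal.
case: eqVneq => [->|NM].
  have -> : b + (c - b) * e - c = (b - c) * (1 - e) by ring.
  by rewrite idealMl // max_ideal_ideal.
by rewrite addKl idealMl ?eN // max_ideal_ideal.
Qed.

Lemma interpolate2_mem M e M' e' N b c c' : max_ideal M -> 1 - e \in M ->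
  (forall N, max_ideal N -> N != M -> e \in N) ->
  max_ideal M' -> 1 - e' \in M' ->
  (forall N, max_ideal N -> N != M' -> e' \in N) -> M' != M -> max_ideal N ->
  (b + (c - b) * e + (c' - b) * e' \in N) =
    ((if N == M then c else if N == M' then c' else b) \in N).
Proof.
move=> mM eM eN mM' eM' eN' MM' mN; have iN := max_ideal_ideal mN.
have [->|NM] := eqVneq N M.
  rewrite (@ideal_subr _ _ _ _ (b + (c - b) * e)); last 1 first.
  - by rewrite addKl idealMl ?eN' ?max_ideal_ideal // eq_sym.
  - by rewrite (interpolate_mem _ _ mM eM eN mM) eqxx.
  exact: max_ideal_ideal.
rewrite addrAC (@ideal_subr _ _ _ _ (b + (c' - b) * e')).
- by rewrite (interpolate_mem _ _ mM' eM' eN' mN).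
- exact: iN.
- by rewrite addKl idealMl ?eN.
Qed.

Lemma jacobson_nonunit u a : u \is a GRing.unit -> a \in jacobson R ->
  u - a \is a GRing.unit.
Proof. by move=> uu aJ; rewrite unitD_jacobson // idealN // jacobson_ideal. Qed.

Lemma nonunit_jacobson a : a \in jacobson R -> a \isn't a GRing.unit.
Proof.
move=> /jacobsonP aJ; apply/negP => au.
have [M mM _] := @nonunit_max_ideal R 0 ltac:(by rewrite unitr0).
by have := max_ideal_unit mM au; rewrite aJ.
Qed.

(** A unit minus an element of the radical is a unit, so the radical and the units form a
    complete bipartite graph. *)
Lemma hosts_jacobson p d : (p <= #|jacobson R|)%N -> (d <= #|units R|)%N ->
  hosts (p + d) (fun i j => (i < p)%N != (j < p)%N).
Proof.
move=> pJ dU.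
pose f i := if (i < p)%N then (enum (jacobson R))`_i else (enum (units R))`_(i - p).
have fJ i : (i < p)%N -> f i \in jacobson R.
  by move=> ip; rewrite /f ip -mem_enum mem_nth // -cardE (leq_trans ip).
have fU i : (p <= i)%N -> (i < p + d)%N -> f i \is a GRing.unit.
  move=> pi ipd; have : f i \in units R.
    by rewrite /f ltnNge pi /= -mem_enum mem_nth // -cardE (leq_trans _ dU) // ltn_subLR.
  by rewrite inE.
exists f => [i j|i j] ipd jpd.
  rewrite /= in ipd jpd; have [ip|pi] := ltnP i p; have [jp|pj] := ltnP j p.
  - rewrite /f ip jp => /eqP; rewrite nth_uniq ?enum_uniq //; first by move/eqP.
      by rewrite -cardE (leq_trans ip).
    by rewrite -cardE (leq_trans jp).
  - by move=> e; have := nonunit_jacobson (fJ i ip); rewrite e fU.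
  - by move=> e; have := nonunit_jacobson (fJ j jp); rewrite -e fU.
  - rewrite /f ltnNge pi ltnNge pj /= => /eqP; rewrite nth_uniq ?enum_uniq //.
    + by move/eqP; lia.
    + by rewrite -cardE (leq_trans _ dU) // ltn_subLR.
    + by rewrite -cardE (leq_trans _ dU) // ltn_subLR.
have [ip|pi] := ltnP i p; have [jp|pj] := ltnP j p => // _.
  by rewrite -opprB unitrN jacobson_nonunit ?fJ ?fU.
by rewrite jacobson_nonunit ?fJ ?fU.
Qed.

(** The units are a union of cosets of the Jacobson radical, so their number is a
    multiple of 3. *)
Lemma units_gt4 : #|jacobson R| = 3%N -> (3 < #|units R|)%N -> (4 < #|units R|)%N.
Proof.
move=> J3 U4.
have iJ := jacobson_ideal R.
have [u uU uJ] : exists2 u, u \in units R & u \notin [set 1 + x | x in jacobson R].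
  apply/subsetPn/negP => /subset_leq_card; rewrite card_imset; last exact: addrI.
  by rewrite J3 leqNgt U4.
(* two cosets of the radical, with six elements together *)
pose A := [set 1 + x | x in jacobson R] :|: [set u + x | x in jacobson R].
have AU : A \subset units R.
  apply/subsetP => y; rewrite inE => /orP[] /imsetP[x xJ ->]; rewrite inE unitD_jacobson //.
    exact: unitr1.
  by move: uU; rewrite inE.
apply: leq_trans (subset_leq_card AU); rewrite cardsU !card_imset ?J3; try exact: addrI.
suff -> : [set 1 + x | x in jacobson R] :&: [set u + x | x in jacobson R] = set0.
  by rewrite cards0.
apply/setP => y; rewrite !inE; apply/negP => /andP[/imsetP[a aJ ->] /imsetP[b bJ e]].
move/negP: uJ; apply; apply/imsetP; exists (a - b); first exact: idealB.
by rewrite addrA e addrK.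
Qed.

(** The vertex [v] is the [a v]-th residue modulo [M1], the [b v]-th modulo [M2] and [p v]
    modulo all the other maximal ideals, up to an element [t v] of the radical. Two
    vertices differ by a unit when all these digits change. *)
Lemma hosts_digits n (e : rel nat) M1 M2 (a b p : nat -> nat) (t : nat -> R) :
  max_ideal M1 -> max_ideal M2 -> M2 != M1 ->
  (forall v, (v < n)%N -> [/\ (a v < size (residues M1))%N, (b v < size (residues M2))%N,
     (p v < 2)%N & t v \in jacobson R]) ->
  (forall v w, (v < n)%N -> (w < n)%N -> a v = a w -> b v = b w ->
     (forall N, max_ideal N -> N != M1 -> N != M2 -> p v = p w) ->
     (p v = p w -> t v = t w) -> v = w) ->
  (forall v w, (v < n)%N -> (w < n)%N -> e v w -> [/\ a v != a w, b v != b w &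
     forall N, max_ideal N -> N != M1 -> N != M2 -> p v != p w]) ->
  hosts n e.
Proof.
move=> m1 m2 n21 dig inj edge.
have i1 := max_ideal_ideal m1; have i2 := max_ideal_ideal m2.
have [e1 e1M e1N] := idempotent_like m1; have [e2 e2M e2N] := idempotent_like m2.
pose s1 := residues M1; pose s2 := residues M2.
pose f v := (p v)%:R + (s1`_(a v) - (p v)%:R) * e1 + (s2`_(b v) - (p v)%:R) * e2 + t v.
have fB v w : f v - f w = ((p v)%:R - (p w)%:R) +
    ((s1`_(a v) - s1`_(a w)) - ((p v)%:R - (p w)%:R)) * e1
    + ((s2`_(b v) - s2`_(b w)) - ((p v)%:R - (p w)%:R)) * e2 + (t v - t w).
  by rewrite /f; ring.
have fN v w N : (v < n)%N -> (w < n)%N -> max_ideal N -> (f v - f w \in N) =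
    (if N == M1 then a v == a w else if N == M2 then b v == b w else p v == p w).
  move=> vn wn mN; have iN := max_ideal_ideal mN.
  have [av bv pv /jacobsonP tv] := dig v vn; have [aw bw pw /jacobsonP tw] := dig w wn.
  transitivity ((if N == M1 then s1`_(a v) - s1`_(a w) else
      if N == M2 then s2`_(b v) - s2`_(b w) else (p v)%:R - (p w)%:R) \in N).
    rewrite -(interpolate2_mem _ _ _ m1 e1M e1N m2 e2M e2N n21 mN) fB.
    by apply: (ideal_subr iN); rewrite addKl; apply: (idealB iN); [exact: tv|exact: tw].
  case: eqVneq => [->|_]; first exact: residues_congruent.
  by case: eqVneq => [->|_]; [exact: residues_congruent|exact: nat2_congruent].
have f0 v w N : max_ideal N -> f v = f w -> f v - f w \in N.
  by move=> mN ->; rewrite subrr ideal0 // max_ideal_ideal.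
exists f => [v w /[!inE] vn wn fvw|v w vn wn /(edge v w vn wn)[vw1 vw2 vw3]].
  have aE : a v = a w.
    by apply/eqP; have := f0 v w M1 m1 fvw; rewrite fN // eqxx.
  have bE : b v = b w.
    by apply/eqP; have := f0 v w M2 m2 fvw; rewrite fN // (negbTE n21) eqxx.
  apply: inj => // [N mN N1 N2|pE].
    by apply/eqP; have := f0 v w N mN fvw; rewrite fN // (negbTE N1) (negbTE N2).
  by move: fvw; rewrite /f aE bE pE => /addrI.
apply: unit_max_ideals => N mN; rewrite fN //.
by case: eqVneq => // N1; case: eqVneq => // N2; exact: vw3 mN N1 N2.
Qed.

(** The digit in {0, 1} serves [M'] and the remaining ideals alike. *)
Lemma hosts_K2K5 M M' : max_ideal M -> max_ideal M' -> M' != M ->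
  (4 < size (residues M))%N -> hosts 10 K2K5_adj.
Proof.
move=> mM mM' MM' q5.
apply: (@hosts_digits _ _ M M' (modn^~ 5) (divn^~ 5) (divn^~ 5) (fun=> 0)) => //.
- move=> v v10; have v2 : (v %/ 5 < 2)%N by rewrite ltn_divLR.
  split; [by apply: leq_trans q5; rewrite ltn_mod|exact: leq_trans (residues_gt1 mM')|
    exact: v2|exact: ideal0 (jacobson_ideal R)].
- by move=> v w _ _ m d _ _; exact: digits2_inj d m.
by move=> v w _ _ /andP[-> ->].
Qed.

(** Adding [a], which lies in every maximal ideal, gives each vertex of the six-cycle a
    twin with the same neighbours. *)
Lemma hosts_C6x2 M0 M a : max_ideal M0 -> max_ideal M -> M0 != M ->
  (2 < size (residues M))%N -> a \in jacobson R -> a != 0 -> hosts 12 C6x2_adj.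
Proof.
move=> mM0 mM MM0 q3 aJ a0.
apply: (@hosts_digits _ _ M M0 (fun v => v %% 6 %/ 2)%N (divn^~ 6) (divn^~ 6)
  (fun v => (v %% 2)%:R * a)) => //.
- move=> v v12; have v2 : (v %/ 6 < 2)%N by rewrite ltn_divLR.
  split; [|exact: leq_trans (residues_gt1 mM0)|exact: v2|exact: idealMl (jacobson_ideal R) _ _ aJ].
  by apply: leq_trans q3; rewrite ltn_divLR // ltn_mod.
- move=> v w _ _ m d _ /(_ d) t; apply: (@digits3_inj 3 2) => //.
  move: t; have := ltn_pmod v (isT : (0 < 2)%N); have := ltn_pmod w (isT : (0 < 2)%N).
  case: (v %% 2)%N => [|[|//]]; case: (w %% 2)%N => [|[|//]] // _ _;
    by rewrite mul0r mul1r => /eqP; rewrite -subr_eq0 ?sub0r ?subr0 ?oppr_eq0 (negbTE a0).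
by move=> v w _ _ /andP[-> ->].
Qed.

Lemma hosts_K2K3K3 M1 M2 M3 : max_ideal M1 -> max_ideal M2 -> max_ideal M3 ->
  M2 != M1 -> M3 != M1 -> M3 != M2 ->
  (2 < size (residues M1))%N -> (2 < size (residues M2))%N -> hosts 18 K2K3K3_adj.
Proof.
move=> m1 m2 m3 n21 n31 n32 q1 q2.
apply: (@hosts_digits _ _ M1 M2 (fun v => v %% 9 %/ 3)%N (modn^~ 3) (divn^~ 9) (fun=> 0)) => //.
- move=> v v18; split; [|by apply: leq_trans q2; rewrite ltn_mod|by rewrite ltn_divLR|
    exact: ideal0 (jacobson_ideal R)].
  by apply: leq_trans q1; rewrite ltn_divLR // ltn_mod.
- by move=> v w _ _ aE bE /(_ M3 m3 n31 n32) pE _; exact: (@digits3_inj 3 3).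
by move=> v w _ _ /and3P[-> -> ->].
Qed.

Lemma hosts_K3K4 M1 M2 : max_ideal M1 -> max_ideal M2 -> M2 != M1 ->
  (forall N, max_ideal N -> N = M1 \/ N = M2) ->
  (2 < size (residues M1))%N -> (3 < size (residues M2))%N -> hosts 12 K3K4_adj.
Proof.
move=> m1 m2 n21 only q1 q2.
apply: (@hosts_digits _ _ M1 M2 (divn^~ 4) (modn^~ 4) (fun=> 0%N) (fun=> 0)) => //.
- move=> v v12; split=> //; last exact: ideal0 (jacobson_ideal R).
    by apply: leq_trans q1; rewrite ltn_divLR.
  by apply: leq_trans q2; rewrite ltn_mod.
- by move=> v w _ _ d m _ _; exact: digits2_inj d m.
move=> v w _ _ /andP[-> ->]; split=> // N /only[] ->; by rewrite eqxx.
Qed.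

End Hosts.

(** * Recognizing the rings Z_5 and Z_3 x Z_3 *)
Section RingOrder.
Import fingroup cyclic pgroup.
Variable R : finComUnitRingType.

Lemma card_natr0 : #|R|%:R = 0 :> R.
Proof.
rewrite -cardsT.
exact: (@expg_cardG R [set: R]%G (GRing.one R) (in_setT _)).
Qed.

(** By Cauchy's theorem there are elements of additive orders 2 and 3, so in a field both
    2 and 3 would vanish. *)
Lemma field_card_neq6 : (forall x : R, x != 0 -> x \is a GRing.unit) -> #|R| != 6%N.
Proof.
move=> fld; apply/eqP => R6.
have h p : prime p -> (p %| 6)%N -> p%:R = 0 :> R.
  move=> pp p6; have [x _ ox] := @Cauchy R p [set: R]%G pp ltac:(by rewrite cardsT R6).
  have x0 : x != 0.
    by apply/eqP => x0; move: pp; rewrite -ox x0 order1.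
  have xp : x *+ p = 0 by rewrite -FinRing.zmodXgE -ox expg_order.
  by rewrite -(mulrK (fld x x0) p%:R) mulr_natl xp mul0r.
have := oner_neq0 R; suff -> : (1 : R) = 3%:R - 2%:R by rewrite !h // subrr eqxx.
by ring.
Qed.

End RingOrder.

Section RingIsomorphisms.

Lemma bijective_rmorphism_isomorphic (R S : nzRingType) (f : {rmorphism S -> R}) :
  bijective f -> ring_isomorphic R S.
Proof.
move=> [g fK gK].
have gB : zmod_morphism g by move=> x y; apply: (can_inj fK); rewrite rmorphB !gK.
have gM : monoid_morphism g.
  split; first by apply: (can_inj fK); rewrite rmorph1 gK.
  by move=> x y; apply: (can_inj fK); rewrite rmorphM !gK.
pose gA := GRing.isZmodMorphism.Build _ _ g gB.
pose gMm := GRing.isMonoidMorphism.Build _ _ g gM.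
pose h : {rmorphism R -> S} := HB.pack g gA gMm.
by exists h; exists f.
Qed.

Lemma ring_isomorphic_fun (R S : nzRingType) (g : S -> R) :
  g 1 = 1 -> {morph g : x y / x - y} -> {morph g : x y / x * y} -> bijective g ->
  ring_isomorphic R S.
Proof.
move=> g1 gB gM bg.
pose gA := GRing.isZmodMorphism.Build _ _ g gB.
pose gMm := GRing.isMonoidMorphism.Build _ _ g (g1, gM).
pose h : {rmorphism S -> R} := HB.pack g gA gMm.
exact: (@bijective_rmorphism_isomorphic R S h).
Qed.

Lemma inj_surj_bij (A : finType) (B : eqType) (f : A -> B) :
  injective f -> (forall y, exists x, f x = y) -> bijective f.
Proof.
move=> finj fsurj.
have h y : {x | f x == y} by apply: sigW; have [x <-] := fsurj y; exists x.
exists (fun y => sval (h y)) => [x|y]; last by case: (h y) => x /= /eqP.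
by apply: finj; case: (h (f x)) => x' /= /eqP.
Qed.

Lemma natr_modn (R : nzRingType) n m : n%:R = 0 :> R -> (m %% n)%:R = m%:R :> R.
Proof. by move=> n0; rewrite {2}(divn_eq m n) natrD natrM n0 mulr0 add0r. Qed.

Variable R : finComUnitRingType.

(** The map from Z_5 is injective since every nonzero residue has a multiple that is 1
    modulo 5. *)
Lemma card5_isomorphic : #|R| = 5%N -> ring_isomorphic R 'Z_5.
Proof.
move=> R5; have r5 : 5%:R = 0 :> R by rewrite -R5 card_natr0.
pose g (k : 'Z_5) : R := (k : nat)%:R.
have gB : {morph g : x y / x - y}.
  move=> x y; rewrite /g /= natr_modn // natrD natr_modn //.
  by rewrite natrB ?r5 ?sub0r // ltnW.
apply: (@ring_isomorphic_fun _ _ g) => //.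
  by move=> x y; rewrite /g /= natr_modn // natrM.
apply: inj_card_bij; last by rewrite R5 card_ord.
move=> x y /eqP; rewrite -subr_eq0 -gB => /eqP g0; apply/eqP; rewrite -subr_eq0.
move: (x - y) g0 => k; rewrite /g; case: k => k k5 /= k0; rewrite -val_eqE /=.
have one0 : (1 : R) = 0 -> k == 0%N by move/eqP; rewrite oner_eq0.
case: k k5 k0 one0 => [|[|[|[|[|//]]]]] // _ k0; apply.
- exact: k0.
- have -> : (1 : R) = 5%:R - 2%:R * 2%:R by ring.
  by rewrite r5 k0; ring.
- have -> : (1 : R) = 2%:R * 3%:R - 5%:R by ring.
  by rewrite r5 k0; ring.
- have -> : (1 : R) = 5%:R - 4%:R by ring.
  by rewrite r5 k0; ring.
Qed.

End RingIsomorphisms.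

Section Residues.
Variable R : finComUnitRingType.
Implicit Types (x y z : R) (I M N : {set R}).

(** Otherwise 0, [u] and [v] would be three different classes. *)
Lemma units_congruent N u v : max_ideal N -> (size (residues N) <= 2)%N ->
  u \is a GRing.unit -> v \is a GRing.unit -> u - v \in N.
Proof.
move=> mN n2 uu vu; apply: contraLR n2 => uvN; rewrite -ltnNge.
apply: (@pairwise_residues R N [:: 0; u; v]); first exact: max_ideal_ideal.
rewrite /= !andbT uvN !(@idealC _ _ (max_ideal_ideal mN) 0) !subr0.
by rewrite !max_ideal_unit.
Qed.

(** A field with three elements is the prime field: with 2 = 0 the elements 0, 1, x, 1 + x
    would be distinct, and with 3 <> 0 so would 0, 1, -1, 2. *)
Lemma three_residues M : max_ideal M -> size (residues M) = 3%N ->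
  [/\ 2%:R \notin M, 3%:R \in M & forall x, exists2 a, (a < 3)%N & x - a%:R \in M].
Proof.
move=> mM s3; have iM := max_ideal_ideal mM; have M1 := max_ideal1 mM.
have no4 a b c d : pairwise (fun x y => x - y \notin M) [:: a; b; c; d] -> False.
  by move=> /(pairwise_residues iM); rewrite s3.
have Ml z : (0 - z \in M) = (z \in M) by rewrite idealC // subr0.
have M2 : 2%:R \notin M.
  apply/negP => M2.
  have [x xM x1M] : exists2 x, x \notin M & 1 - x \notin M.
    have [x /andP[]|no] := pickP [pred x | (x \notin M) && (1 - x \notin M)]; first by exists x.
    have : (size (residues M) <= size [:: residue M 0; residue M 1]%R)%N; last by rewrite s3.
    apply: uniq_leq_size => [|r]; first by rewrite filter_uniq // enum_uniq.
    rewrite mem_filter => /andP[/eqP <- _]; have := no r; rewrite /= !inE.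
    case: (boolP (r \in M)) => [rM _|_ /negbFE r1].
      by rewrite (@residue_eq _ _ r 0) ?eqxx // subr0.
    by rewrite (@residue_eq _ _ r 1) ?eqxx ?orbT // idealC.
  apply: (no4 0 1 x (1 + x)); rewrite /= !andbT !Ml M1 xM x1M /=.
  have -> : 1 - (1 + x) = - x by ring.
  have -> : x - (1 + x) = - 1 by ring.
  rewrite -!(Ml (- _)) !sub0r !opprK xM M1 andbT /=.
  rewrite andbT; apply: contra x1M => h; have -> : 1 - x = 2%:R - (1 + x) by ring.
  exact: idealB.
have M3 : 3%:R \in M.
  apply: contraT => M3; exfalso; apply: (no4 0 1 (-1) 2%:R).
  rewrite /= !andbT !Ml M1 M2 (_ : 1 - -1 = 2%:R) ?M2; last by ring.
  have -> : 1 - 2%:R = - 1 :> R by ring.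
  have -> : -1 - 2%:R = - 3%:R :> R by ring.
  by rewrite -!(Ml (- _)) !sub0r !opprK M1 M3.
split=> // x; case: (boolP (x - 0 \in M)) => x0; first by exists 0%N.
case: (boolP (x - 1 \in M)) => x1; first by exists 1%N.
case: (boolP (x - 2%:R \in M)) => x2; first by exists 2.
exfalso; apply: (no4 x 0 1 2%:R); rewrite /= !andbT x0 x1 x2 !Ml M1 M2 /=.
by rewrite (_ : 1 - 2%:R = - 1 :> R) -?(Ml (- _)) ?sub0r ?opprK //; ring.
Qed.

(** The elements [e1] and [e2] of [idempotent_like] are complementary idempotents,
    since the intersection of the two ideals is 0. *)
Lemma two_ideals_isomorphic M1 M2 : max_ideal M1 -> max_ideal M2 -> M2 != M1 ->
  (forall N, max_ideal N -> N = M1 \/ N = M2) -> jacobson R = [set 0] ->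
  size (residues M1) = 3%N -> size (residues M2) = 3%N ->
  ring_isomorphic R ('Z_3 * 'Z_3)%type.
Proof.
move=> m1 m2 n21 only J0 q1 q2.
have i1 := max_ideal_ideal m1; have i2 := max_ideal_ideal m2.
have [h12 h13 h1x] := three_residues m1 q1; have [h22 h23 h2x] := three_residues m2 q2.
have [e1 e1M e1N] := idempotent_like m1; have [e2 e2M e2N] := idempotent_like m2.
have {}e1N := e1N M2 m2 n21; have {}e2N : e2 \in M1 by apply: e2N; rewrite // eq_sym.
have zero x : x \in M1 -> x \in M2 -> x = 0.
  move=> x1 x2; apply/set1P; rewrite -J0; apply/jacobsonP => N /only[] -> //.
have e12 : e2 = 1 - e1.
  apply/eqP; rewrite eq_sym -subr_eq0; apply/eqP/zero; first exact: idealB.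
  by rewrite addrAC idealB.
have r3 : 3%:R = 0 :> R by apply: zero.
have ee : e1 * e1 = e1.
  have : e1 * (1 - e1) = 0.
    by apply: zero; [apply: idealMl|apply: idealMr].
  by rewrite mulrBr mulr1 => /eqP; rewrite subr_eq0 => /eqP.
(* the Chinese remainder isomorphism, with integer representatives as coefficients *)
pose g (p : 'Z_3 * 'Z_3) : R := (p.1 : nat)%:R * e1 + (p.2 : nat)%:R * e2.
have c3 : forall k : 'Z_3, ((3 - k)%N)%:R = - (k : nat)%:R :> R.
  by move=> k; rewrite natrB ?r3 ?sub0r // ltnW.
have gB : {morph g : x y / x - y}.
  by move=> [a b] [c d]; rewrite /g /= !natr_modn // !natrD !natr_modn // !c3; ring.
apply: (@ring_isomorphic_fun _ _ g).
- by transitivity (1%:R * e1 + 1%:R * e2); rewrite // e12; ring.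
- exact: gB.
- move=> [a b] [c d]; rewrite /g /= !natr_modn // !natrM e12.
  have f2 : (1 - e1) * (1 - e1) = 1 - e1 by rewrite mulrBr mulr1 mulrBl mul1r ee subrr subr0.
  have f3 : e1 * (1 - e1) = 0 by rewrite mulrBr mulr1 ee subrr.
  transitivity ((a : nat)%:R * (c : nat)%:R * (e1 * e1) + (b : nat)%:R * (d : nat)%:R * ((1 - e1) * (1 - e1))
     + ((a : nat)%:R * (d : nat)%:R + (b : nat)%:R * (c : nat)%:R) * (e1 * (1 - e1))).
    by rewrite ee f2 f3 mulr0 addr0.
  by ring.
apply: inj_surj_bij.
  move=> x y /eqP; rewrite -subr_eq0 -gB => /eqP g0; apply/eqP; rewrite -subr_eq0.
  move: (x - y) g0 => [a b]; rewrite /g /= => g0.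
  have small M (k : 'Z_3) : max_ideal M -> 2%:R \notin M -> (k : nat)%:R \in M -> k = 0.
    move=> mM tM; have := max_ideal1 mM; case: k => [[|[|[|//]]] k3] /= => [_ _|/negbTE ->|_] //.
      by apply: val_inj.
    by rewrite (negbTE tM).
  have aM : (a : nat)%:R \in M1.
    have -> : (a : nat)%:R = (a : nat)%:R * (1 - e1) - (b : nat)%:R * e2
       + ((a : nat)%:R * e1 + (b : nat)%:R * e2) by ring.
    by rewrite g0 addr0 idealB ?idealMl.
  have bM : (b : nat)%:R \in M2.
    have -> : (b : nat)%:R = (b : nat)%:R * (1 - e2) - (a : nat)%:R * e1
       + ((a : nat)%:R * e1 + (b : nat)%:R * e2) by ring.
    by rewrite g0 addr0 idealB ?idealMl.
  by rewrite (small M1 a m1 h12 aM) (small M2 b m2 h22 bM).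
move=> y; have [a a3 aP] := h1x y; have [b b3 bP] := h2x y.
exists (Ordinal a3 : 'Z_3, Ordinal b3 : 'Z_3); apply/eqP; rewrite eq_sym -subr_eq0 /g /=.
apply/eqP/zero.
  have -> : y - (a%:R * e1 + b%:R * e2) = (y - a%:R) + a%:R * (1 - e1) - b%:R * e2 by ring.
  by apply: idealB; rewrite ?idealMl //; apply: idealD; rewrite ?idealMl.
have -> : y - (a%:R * e1 + b%:R * e2) = (y - b%:R) + b%:R * (1 - e2) - a%:R * e1 by ring.
by apply: idealB; rewrite ?idealMl //; apply: idealD; rewrite ?idealMl.
Qed.

End Residues.

(** * Rings with at least four units *)
Inductive obstruction : nat -> rel nat -> Prop :=
  | Obstruction_K35 : obstruction 8 K35_adj
  | Obstruction_K44 : obstruction 8 K44_adj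
  | Obstruction_K7 : obstruction 7 K7_adj
  | Obstruction_C6x2 : obstruction 12 C6x2_adj
  | Obstruction_K2K5 : obstruction 10 K2K5_adj
  | Obstruction_K2K3K3 : obstruction 18 K2K3K3_adj
  | Obstruction_K3K4 : obstruction 12 K3K4_adj.

Section Classification.
Variable R : finComUnitRingType.
Implicit Types (x y z : R) (I M N : {set R}).

Definition obstructed : Prop := exists n e, obstruction n e /\ hosts R n e.

(** Modulo an ideal with at most two residues all units agree, so units that agree modulo [M1]
    differ by an element of the Jacobson radical; the class of 0 contains no unit. *)
Lemma units_le_residues M1 : max_ideal M1 ->
  (forall N, max_ideal N -> N != M1 -> (size (residues N) <= 2)%N) ->
  jacobson R = [set 0] -> (#|units R| < size (residues M1))%N.
Proof.
move=> m1 small J0; have i1 := max_ideal_ideal m1.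
have rinj : {in units R &, injective (residue M1)}.
  move=> u v; rewrite !inE => uu vu e; apply/eqP; rewrite -subr_eq0 -in_set1 -J0.
  apply/jacobsonP => N mN; have [->|NM] := eqVneq N M1; last first.
    by apply: units_congruent => //; exact: small.
  have -> : u - v = (u - residue M1 u) - (v - residue M1 v) by rewrite e; ring.
  by apply: idealB; rewrite ?residueP.
(* the class of 0 is one more residue, so the inequality is strict *)
rewrite -(card_in_imset rinj) cardE.
have h0 : residue M1 0 \notin [set residue M1 u | u in units R].
  apply/negP => /imsetP[u]; rewrite inE => uu e.
  have := max_ideal_unit m1 uu; suff -> : u \in M1 by [].
  have := residueP u i1; rewrite -e => h; have := residueP 0 i1; rewrite sub0r => h0.
  have -> : u = (u - residue M1 0) - (- residue M1 0) by ring.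
  exact: idealB.
apply: (@uniq_leq_size _ (residue M1 0 :: enum [set residue M1 u | u in units R])).
  by rewrite /= mem_enum h0 enum_uniq.
move=> y; rewrite inE mem_enum => /orP[/eqP ->|/imsetP[u _ ->]]; exact: residue_mem.
Qed.

Lemma has_max_ideal : exists M : {set R}, max_ideal M.
Proof.
by have [M mM _] := @nonunit_max_ideal R 0 ltac:(by rewrite unitr0); exists M.
Qed.

(** The annihilator of [a]: the map [x |-> x * a] takes only the values 0 and [a]. *)
Lemma jacobson2_ann a : jacobson R = [set 0; a] -> a != 0 ->
  exists2 M : {set R}, max_ideal M & (size (residues M) <= 2)%N.
Proof.
move=> Ja a0; have iJ := jacobson_ideal R.
have aJ : a \in jacobson R by rewrite Ja !inE eqxx orbT.
have dich x : x * a = 0 \/ x * a = a.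
  by have := idealMl iJ x aJ; rewrite Ja !inE => /orP[] /eqP; [left|right].
pose M := [set x | x * a == 0]; have inM x : (x \in M) = (x * a == 0) by rewrite inE.
have iM : ideal M.
  apply: idealP; first by rewrite inM mul0r.
    by move=> x y; rewrite !inM mulrBl => /eqP-> /eqP->; rewrite subrr.
  by move=> x y; rewrite !inM -mulrA => /eqP->; rewrite mulr0.
exists M.
  apply: max_idealP => // [|x]; rewrite inM; first by rewrite mul1r.
  move=> /eqP xa; exists 1; rewrite inM mulr1 mulrBl mul1r.
  by case: (dich x) => [//|->]; rewrite subrr.
rewrite leqNgt; apply/negP => s3; have si i j := @residues_congruent _ M i j iM.
have := si 0%N 1%N (ltnW (ltnW s3)) (ltnW s3).
have := si 0%N 2 (ltnW (ltnW s3)) s3; have := si 1%N 2 (ltnW s3) s3.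
rewrite !inM; move: (_`_0) (_`_1) (_`_2) => x y z; rewrite !mulrBl.
case: (dich x) => ->; case: (dich y) => ->; case: (dich z) => ->; by rewrite subrr eqxx.
Qed.

Lemma field_classification M : max_ideal M -> (forall N, max_ideal N -> N = M) ->
  jacobson R = [set 0] -> (4 < size (residues M))%N ->
  obstructed \/ ring_isomorphic R 'Z_5.
Proof.
move=> mM only J0 q5.
have fld x : x != 0 -> x \is a GRing.unit.
  move=> x0; apply: contraT => /nonunit_max_ideal[N mN xN].
  have : x \in jacobson R by apply/jacobsonP => N' /only ->; rewrite -(only N).
  by rewrite J0 inE (negbTE x0).
have R5 : (4 < #|R|)%N.
  rewrite cardE; apply: leq_trans q5 _; apply: uniq_leq_size.
    by rewrite filter_uniq // enum_uniq.
  by move=> x _; rewrite mem_enum.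
have [R7|R7] := leqP 7 #|R|.
  left; exists 7, K7_adj; split; first by constructor.
  have lt i : (i < 7)%N -> (i < size (enum R))%N by move=> i7; rewrite -cardE (leq_trans i7).
  exists (fun i => (enum R)`_i) => [i j /[!inE]/= i7 j7 /eqP|i j i7 j7 ij].
    by rewrite nth_uniq ?enum_uniq ?lt // => /eqP.
  by apply: fld; rewrite subr_eq0 nth_uniq ?enum_uniq ?lt.
right; apply: card5_isomorphic; have := field_card_neq6 fld.
by move: R5 R7; case: #|R| => [|[|[|[|[|[|[|?]]]]]]].
Qed.

(** The cases are separated by the numbers of residues of the maximal ideals. If at most
    one ideal has more than two residues, there are too few units. *)
Lemma semisimple_classification : (3 < #|units R|)%N -> jacobson R = [set 0] ->
  [\/ obstructed, ring_isomorphic R 'Z_5 | ring_isomorphic R ('Z_3 * 'Z_3)%type].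
Proof.
move=> U4 J0.
have [M /andP[mM q5]|no5] := pickP (fun M : {set R} => max_ideal M && (4 < size (residues M))%N).
  have [M' /andP[mM' MM']|only] := pickP (fun N : {set R} => max_ideal N && (N != M)).
    constructor 1; exists 10, K2K5_adj; split; first by constructor.
    exact: hosts_K2K5 mM mM' MM' q5.
  case: (@field_classification M) => //.
  - by move=> N mN; have := only N; rewrite mN => /eqP.
  - by constructor 1.
  - by constructor 2.
have le4 N : max_ideal N -> (size (residues N) <= 4)%N.
  by move=> mN; have := no5 N; rewrite mN /= ltnNge => /negbFE.
pose big (N : {set R}) := max_ideal N && (2 < size (residues N))%N.
have [M1 [m1 hM1]] : exists M1 : {set R}, max_ideal M1 /\
   (big M1 \/ forall N, max_ideal N -> (size (residues N) <= 2)%N).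
  have [M1 bM1|nobig] := pickP big; first by exists M1; case/andP: (bM1) => ? _; split=> //; left.
  have [M1 m1] := has_max_ideal; exists M1; split=> //; right => N mN.
  by have := nobig N; rewrite /big mN /= ltnNge => /negbFE.
have [M2 /andP[b2 n21]|no2] := pickP (fun N : {set R} => big N && (N != M1)); last first.
  suff : (#|units R| < size (residues M1))%N by rewrite ltnNge (leq_trans (le4 M1 m1)).
  apply: units_le_residues => // N mN NM.
  by have := no2 N; rewrite /big mN NM andbT /= ltnNge => /negbFE.
have [m2 q2] := andP b2.
have {hM1} q1 : (2 < size (residues M1))%N.
  case: hM1 => [/andP[]//|/(_ M2 m2)]; by rewrite leqNgt q2.
have [M3 /and3P[m3 n31 n32]|only] := pickP (fun N : {set R} => [&& max_ideal N, N != M1 & N != M2]).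
  constructor 1; exists 18, K2K3K3_adj; split; first by constructor.
  exact: hosts_K2K3K3 m1 m2 m3 n21 n31 n32 q1 q2.
have {}only N : max_ideal N -> N = M1 \/ N = M2.
  move=> mN; have := only N; rewrite mN /=.
  by case: eqVneq => [|_]; [left|case: eqVneq; [right|]].
have [q2'|q2'] := ltnP 3 (size (residues M2)).
  constructor 1; exists 12, K3K4_adj; split; first by constructor.
  exact: hosts_K3K4 m1 m2 n21 only q1 q2'.
have [q1'|q1'] := ltnP 3 (size (residues M1)).
  constructor 1; exists 12, K3K4_adj; split; first by constructor.
  by apply: (hosts_K3K4 m2 m1) => //; [rewrite eq_sym|move=> N /only[]; [right|left]].
constructor 3; apply: (two_ideals_isomorphic m1 m2) => //; apply/eqP;
  by rewrite eqn_leq ?q1 ?q2 ?q1' ?q2'.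
Qed.

Theorem ring_classification : (3 < #|units R|)%N ->
  [\/ obstructed, ring_isomorphic R 'Z_5 | ring_isomorphic R ('Z_3 * 'Z_3)%type].
Proof.
move=> U4; have J0 : 0 \in jacobson R := ideal0 (jacobson_ideal R).
have [J4|J4] := leqP 4 #|jacobson R|.
  constructor 1; exists 8, K44_adj; split; first by constructor.
  exact: (@hosts_jacobson R 4 4).
have [J3|J3] := leqP 3 #|jacobson R|.
  constructor 1; exists 8, K35_adj; split; first by constructor.
  apply: (@hosts_jacobson R 3 5) => //; apply: units_gt4 => //.
  by apply/eqP; rewrite eqn_leq J3 -ltnS J4.
have [a aJ|J1] := pickP [pred a in jacobson R | a != 0]; last first.
  apply: semisimple_classification => //; apply/setP => x.
  apply/idP/set1P => [xJ|->//]; by have := J1 x; rewrite /= xJ /= => /negbFE/eqP->.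
case/andP: aJ => /= aJ a0.
have Ja : jacobson R = [set 0; a].
  apply/esym/eqP; rewrite eqEcard cards2 eq_sym a0 -ltnS J3 andbT.
  by rewrite finset.subUset !sub1set J0 aJ.
have [M0 m0 q0] := jacobson2_ann Ja a0.
have [M /andP[mM q3]|small] := pickP (fun M : {set R} => max_ideal M && (2 < size (residues M))%N).
  constructor 1; exists 12, C6x2_adj; split; first by constructor.
  apply: (hosts_C6x2 m0 mM _ q3 aJ a0).
  by apply/eqP => e; move: q3; rewrite -e ltnNge q0.
exfalso; have : units R \subset [set 1 + x | x in jacobson R].
  apply/subsetP => u; rewrite inE => uu; apply/imsetP; exists (u - 1); last by ring.
  apply/jacobsonP => N mN; apply: units_congruent => //; last exact: unitr1.
  by have := small N; rewrite mN /= ltnNge => /negbFE.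
move/subset_leq_card; rewrite card_imset; last exact: addrI.
by move=> /(leq_trans U4)/ltnW h; move: J3; rewrite ltnNge h.
Qed.

End Classification.

From mathcomp Require Import lra.
Import Order.TTheory Num.Theory.

(** * Orientations of vectors and crossings of segments *)

Ltac split_andb := repeat match goal with
  | H : is_true (_ && _) |- _ => let H1 := fresh in let H2 := fresh in
      case/andP: H => H1 H2 end.

HB.lock Definition det3 (K : realFieldType) (a b c : 'rV[K]_3) : K :=
  a 0 0 * (b 0 1 * c 0 2%:R - b 0 2%:R * c 0 1)
  - a 0 1 * (b 0 0 * c 0 2%:R - b 0 2%:R * c 0 0)
  + a 0 2%:R * (b 0 0 * c 0 1 - b 0 1 * c 0 0).

Section Chirotope.
Variable K : realFieldType.
Implicit Types a b c d o q u v w x y z : 'rV[K]_3.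

Definition ori a b c : bool := det3 a b c < 0.

Definition gen3 a b c : bool := det3 a b c != 0.

Fixpoint gen_pairs a (s : seq 'rV[K]_3) : bool :=
  if s is b :: s' then all (gen3 a b) s' && gen_pairs a s' else true.

Fixpoint gen_pos (s : seq 'rV[K]_3) : bool :=
  if s is a :: s' then gen_pairs a s' && gen_pos s' else true.

Lemma det3_rot a b c : det3 b c a = det3 a b c.
Proof. by rewrite !det3.unlock; ring. Qed.

Lemma det3_swap a b c : det3 b a c = - det3 a b c.
Proof. by rewrite !det3.unlock; ring. Qed.

Lemma det3N a b c : det3 a b (- c) = - det3 a b c.
Proof. by rewrite !det3.unlock !mxE; ring. Qed.

Lemma ori_rot a b c : ori b c a = ori a b c.
Proof. by rewrite /ori det3_rot. Qed.

Lemma lt0_opp (k : K) : k != 0 -> (- k < 0) = ~~ (k < 0).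
Proof. by move=> k0; rewrite oppr_lt0 -leNgt le_eqVlt eq_sym (negbTE k0). Qed.

Lemma ori_swap a b c : gen3 a b c -> ori b a c = ~~ ori a b c.
Proof. by move=> g; rewrite /ori (det3_swap a b c) lt0_opp. Qed.

Lemma oriN a b c : gen3 a b c -> ori a b (- c) = ~~ ori a b c.
Proof. by move=> g; rewrite /ori det3N lt0_opp. Qed.

Lemma gen3_rot a b c : gen3 b c a = gen3 a b c.
Proof. by rewrite /gen3 det3_rot. Qed.

Lemma gen3_swap a b c : gen3 b a c = gen3 a b c.
Proof. by rewrite /gen3 (det3_swap a b c) oppr_eq0. Qed.

Lemma gen3N a b c : gen3 a b (- c) = gen3 a b c.
Proof. by rewrite /gen3 det3N oppr_eq0. Qed.

Lemma ori_acb a b c : gen3 a b c -> ori a c b = ~~ ori a b c.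
Proof. by move=> g; rewrite -(ori_rot a c b) -(ori_rot a b c) ori_swap // gen3_rot. Qed.

Lemma ori_cab a b c : ori c a b = ori a b c.
Proof. by rewrite ori_rot ori_rot. Qed.

(** Points of the sphere are rays, so two arcs cross when the open cones spanned by their
    ends meet. In the projective plane points are lines, and the cones may meet up to the
    sign of one of them, which leaves out the last comparison. *)
Definition sphere_cross u v w z : bool :=
  [&& ori u v w (+) ori u v z, ori w z u (+) ori w z v & ori w z u (+) ori u v w].
Definition plane_cross u v w z : bool :=
  (ori u v w (+) ori u v z) && (ori w z u (+) ori w z v).

(** Up to the sign of [det3 a b c], the three orientations are the signs of the
    coordinates of [x] in the basis [a, b, c]. *)
Definition plane_inside x a b c : bool :=
  (ori a b x == ori b c x) && (ori b c x == ori c a x).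
Definition sphere_inside x a b c : bool := plane_inside x a b c && (ori c a x == ori a b c).

(** In a relation [A - B + C = 0] between nonzero products, [A] and [C] cannot both have
    the sign opposite to that of [B]; the arguments are the signs of the factors. *)
Definition sign_compatible (p q r t u v : bool) :=
  ~~ ((p (+) q == ~~ (r (+) t)) && (p (+) q == u (+) v)).

Lemma grassmann_plucker a b c d e : gen_pos [:: a; b; c; d; e] ->
  sign_compatible (ori a b c) (ori a d e) (ori a b d) (ori a c e)
    (ori a b e) (ori a c d).
Proof.
have gp : det3 a b c * det3 a d e - det3 a b d * det3 a c e
          + det3 a b e * det3 a c d = 0 by rewrite !det3.unlock; ring.
move=> H; simpl in H; split_andb; move: gp.
have sg x1 y1 z1 x2 y2 z2 : gen3 x1 y1 z1 -> gen3 x2 y2 z2 ->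
   ori x1 y1 z1 (+) ori x2 y2 z2 = (det3 x1 y1 z1 * det3 x2 y2 z2 < 0).
  by rewrite /gen3 /ori => m0 n0; rewrite mulr_lt0 m0 n0.
rewrite /sign_compatible !sg //.
have nz x1 y1 z1 x2 y2 z2 : gen3 x1 y1 z1 -> gen3 x2 y2 z2 ->
   (det3 x1 y1 z1 * det3 x2 y2 z2) != 0 by move=> *; rewrite mulf_neq0.
have := nz a b c a d e; have := nz a b d a c e; have := nz a b e a c d.
move: (_ * _) (_ * _) (_ * _) => A B C.
do 3 move=> /(_ ltac:(assumption) ltac:(assumption)) ?.
move=> gp; apply/negP => /andP[/eqP e1 /eqP e2].
by move: e1 e2; case: (ltrgt0P A); case: (ltrgt0P B); case: (ltrgt0P C) => //; lra.
Qed.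

Lemma gen_pos_rot a s : gen_pos (a :: s) -> gen_pos (rcons s a).
Proof.
have cat x s1 y : gen_pairs x (rcons s1 y) = gen_pairs x s1 && all (gen3 y x) s1.
  elim: s1 => //= b s1 ->; rewrite all_rcons gen3_rot.
  by rewrite -!andbA; do !bool_congr.
rewrite /=; elim: s => //= b s IHs /andP[/andP[ab as'] /andP[bs s_]].
rewrite cat bs /= IHs ?as' // andbT.
by rewrite ab.
Qed.

(** Here and below [m] is true for the projective plane and false for the sphere. *)
Definition cross (m : bool) u v w z := if m then plane_cross u v w z else sphere_cross u v w z.
Definition inside (m : bool) x a b c := if m then plane_inside x a b c else sphere_inside x a b c.

(** A segment crosses the boundary of a triangle an odd number of times exactly when it
    joins the inside to the outside. This depends on the signs of ten determinants only,
    and holds for all the sign patterns that are compatible with the five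
    Grassmann-Pluecker relations. *)
Lemma cross_triangle m o c d w z : gen_pos [:: o; c; d; w; z] ->
  cross m o c w z (+) cross m c d w z (+) cross m o d w z =
  inside m w o c d (+) inside m z o c d.
Proof.
move=> H.
have g1 := grassmann_plucker H; have H1 := gen_pos_rot H.
have g2 := grassmann_plucker H1; have H2 := gen_pos_rot H1.
have g3 := grassmann_plucker H2; have H3 := gen_pos_rot H2.
have g4 := grassmann_plucker H3; have H4 := gen_pos_rot H3.
have g5 := grassmann_plucker H4.
rewrite /= in g1 g2 g3 g4 g5; move: g1 g2 g3 g4 g5.
clear H1 H2 H3 H4; simpl in H; split_andb.
rewrite /inside /cross /sphere_inside /sphere_cross /plane_inside /plane_cross.
rewrite (@ori_swap o d w) // (@ori_swap o d z) //.
rewrite ?(ori_rot o c d) ?(ori_rot o c w) ?(ori_rot o d w) ?(ori_rot o c z) ?(ori_rot o d z)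
  ?(ori_rot o w z) ?(ori_rot c d w) ?(ori_rot c d z) ?(ori_rot c w z) ?(ori_rot d w z).
rewrite ?(ori_cab o c d) ?(ori_cab o c w) ?(ori_cab o d w) ?(ori_cab o c z) ?(ori_cab o d z)
  ?(ori_cab o w z) ?(ori_cab c d w) ?(ori_cab c d z) ?(ori_cab c w z) ?(ori_cab d w z).
move: (ori o c d) (ori o c w) (ori o d w) (ori o c z) (ori o d z) (ori o w z).
move: (ori c d w) (ori c d z) (ori c w z) (ori d w z) => [] [] [] [].
all: case: m; rewrite /sign_compatible.
all: by do 6! case.
Qed.

End Chirotope.

(** * The parity of the crossings of two chains *)
Section PathCrossings.
Variable K : realFieldType.
Implicit Types (a b d o q u v w x y z : 'rV[K]_3) (c f : nat -> 'rV[K]_3).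
Implicit Types (m : bool) (n k : nat).

(** A comparison of the directions of [x] and [y] seen from [o], cut open at the
    direction of [q]; for the role that it plays see [cross_ray]. *)
Definition before o q x y : bool :=
  if ori o q x == ori o q y then ori o x y else ori o q x.

(** The crossing of [ox] with [yz] is expressed by the position of [x] with respect to
    the triangle [oyz], a term that telescopes when [yz] runs through a chain, and a term
    that does not depend on [x]. *)
Lemma cross_ray m o q x y z : gen_pos [:: o; q; x; y; z] ->
  cross m o x y z = inside m x o y z (+) before o q x y (+) before o q x z
    (+) ((ori o q y (+) ori o q z) && (ori o y z == ori o q z)).
Proof.
move=> H; have := grassmann_plucker H.
simpl in H; split_andb.
rewrite /inside /cross /sphere_inside /sphere_cross /plane_inside /plane_cross /before.
rewrite (ori_rot o y z) (ori_rot x y z).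
rewrite (@ori_acb _ o x y) // (ori_cab o x z).
rewrite /sign_compatible.
move: (ori o x y) (ori o x z) (ori o y z) (ori x y z) => [] [] [] [];
move: (ori o q x) (ori o q y) (ori o q z) => [] [] [] //; by case: m.
Qed.

Lemma before_antisym o q x y : gen_pos [:: o; q; x; y] ->
  before o q y x = ~~ before o q x y.
Proof.
move=> H; simpl in H; split_andb; rewrite /before (@ori_acb _ o x y) // eq_sym.
by case: (ori o q x); case: (ori o q y); case: ori.
Qed.

Lemma telescope_addb n (g : nat -> bool) :
  \big[addb/false]_(i < n) (g i (+) g i.+1) = g 0 (+) g n.
Proof.
elim: n => [|n IHn]; first by rewrite big_ord0 addbb.
by rewrite big_ord_recr /= IHn addbA -(addbA (g 0)) addbb addbF.
Qed.

Definition crossings m c n f k : bool :=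
  \big[addb/false]_(i < n) \big[addb/false]_(j < k)
    cross m (c i) (c i.+1) (f j) (f j.+1).

Definition winding m o c n x : bool :=
  \big[addb/false]_(i < n) inside m x o (c i) (c i.+1).

(** Contracting the chain [c] to [o] through the triangles [o, c i, c i.+1]: by
    [cross_triangle] the parity changes by winding numbers around the ends of [f], and
    the crossings with the first and the last ray remain. *)
Lemma crossings_cone m o c n f k :
  (forall i j, (i < n)%N -> (j < k)%N ->
    gen_pos [:: o; c i; c i.+1; f j; f j.+1]) ->
  crossings m c n f k =
    winding m o c n (f 0) (+) winding m o c n (f k)
    (+) \big[addb/false]_(j < k) cross m o (c 0) (f j) (f j.+1)
    (+) \big[addb/false]_(j < k) cross m o (c n) (f j) (f j.+1).
Proof.
move=> H; rewrite -(telescope_addb k (fun j => winding m o c n (f j))).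
rewrite -!big_split /= /crossings exchange_big; apply: eq_bigr => j _.
rewrite -addbA -(telescope_addb n (fun i => cross m o (c i) (f j) (f j.+1))).
rewrite -!big_split /=; apply: eq_bigr => i _.
have := cross_triangle m (H i j (ltn_ord i) (ltn_ord j)).
by do !case: (cross _ _ _ _ _); do !case: (inside _ _ _ _ _).
Qed.

Lemma ray_crossings m o q x f k :
  (forall j, (j < k)%N -> gen_pos [:: o; q; x; f j; f j.+1]) ->
  \big[addb/false]_(j < k) cross m o x (f j) (f j.+1) =
    winding m o f k x (+) before o q x (f 0) (+) before o q x (f k)
    (+) \big[addb/false]_(j < k) ((ori o q (f j) (+) ori o q (f j.+1))
          && (ori o (f j) (f j.+1) == ori o q (f j.+1))).
Proof.
move=> H; rewrite -addbA -!addbA (addbA (before _ _ _ _)).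
rewrite -(telescope_addb k (fun j => before o q x (f j))) -!big_split /=.
by apply: eq_bigr => j _; rewrite (cross_ray m (H j (ltn_ord j))) -!addbA.
Qed.

(** The rays towards [c 0] and [c n] contribute the same last sum of [ray_crossings], so
    it cancels. No term that remains involves both chains. *)
Lemma crossings_parity m o q c n f k : (0 < n)%N -> (0 < k)%N ->
  (forall i j, (i < n)%N -> (j < k)%N ->
    gen_pos [:: o; q; c i; c i.+1; f j; f j.+1]) ->
  crossings m c n f k =
    winding m o c n (f 0) (+) winding m o c n (f k)
    (+) winding m o f k (c 0) (+) winding m o f k (c n)
    (+) before o q (c 0) (f 0) (+) before o q (c 0) (f k)
    (+) before o q (c n) (f 0) (+) before o q (c n) (f k).
Proof.
move=> n0 k0 H; rewrite (@crossings_cone m o) => [|i j ilt jlt]; last first.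
  by have := H i j ilt jlt => /= H1; split_andb; do ![apply/andP; split].
rewrite !(@ray_crossings m o q) => [|j jlt|j jlt].
- move: (winding _ _ _ _ _) (winding _ _ _ _ _) (winding _ _ _ _ _)
    (winding _ _ _ _ _) (\big[_/_]_(_ < _) _).
  by do 5!case; do 4!case: (before _ _ _ _).
- have := H n.-1 j _ jlt; rewrite prednK // => /(_ (leqnn _)) /= H1.
  by split_andb; do ![apply/andP; split].
- have := H 0 j n0 jlt => /= H1.
  by split_andb; do ![apply/andP; split].
Qed.

End PathCrossings.

(** * Crossing parities of an embedded graph *)

(** What an embedding leaves behind once a vector is chosen for every vertex. The bit
    [sgn x y] tells whether the edge, lifted to the sphere from the vector of [x], ends at
    the antipode of the vector of [y]; [wind x y z] collects the terms of
    [crossings_parity] that depend on the edge [xy] and the vertex [z], and [tour x z]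
    those that depend on two vertices. *)
Record parity_data (m : bool) (V : eqType) (adj : rel V) := ParityData {
  sgn : V -> V -> bool;
  wind : V -> V -> V -> bool;
  tour : V -> V -> bool;
  sgn_planar : m = false -> forall x y, sgn x y = false;
  sgn_sym : forall x y, sgn y x = sgn x y;
  wind_sym : forall x y z, wind y x z = wind x y z;
  tour_anti : forall x y, x != y -> tour y x = ~~ tour x y;
  parity_eq : forall x y z w, adj x y -> adj z w -> uniq [:: x; y; z; w] ->
    sgn x y && sgn z w =
    wind x y z (+) wind x y w (+) wind z w x (+) wind z w y
    (+) tour x z (+) tour x w (+) tour y z (+) tour y w }.

Lemma uniq4E (T : eqType) (x y z w : T) : uniq [:: x; y; z; w] =
  [&& x != y, x != z, x != w, y != z, y != w & z != w].
Proof. by rewrite /= !inE !negb_or andbT -!andbA. Qed.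

(** A drawing provides these bits for oriented edges, and the two orientations of an edge
    may disagree; the orientation from the vertex that comes first in an enumeration is
    used throughout. *)
Lemma symmetrize_parity (m : bool) (V : finType) (adj : rel V)
    (h : V -> V -> bool) (wd : V -> V -> V -> bool) (tr : V -> V -> bool) :
  symmetric adj ->
  (m = false -> forall x y, h x y = false) ->
  (forall x y, x != y -> tr y x = ~~ tr x y) ->
  (forall x y z w, adj x y -> adj z w -> uniq [:: x; y; z; w] ->
    h x y && h z w = wd x y z (+) wd x y w (+) wd z w x (+) wd z w y
    (+) tr x z (+) tr x w (+) tr y z (+) tr y w) ->
  inhabited (parity_data m adj).
Proof.
move=> asym h0 tra eqn.
pose lt (x y : V) := (enum_rank x < enum_rank y)%N.
pose h' x y := if lt x y then h x y else h y x.
pose wd' x y z := if lt x y then wd x y z else wd y x z.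
have hs x y : h' y x = h' x y.
  rewrite /h' /lt; case: ltngtP => // /val_inj /enum_rank_inj ->//.
have ws x y z : wd' y x z = wd' x y z.
  rewrite /wd' /lt; case: ltngtP => // /val_inj /enum_rank_inj ->//.
constructor; apply: (@ParityData m V adj h' wd' tr) => //.
  by move=> m0 x y; rewrite /h' !h0 //; case: ifP.
move=> x y z w xy zw uq; rewrite /h' /wd'.
have yx : adj y x by rewrite asym.
have wz : adj w z by rewrite asym.
have [u1 u2 u3] : [/\ uniq [:: y; x; z; w], uniq [:: x; y; w; z] & uniq [:: y; x; w; z]].
  move: uq; rewrite !uniq4E (eq_sym y x) (eq_sym w z).
  by move=> u4; split_andb; split; do ![apply/andP; split].
case: (lt x y); case: (lt z w).
- exact: eqn.
- rewrite (eqn _ _ _ _ xy wz) //.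
  by do 4!case: (wd _ _ _); do 4!case: (tr _ _).
- rewrite (eqn _ _ _ _ yx zw) //.
  by do 4!case: (wd _ _ _); do 4!case: (tr _ _).
- rewrite (eqn _ _ _ _ yx wz) //.
  by do 4!case: (wd _ _ _); do 4!case: (tr _ _).
Qed.

Section PolygonalDrawing.
Variables (K : realFieldType) (m : bool) (V : finType) (adj : rel V).
Hypothesis asym : symmetric adj.
Variables (o q : 'rV[K]_3) (P : V -> 'rV[K]_3).
Variables (len : V -> V -> nat) (L : V -> V -> nat -> 'rV[K]_3).
Variable (h : V -> V -> bool).
Hypothesis h_planar : m = false -> forall x y, h x y = false.
Hypothesis P_half : m -> forall x, ori o q (P x) = false.
Hypothesis P_gen : forall x y, x != y -> gen_pos [:: o; q; P x; P y].
Hypothesis len_gt0 : forall x y, adj x y -> (0 < len x y)%N.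
Hypothesis L0 : forall x y, adj x y -> L x y 0 = P x.
Hypothesis Llen : forall x y, adj x y -> L x y (len x y) = (-1) ^+ h x y *: P y.
Hypothesis L_gen : forall x y z w, adj x y -> adj z w -> uniq [:: x; y; z; w] ->
  forall i j, (i < len x y)%N -> (j < len z w)%N ->
  gen_pos [:: o; q; L x y i; L x y i.+1; L z w j; L z w j.+1].
Hypothesis L_cross : forall x y z w, adj x y -> adj z w -> uniq [:: x; y; z; w] ->
  forall i j, (i < len x y)%N -> (j < len z w)%N ->
  ~~ cross m (L x y i) (L x y i.+1) (L z w j) (L z w j.+1).

Lemma inside_sign (x a b c : 'rV[K]_3) (e : bool) :
  gen_pos [:: a; b; c; x] -> (e -> m) ->
  inside m ((-1) ^+ e *: x) a b c = inside m x a b c.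
Proof.
case: e => [g /(_ isT) ->|_ _]; last by rewrite scale1r.
rewrite /= in g; split_andb.
rewrite scaleN1r /inside /sphere_inside /plane_inside (@oriN _ a b x) // (@oriN _ b c x) //.
rewrite (@oriN _ c a x); last by rewrite gen3_swap.
by do !case: ori.
Qed.

(** The product of signs in [parity_eq] comes from the last term, which appears when both
    vectors are replaced by their antipodes. *)
Lemma before_sign (x y : 'rV[K]_3) (d e : bool) : gen_pos [:: o; q; x; y] ->
  (d -> m) -> (e -> m) -> 
  (m -> ori o q x = false) -> (m -> ori o q y = false) ->
  before o q ((-1) ^+ d *: x) ((-1) ^+ e *: y) =
   before o q x y (+) (d && before o q x y) (+) (e && before o q x y) (+) d (+) (d && e).
Proof.
move=> g hd he hx hy; simpl in g; split_andb.
have [m0|m1] := boolP m; last first.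
  move: hd he; rewrite (negbTE m1); case: d => [/(_ isT)//|]; case: e => [_ /(_ isT)//|].
  by rewrite !scale1r; case: before.
have hx' := hx m0; have hy' := hy m0; rewrite /before.
have ex : ori o q (- x) by rewrite oriN // hx'.
have ey : ori o q (- y) by rewrite oriN // hy'.
have exy : ori o (- x) (- y) = ori o x y.
  have g' : gen3 o (- x) y by rewrite gen3_rot gen3N -gen3_rot.
  rewrite oriN // (ori_rot y o (- x)) oriN ?negbK ?(ori_rot y o x) //.
  by rewrite -gen3_rot.
by case: d {hd}; case: e {he};
  rewrite ?scale1r ?scaleN1r ?ex ?ey ?exy ?hx' ?hy' /=; case: (ori o x y).
Qed.

Lemma winding_end x y z w : adj x y -> adj z w -> uniq [:: x; y; z; w] ->
  winding m o (L x y) (len x y) ((-1) ^+ h z w *: P w) =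
  winding m o (L x y) (len x y) (P w).
Proof.
move=> xy zw uq; apply: eq_bigr => i _; apply: inside_sign; last first.
  by case: (m) h_planar => // /(_ erefl) ->.
have := L_gen xy zw uq (ltn_ord i) (j := (len z w).-1).
rewrite prednK ?len_gt0 // leqnn => /(_ isT) /= g; rewrite Llen // in g.
move: g; case: (h z w); rewrite ?scaleN1r ?scale1r ?gen3N => g; split_andb;
  by do ![apply/andP; split].
Qed.

(** This is [crossings_parity] for two chains that do not cross. A chain may end at the
    antipode of the vector of its last vertex: [inside] is insensitive to this, while
    [before] changes according to [before_sign]. *)
Lemma polygonal_parity : inhabited (parity_data m adj).
Proof.
pose wd x y z := winding m o (L x y) (len x y) (P z)
                 (+) (h x y && before o q (P y) (P z)).
apply: (@symmetrize_parity m V adj h wd (fun x y => before o q (P x) (P y))) => //.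
  by move=> x y xy; apply: before_antisym; apply: P_gen.
move=> x y z w xy zw uq.
have hm x1 y1 : h x1 y1 -> m by case: (m) h_planar => // /(_ erefl) ->.
have := crossings_parity m (len_gt0 xy) (len_gt0 zw) (L_gen xy zw uq).
have -> : crossings m (L x y) (len x y) (L z w) (len z w) = false.
  apply: big1 => i _; apply: big1 => j _; apply/negbTE.
  exact: (L_cross xy zw uq).
rewrite (L0 xy) (L0 zw) (Llen xy) (Llen zw).
rewrite (winding_end xy zw uq) (winding_end zw xy); last first.
  by move: uq; rewrite (uniq_catC [:: x; y] [:: z; w]).
have bs u v (d e : bool) : u != v -> (d -> m) -> (e -> m) ->
  before o q ((-1) ^+ d *: P u) ((-1) ^+ e *: P v) = 
  before o q (P u) (P v) (+) (d && before o q (P u) (P v))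
  (+) (e && before o q (P u) (P v)) (+) d (+) (d && e).
  by move=> uv hd he; apply: before_sign => //; [exact: P_gen|move/P_half|move/P_half].
have [xz xw yz yw] : [/\ x != z, x != w, y != z & y != w].
  by move: uq; rewrite uniq4E => u4; split_andb.
rewrite (bs y w) //; try exact: hm.
have := bs x w false (h z w) xw ltac:(by []) (@hm z w); rewrite scale1r => ->.
have := bs y z (h x y) false yz (@hm x y) ltac:(by []); rewrite scale1r => ->.
rewrite /wd (before_antisym (P_gen yw)) (before_antisym (P_gen xw)).
case: (h x y); case: (h z w) => /=;
do 4!case: (winding _ _ _ _ _); do 4!case: (before _ _ _ _) => //.
Qed.

End PolygonalDrawing.

(** * Perturbation into general position *)
Section GeneralPosition.
Variable K : realFieldType.

Lemma ord3P (l : 'I_3) : [\/ l = 0, l = 1 | l = 2%:R].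
Proof.
by case: l => [[|[|[|//]]] i]; [constructor 1|constructor 2|constructor 3]; apply: val_inj.
Qed.

Lemma row3P (u v : 'rV[K]_3) :
  u 0 0 = v 0 0 -> u 0 1 = v 0 1 -> u 0 2%:R = v 0 2%:R -> u = v.
Proof.
by move=> e0 e1 e2; apply/rowP => l; have [->|->|->] := ord3P l.
Qed.

Definition vec3 (a b c : K) : 'rV[K]_3 := \row_(l < 3) [:: a; b; c]`_l.

(** Three points of the moment curve are independent, by the Vandermonde determinant. *)
Definition moment (r : nat) : 'rV[K]_3 := vec3 1 r%:R (r%:R ^+ 2).

Lemma vec3E a b c : (vec3 a b c 0 0 = a) * (vec3 a b c 0 1 = b)
  * (vec3 a b c 0 2%:R = c).
Proof. by rewrite /vec3 !mxE. Qed.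

(** Among [size p] candidates below [e] one is not a root. *)
Lemma nonroot_near0 (p : {poly K}) (e : K) : p != 0 -> 0 < e ->
  exists t, [/\ 0 < t, t <= e & ~~ root p t].
Proof.
move=> p0 e0.
pose ts := [seq e / i.+1%:R | i <- iota 0 (size p)].
have uts : uniq ts.
  rewrite map_inj_uniq ?iota_uniq // => i j /mulfI.
  by rewrite gt_eqF // => /(_ isT) /invr_inj /(@Num.Theory.mulrIn _ 1 (oner_neq0 _)) [].
have : ~~ all (root p) ts.
  apply/negP => ats; have := max_poly_roots p0 ats uts.
  by rewrite size_map size_iota ltnn.
case/allPn => t /mapP[i _ ->] ni; exists (e / i.+1%:R); split => //.
  by rewrite divr_gt0.
by rewrite ler_pdivrMr // ler_peMr ?(ltW e0) // ler1n.
Qed.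

(** Each point is moved by [t] times its own point of the moment curve. A determinant of
    three points is then a polynomial in [t] whose leading coefficient is a Vandermonde
    determinant, so a small [t] exists at which none of them vanishes. *)
Lemma perturbation (T : finType) (B : T -> 'rV[K]_3) (e : K) : 0 < e ->
  exists v : T -> 'rV[K]_3, (forall i l, `|v i 0 l - B i 0 l| <= e) /\
   forall i j k, uniq [:: i; j; k] -> gen3 (v i) (v j) (v k).
Proof.
move=> e0.
pose M i := moment (enum_rank (i : T)).
pose p (s : T * T * T) := let: (i, j, k) := s in
  Poly [:: det3 (B i) (B j) (B k);
   det3 (M i) (B j) (B k) + det3 (B i) (M j) (B k) + det3 (B i) (B j) (M k);
   det3 (B i) (M j) (M k) + det3 (M i) (B j) (M k) + det3 (M i) (M j) (B k);
   det3 (M i) (M j) (M k)].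
have pE i j k t : (p (i, j, k)).[t] =
    det3 (B i + t *: M i) (B j + t *: M j) (B k + t *: M k).
  rewrite /p horner_Poly /= !det3.unlock !mxE /=.
  by ring.
have p0 i j k : uniq [:: i; j; k] -> p (i, j, k) != 0.
  rewrite /= !inE negb_or andbT => /andP[/andP[ij ik] jk].
  suff V0 : det3 (M i) (M j) (M k) != 0.
    apply: contraNneq V0 => q0.
    have {}q0 : p (i, j, k) = 0 := q0.
    have : (p (i, j, k))`_3 = 0 by rewrite q0 coef0.
    by rewrite /p coef_Poly /= => ->.
  pose r (u : T) : K := (enum_rank u)%:R.
  have -> : det3 (M i) (M j) (M k) = (r j - r i) * (r k - r i) * (r k - r j).
    by rewrite det3.unlock /M /moment !vec3E /r; ring.
  have sub u v : u != v -> (enum_rank v)%:R - (enum_rank u)%:R != 0 :> K.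
    move=> uv; rewrite subr_eq0 eqr_nat; apply: contra uv => /eqP.
    by move/val_inj/enum_rank_inj->.
  by rewrite !mulf_neq0 // sub.
pose P := \prod_(s : T * T * T | uniq [:: s.1.1; s.1.2; s.2]) p s.
have P0 : P != 0 by apply/prodf_neq0 => -[[i j] k]; exact: p0.
pose N : K := (#|T| ^ 2).+1%:R.
have N0 : 0 < N by rewrite ltr0n.
have [t [t0 te tP]] := nonroot_near0 P0 (divr_gt0 e0 N0).
exists (fun i => B i + t *: M i); split => [i l|i j k u].
  have -> : (B i + t *: M i) 0 l - B i 0 l = t * M i 0 l.
    by rewrite !mxE addrC addKr.
  have : 0 <= (vec3 1 (enum_rank i)%:R ((enum_rank i)%:R ^+ 2)) 0 l <= N.
    have : (enum_rank i < #|T|)%N by exact: ltn_ord.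
    rewrite /vec3 mxE /N.
    move: (nat_of_ord (enum_rank i)) => a; move: #|T| => n an.
    case: l => [[|[|[|//]]] /= _].
    - by rewrite ler01 ler1n.
    - by rewrite ler0n ler_nat -mulnn; nia.
    - by rewrite -natrX ler0n ler_nat -!mulnn; nia.
  rewrite /M /moment /vec3 mxE; move: (_`_l) => x /andP[x0 xN].
  rewrite ger0_norm; last by rewrite mulr_ge0 // ltW.
  rewrite -[leRHS](divfK (lt0r_neq0 N0)).
  by apply: ler_pM => //; apply: ltW.
rewrite /gen3 -pE; apply: contra tP => /eqP r0.
rewrite /root /P (bigD1 (i, j, k)) //= hornerM r0 mul0r eqxx //.
Qed.

End GeneralPosition.

(** * Segments of distant chains do not cross *)
Section CloseSegments.
Variable K : realFieldType.
Implicit Types u v w z : 'rV[K]_3.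

Definition dot3 u w : K := u 0 0 * w 0 0 + u 0 1 * w 0 1 + u 0 2%:R * w 0 2%:R.

Lemma dot3_ge0 u : 0 <= dot3 u u.
Proof. by rewrite /dot3 -!expr2 !addr_ge0 // sqr_ge0. Qed.

Lemma dot3_sub u w : dot3 (w - u) (w - u) = dot3 u u + dot3 w w - 2 * dot3 u w.
Proof. by rewrite /dot3 !mxE; ring. Qed.

Lemma dot3_le1 u w : dot3 u u = 1 -> dot3 w w = 1 -> dot3 u w <= 1.
Proof. by move=> u1 w1; have := dot3_ge0 (w - u); rewrite dot3_sub u1 w1; lra. Qed.

(** It equals 1 exactly at equal points of the surface; the square makes it independent of
    the signs of the vectors. *)
Definition affinity (m : bool) u w : K := if m then dot3 u w ^+ 2 else dot3 u w.

Definition nearby (e : K) u v := forall l, `|v 0 l - u 0 l| <= e.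

(** The planes of the two cones intersect in a line, which Cramer's rule describes from
    both sides; the crossing condition makes the coefficients positive. *)
Lemma sphere_cross_meet u v w z :
  gen3 u v w -> gen3 u v z -> gen3 w z u -> gen3 w z v -> sphere_cross u v w z ->
  exists a b c d, [/\ [/\ 0 < a, 0 < b, 0 < c & 0 < d] &
    a *: u + b *: v = c *: w + d *: z].
Proof.
have id l : det3 w z v * u 0 l - det3 w z u * v 0 l =
    - det3 u v z * w 0 l + det3 u v w * z 0 l.
  rewrite !det3.unlock.
  by have [->|->|->] := ord3P l; ring.
rewrite /gen3 /sphere_cross /ori; move: id.
move: (det3 u v w) (det3 u v z) (det3 w z u) (det3 w z v) => p q r s id p0 q0 r0 s0.
case: (ltrgt0P p) p0 => // hp _; case: (ltrgt0P q) q0 => // hq _;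
 case: (ltrgt0P r) r0 => // hr _; case: (ltrgt0P s) s0 => // hs _ //= _.
- exists s, (- r), (- q), p; split; first by split; rewrite ?oppr_gt0.
  by apply/rowP => l; rewrite !mxE mulNr id.
- exists (- s), r, q, (- p); split; first by split; rewrite ?oppr_gt0.
  apply/rowP => l; rewrite !mxE; have := id l.
  by move: (u 0 l) (v 0 l) (w 0 l) (z 0 l) => ul vl wl zl e; lra.
Qed.

Lemma sqr_unit_le1 u l : dot3 u u = 1 -> `|u 0 l| <= 1.
Proof.
rewrite /dot3 => u1; rewrite -(@ler_pXn2r _ 2) ?nnegrE // expr1n real_normK ?num_real //.
have := sqr_ge0 (u 0 0); have := sqr_ge0 (u 0 1); have := sqr_ge0 (u 0 2%:R).
by have [->|->|->] := ord3P l; lra.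
Qed.

Lemma dot3_err (e : K) u v : 0 <= e -> dot3 u u = 1 ->
  (forall l, `|v 0 l| <= e) -> `|dot3 v u| <= 3 * e.
Proof.
move=> e0 u1 ve.
have b l : `|v 0 l * u 0 l| <= e.
  by rewrite normrM -[leRHS]mulr1 ler_pM // sqr_unit_le1.
rewrite /dot3 (le_trans (ler_normD _ _)) //.
have := ler_normD (v 0 0 * u 0 0) (v 0 1 * u 0 1).
have := b 0; have := b 1; have := b 2%:R; lra.
Qed.

(** A common point is a positive combination of [u, v] and of [w, z], hence up to a
    relative error [e] a multiple of [u0] and of [w0], with factors [A] and [C]. The scalar
    products with [u0] and [w0] show that [A] and [C] are nearly equal and that [u0] and
    [w0] are nearly parallel. *)
Lemma meet_dot (e : K) (u0 w0 u v w z : 'rV[K]_3) :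
  dot3 u0 u0 = 1 -> dot3 w0 w0 = 1 -> 0 <= e -> e <= 16^-1 ->
  nearby e u0 u -> nearby e u0 v -> nearby e w0 w -> nearby e w0 z ->
  gen3 u v w -> gen3 u v z -> gen3 w z u -> gen3 w z v -> sphere_cross u v w z ->
  1 - 8 * e <= dot3 u0 w0.
Proof.
move=> u1 w1 e0 e16 nu nv nw nz g1 g2 g3 g4.
case/(sphere_cross_meet g1 g2 g3 g4) => a [b [c [d [[a0 b0 c0 d0] eqn]]]].
pose A := a + b; pose C := c + d.
have A0 : 0 < A by rewrite addr_gt0.
have C0 : 0 < C by rewrite addr_gt0.
pose r := A *: u0 - C *: w0.
have rE l : `|r 0 l| <= (A + C) * e.
  have := congr1 (fun x : 'rV[K]_3 => x 0 l) eqn.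
  have := nu l; have := nv l; have := nw l; have := nz l.
  rewrite /r /A /C !mxE !ler_norml.
  move: (u0 0 l) (w0 0 l) (u 0 l) (v 0 l) (w 0 l) (z 0 l) => U W ul vl wl zl.
  move=> /andP[z1 z2] /andP[w_1 w_2] /andP[v1 v2] /andP[u_1 u_2] E.
  have hz1 := ler_wpM2l (ltW d0) z1; have hz2 := ler_wpM2l (ltW d0) z2.
  have hw1 := ler_wpM2l (ltW c0) w_1; have hw2 := ler_wpM2l (ltW c0) w_2.
  have hv1 := ler_wpM2l (ltW b0) v1; have hv2 := ler_wpM2l (ltW b0) v2.
  have hu1 := ler_wpM2l (ltW a0) u_1; have hu2 := ler_wpM2l (ltW a0) u_2.
  by apply/andP; split; nra.
have ACe : 0 <= (A + C) * e by rewrite mulr_ge0 // ltW // addr_gt0.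
have := dot3_err ACe u1 rE; have := dot3_err ACe w1 rE.
have -> : dot3 r w0 = A * dot3 u0 w0 - C * dot3 w0 w0.
  by rewrite /dot3 /r !mxE; ring.
have -> : dot3 r u0 = A * dot3 u0 u0 - C * dot3 u0 w0.
  by rewrite /dot3 /r !mxE; ring.
have D1 := dot3_le1 u1 w1.
rewrite u1 w1 !mulr1; set D := dot3 u0 w0.
rewrite !ler_norml => /andP[h1 h2] /andP[h3 h4].
have {}D1 : D <= 1 by exact: D1.
clearbody D A C; clear -A0 C0 e0 e16 h1 h2 h3 h4 D1.
wlog AC : A C A0 C0 h1 h2 h3 h4 / A <= C => [hw|].
  by case: (leP A C) => [|/ltW] AC; [apply: (hw A C) | apply: (hw C A) => //; lra].
have AD : A * D <= A by rewrite ler_piMr // ltW.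
have Ae : A * e <= A * 16^-1 by rewrite ler_pM2l.
have Ce : C * e <= C * 16^-1 by rewrite ler_pM2l.
have CA : 3 * C <= 5 * A by lra.
have CAe : 3 * C * e <= 5 * A * e by rewrite ler_wpM2r.
rewrite -(ler_pM2l A0); lra.
Qed.

(** In the projective plane a crossing is a crossing on the sphere after changing the
    sign of one of the two segments. *)
Lemma cross_far (m : bool) (d e : K) (u0 w0 u v w z : 'rV[K]_3) :
  dot3 u0 u0 = 1 -> dot3 w0 w0 = 1 -> 0 < d -> 32 * e <= d -> 0 <= e -> e <= 16^-1 ->
  nearby e u0 u -> nearby e u0 v -> nearby e w0 w -> nearby e w0 z ->
  gen3 u v w -> gen3 u v z -> gen3 w z u -> gen3 w z v ->
  affinity m u0 w0 <= 1 - d -> ~~ cross m u v w z.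
Proof.
move=> u1 w1 d0 ed e0 e16 nu nv nw nz g1 g2 g3 g4 aff.
apply/negP => cr; have {cr} : 1 - 8 * e <= dot3 u0 w0 \/ m /\ 1 - 8 * e <= - dot3 u0 w0.
  case: (boolP (sphere_cross u v w z)) => [crS|ncr].
    by left; apply: (meet_dot u1 w1 e0 e16 nu nv nw nz).
  case: m cr {aff} => /= cr; last by rewrite cr in ncr.
  right; split=> //.
  have -> : - dot3 u0 w0 = dot3 u0 (- w0) by rewrite /dot3 !mxE; ring.
  have nN x y : nearby e x y -> nearby e (- x) (- y).
    by move=> n l; rewrite !mxE -opprD normrN.
  have NN x y t : gen3 t x y -> gen3 t (- x) (- y).
    by move=> g; rewrite gen3N (gen3_rot y t (- x)) gen3N -(gen3_rot y t x).
  have rg x y t : gen3 x y t -> gen3 (- x) (- y) t.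
    by move=> g; rewrite gen3_rot NN // -gen3_rot.
  apply: (@meet_dot e u0 (- w0) u v (- w) (- z)) => //; try exact: nN.
  - by rewrite -w1 /dot3 !mxE; ring.
  - by rewrite gen3N.
  - by rewrite gen3N.
  - exact: rg.
  - exact: rg.
  move: cr ncr; rewrite /plane_cross /sphere_cross !oriN //.
  have rt x : gen3 w z x -> ori (- w) (- z) x = ori w z x.
    move=> g; have g' : gen3 z x w by rewrite -(gen3_rot z x w) -(gen3_rot x w z).
    rewrite (ori_rot x (- w) (- z)) oriN; last first.
      by rewrite (gen3_rot z x (- w)) gen3N.
    rewrite (ori_rot z x (- w)) oriN // negbK.
    by rewrite (ori_rot x w z) (ori_rot z x w).
  rewrite !rt //.
  by do 4! case: ori.
case: m aff => /= aff; last by case=> [|[]] //; lra.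
by case=> [h|[_ h]]; nra.
Qed.

End CloseSegments.

(** * From chains of unit vectors to crossing parities *)
Section ChainDrawing.
Variables (K : realFieldType) (m : bool) (V : finType) (adj : rel V).

Lemma gen_pos_signed (T : eqType) (v : T -> 'rV[K]_3) (s : seq (bool * T)) :
  (forall i j k, uniq [:: i; j; k] -> gen3 (v i) (v j) (v k)) ->
  uniq (map snd s) -> gen_pos (map (fun bt : bool * T => (-1) ^+ bt.1 *: v bt.2) s).
Proof.
move=> gv.
have gs (a b c : bool) i j k : uniq [:: i; j; k] ->
    gen3 ((-1) ^+ a *: v i) ((-1) ^+ b *: v j) ((-1) ^+ c *: v k).
  have sg x y z (d : bool) : gen3 x y ((-1) ^+ d *: z : 'rV[K]_3) = gen3 x y z.
    by case: d; rewrite ?scale1r ?scaleN1r ?gen3N.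
  by move=> u; rewrite sg -gen3_rot -gen3_rot sg -gen3_rot -gen3_rot sg
    -gen3_rot -gen3_rot; apply: gv.
elim: s => //= -[a i] s IHs /= /andP[is_ us].
rewrite {}IHs // andbT; elim: s is_ us => //= -[b j] s IHs /=.
rewrite inE negb_or => /andP[ij is_] /andP[js us]; rewrite IHs // andbT.
apply/allP => _ /mapP[[c k] ck ->] /=; apply: gs.
have ks : k \in [seq i.2 | i <- s] by apply/mapP; exists (c, k).
rewrite /= !inE negb_or ij andbT andTb.
by apply/andP; split; [apply: contraNneq is_ | apply: contraNneq js] => ->.
Qed.

Lemma near_sign (e : K) u v (b : bool) :
  nearby e u v -> nearby e ((-1) ^+ b *: u) ((-1) ^+ b *: v).
Proof.
move=> n l; rewrite !mxE -mulrBr normrM normrX normrN1 expr1n mul1r; exact: n.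
Qed.

Lemma near_trans (e e' : K) u v w : nearby e u v -> nearby e' v w -> nearby (e + e') u w.
Proof.
move=> uv vw l; rewrite -(subrKA (v 0 l)) (le_trans (ler_normD _ _)) // addrC.
exact: lerD (uv l) (vw l).
Qed.

Lemma near_weak (e e' : K) u v : e <= e' -> nearby e u v -> nearby e' u v.
Proof. by move=> ee n l; apply: le_trans ee. Qed.

Lemma dot3_sign (b : bool) (u : 'rV[K]_3) :
  dot3 ((-1) ^+ b *: u) ((-1) ^+ b *: u) = dot3 u u.
Proof. by rewrite /dot3 !mxE; case: b; rewrite ?expr0 ?expr1; ring. Qed.

Lemma affinity_sign (b c : bool) (u w : 'rV[K]_3) : (b -> m) -> (c -> m) ->
  affinity m ((-1) ^+ b *: u) ((-1) ^+ c *: w) = affinity m u w.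
Proof.
rewrite /affinity; case: m => [_ _|].
  by rewrite /dot3 !mxE; case: b; case: c; rewrite ?expr0 ?expr1; ring.
by case: b => [/(_ isT)//|_]; case: c => [/(_ isT)//|_]; rewrite !scale1r.
Qed.

(** All the chains are perturbed together into general position; since their steps are
    short and disjoint edges stay apart, the perturbed chains still do not cross. In the
    projective plane the signs [eps] move the vectors of the vertices to one side of the
    plane through [o] and [q], as [before_sign] requires, and the sign of an edge is
    corrected accordingly. *)
Lemma chains_parity (d e : K) (P0 : V -> 'rV[K]_3) (h : V -> V -> bool)
    (len : V -> V -> nat) (l : V -> V -> nat -> 'rV[K]_3) :
  symmetric adj -> irreflexive adj ->
  0 < d -> 0 < e -> 64 * e <= d -> e <= 32^-1 ->
  (m = false -> forall x y, h x y = false) ->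
  (forall x y, adj x y -> [/\ (0 < len x y)%N, l x y 0 = P0 x &
     l x y (len x y) = (-1) ^+ h x y *: P0 y]) ->
  (forall x y i, adj x y -> (i <= len x y)%N -> dot3 (l x y i) (l x y i) = 1) ->
  (forall x y i, adj x y -> (i < len x y)%N -> nearby e (l x y i) (l x y i.+1)) ->
  (forall x y z w i j, adj x y -> adj z w -> uniq [:: x; y; z; w] ->
    (i <= len x y)%N -> (j <= len z w)%N -> affinity m (l x y i) (l z w j) <= 1 - d) ->
  inhabited (parity_data m adj).
Proof.
move=> asym airr d0 e0 ed e32 h0 lends lunit lstep lsep.
pose N := \max_x \max_y len x y.
have lenN x y : (len x y <= N)%N.
  by rewrite (leq_trans _ (leq_bigmax x)) // (leq_bigmax y).
(* the vectors o and q, the vertices, and the points of the chains, perturbed together *)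
pose T := (bool + (V + V * V * 'I_N.+1))%type.
pose B (t : T) : 'rV[K]_3 := match t with
  | inl _ => 0 | inr (inl x) => P0 x | inr (inr (x, y, i)) => l x y i end.
have [v [vB vgen]] := perturbation B e0.
pose o := v (inl false); pose q := v (inl true).
pose pt x := v (inr (inl x)).
(* the ends of a chain must be the vertices themselves, for all the chains at once *)
pose idx x y i : T := if i == 0%N then inr (inl x)
  else if i == len x y then inr (inl y) else inr (inr (x, y, inord i)).
pose eps x := m && ori o q (pt x).
have epsm x : eps x -> m by case/andP.
pose bit x y i := eps x (+) (h x y && (i == len x y)).
pose P x := (-1) ^+ eps x *: pt x.
pose L x y i := (-1) ^+ bit x y i *: v (idx x y i).
have hm x y : h x y -> m by case: (m) h0 => // /(_ erefl) ->.
have len_ne x y : adj x y -> (0%N == len x y) = false.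
  by case/lends => len0 _ _; rewrite ltn_eqF.
have Lnear x y i : adj x y -> (i <= len x y)%N ->
    nearby e ((-1) ^+ eps x *: l x y i) (L x y i).
  move=> xy ilen; have [len0 l0 ll] := lends x y xy.
  rewrite /L /bit signr_addb -scalerA; apply: near_sign.
  rewrite /idx; case: (eqVneq i 0%N) => [->|i0].
    rewrite len_ne // andbF scale1r l0 => j; exact: vB.
  case: (eqVneq i (len x y)) => [->|il].
    by rewrite andbT ll; apply: near_sign => j; exact: vB.
  rewrite andbF scale1r => j; have := vB (inr (inr (x, y, inord i))) j.
  by rewrite /B inordK // ltnS (leq_trans ilen).
have idx_inj x y i : adj x y -> (i < len x y)%N -> idx x y i != idx x y i.+1.
  move=> xy ilen; have xny : x != y by apply: contraTneq xy => ->; rewrite airr.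
  have iN : (i.+1 < N.+1)%N by rewrite ltnS (leq_trans ilen).
  rewrite /idx (ltn_eqF ilen) /=; case: (eqVneq i 0%N) => [->|i0]; case: (eqVneq _ (len x y)) => // _.
  apply/eqP => -[/(congr1 val)]; rewrite /= !inordK //; last exact: ltnW.
  by move/eqP; rewrite ltn_eqF.
have idx_disj x y z w i j : uniq [:: x; y; z; w] -> idx x y i != idx z w j.
  rewrite uniq4E => u4; split_andb.
  rewrite /idx; case: (i == 0%N); case: (j == 0%N); case: (i == len x y);
    case: (j == len z w); apply/eqP => -[] *; subst; 
    try discriminate; match goal with H : is_true (?a != ?a) |- _ => by rewrite eqxx in H end.
have Lsgn x y i : L x y i = (-1) ^+ bit x y i *: v (idx x y i) by [].
apply: (@polygonal_parity K m V adj asym o q P len L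
  (fun x y => eps x (+) h x y (+) eps y)).
- by move=> m0 x y; rewrite h0 // /eps m0.
- move=> m1 x; rewrite /P /eps m1 /=; have g : gen3 o q (pt x) by apply: vgen.
  by case E: (ori o q (pt x)); rewrite ?scale1r ?scaleN1r ?oriN ?E.
- move=> x y xy.
  have -> : [:: o; q; P x; P y] = map (fun bt : bool * T => (-1) ^+ bt.1 *: v bt.2)
    [:: (false, inl false); (false, inl true); (eps x, inr (inl x)); (eps y, inr (inl y))].
    by rewrite /= !expr0 !scale1r.
  apply: gen_pos_signed vgen _.
  by rewrite /= !inE /= andbT; apply: contraNneq xy => -[->].
- by move=> x y /lends[].
- move=> x y xy; have [len0 _ _] := lends x y xy.
  by rewrite Lsgn /bit len_ne // andbF addbF /idx eqxx.
- move=> x y xy; have [len0 _ _] := lends x y xy.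
  rewrite Lsgn /bit eqxx andbT /idx eq_sym len_ne // eqxx /P scalerA -signr_addb.
  by rewrite -addbA addbb addbF.
- move=> x y z w xy zw uq i j il jl.
  have -> : [:: o; q; L x y i; L x y i.+1; L z w j; L z w j.+1] =
    map (fun bt : bool * T => (-1) ^+ bt.1 *: v bt.2)
    [:: (false, inl false); (false, inl true);
    (bit x y i, idx x y i); (bit x y i.+1, idx x y i.+1);
    (bit z w j, idx z w j); (bit z w j.+1, idx z w j.+1)].
    by rewrite /= !expr0 !scale1r.
  apply: gen_pos_signed vgen _.
  have nb b x1 y1 i1 : (inl b == idx x1 y1 i1) = false.
    by rewrite /idx; case: ifP => // _; case: ifP.
  by rewrite /= !inE !nb /= !(negbTE (idx_disj _ _ _ _ _ _ uq))
    (negbTE (idx_inj _ _ _ xy il)) (negbTE (idx_inj _ _ _ zw jl)).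
- move=> x y z w xy zw uq i j il jl.
  have ga := @gen_pos_signed T v [:: (bit x y i, idx x y i); (bit x y i.+1, idx x y i.+1);
    (bit z w j, idx z w j); (bit z w j.+1, idx z w j.+1)] vgen.
  have {}ga : gen_pos [:: L x y i; L x y i.+1; L z w j; L z w j.+1].
    apply: ga; rewrite /= !inE !(negbTE (idx_disj _ _ _ _ _ _ uq)).
    by rewrite (negbTE (idx_inj _ _ _ xy il)) (negbTE (idx_inj _ _ _ zw jl)).
  have e2 : e <= e + e by rewrite lerDl ltW.
  have n1 := near_weak e2 (Lnear x y i xy (ltnW il)).
  have n2 := near_trans (near_sign (eps x) (lstep x y i xy il)) (Lnear x y i.+1 xy il).
  have n3 := near_weak e2 (Lnear z w j zw (ltnW jl)).
  have n4 := near_trans (near_sign (eps z) (lstep z w j zw jl)) (Lnear z w j.+1 zw jl).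
  have u1 : dot3 ((-1) ^+ eps x *: l x y i) ((-1) ^+ eps x *: l x y i) = 1.
    by rewrite dot3_sign lunit // ltnW.
  have w1 : dot3 ((-1) ^+ eps z *: l z w j) ((-1) ^+ eps z *: l z w j) = 1.
    by rewrite dot3_sign lunit // ltnW.
  have aff : affinity m ((-1) ^+ eps x *: l x y i) ((-1) ^+ eps z *: l z w j) <= 1 - d.
    rewrite affinity_sign; [|exact: epsm|exact: epsm].
    by apply: lsep => //; exact: ltnW.
  move: n1 n2 n3 n4 u1 w1 aff ga; clear -d0 e0 ed e32.
  move: (_ *: _) (_ *: _) (L x y i) (L x y i.+1) (L z w j) (L z w j.+1).
  move=> u0 w0 u u' w1 w2 n1 n2 n3 n4 u01 w01 aff /= ga; split_andb.
  have d32 : 32 * (e + e) <= d by lra.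
  have ee0 : 0 <= e + e by lra.
  have e16 : e + e <= 16^-1 by lra.
  by apply: (cross_far u01 w01 d0 d32 ee0 e16 n1 n2 n3 n4) => //; rewrite gen3_rot.
Qed.

End ChainDrawing.

From Stdlib Require Import Ring.
Local Open Scope nat_scope.

(** * Subdivisions of the complete bipartite graph K_{3,3} *)

(** The sum of [h i j * h i' j'] over the 18 pairs of disjoint edges of K_{3,3}. *)
Definition k33_form (h : nat -> nat -> bool) : bool :=
  let two i i' j j' := xorb (h i j && h i' j') (h i j' && h i' j) in
  let rows i i' := xorb (two i i' 0 1) (xorb (two i i' 0 2) (two i i' 1 2)) in
  xorb (rows 0 1) (xorb (rows 0 2) (rows 1 2)).

Lemma addb_xorb a b : a (+) b = xorb a b.
Proof. by case: a; case: b. Qed.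

Lemma negb_xorb a : ~~ a = xorb true a.
Proof. by []. Qed.

Ltac xor_ring := rewrite ?addb_xorb ?negb_xorb; ring.

(** In the sum over the 18 pairs of disjoint edges every term occurs an even number of
    times, except for those of [tbb]: [tbb j j'] and [tbb j' j] add up to 1, for three
    pairs [i < i'] and three pairs [j < j']. *)
Lemma k33_form_true (h : nat -> nat -> bool) (A B : nat -> nat -> nat -> bool)
    (taa tab tba tbb : nat -> nat -> bool) :
  (forall j j', (j < j' < 3)%N -> tbb j' j = ~~ tbb j j') ->
  (forall i i' j j', (i < i' < 3)%N -> (j < 3)%N -> (j' < 3)%N -> j != j' -> h i j && h i' j' =
    A i j i' (+) B i j j' (+) A i' j' i (+) B i' j' j
    (+) taa i i' (+) tab i j' (+) tba j i' (+) tbb j j') ->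
  k33_form h = true.
Proof.
move=> anti eqn; rewrite /k33_form !eqn // (anti 0 1) // (anti 0 2) // (anti 1 2) //.
xor_ring.
Qed.

Section Walks.
Variables (m : bool) (V : eqType) (adj : rel V) (D : parity_data m adj).
Hypothesis airr : irreflexive adj.

Fixpoint walk_sgn (x : V) (s : seq V) : bool :=
  if s is y :: s' then sgn D x y (+) walk_sgn y s' else false.

Fixpoint walk_wind (x : V) (s : seq V) (z : V) : bool :=
  if s is y :: s' then wind D x y z (+) walk_wind y s' z else false.

Lemma edge_walk_parity x y z t : adj x y -> path adj z t ->
  ~~ has (mem [:: x; y]) (z :: t) ->
  sgn D x y && walk_sgn z t =
    wind D x y z (+) wind D x y (last z t) (+) walk_wind z t x (+) walk_wind z t y
    (+) tour D x z (+) tour D x (last z t) (+) tour D y z (+) tour D y (last z t).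
Proof.
move=> xy; elim: t z => [z _ _|w t IHt z] /=.
  by rewrite andbF; xor_ring.
move=> /andP[zw wt]; rewrite negb_or => /andP[nz nwt].
have := IHt w wt nwt; have nw : w \notin [:: x; y].
  by move: nwt; rewrite /= negb_or => /andP[].
rewrite /= in nz.
have u : uniq [:: x; y; z; w].
  have xny : x != y by apply: contraTneq xy => ->; rewrite airr.
  have znw : z != w by apply: contraTneq zw => ->; rewrite airr.
  move: nz nw; rewrite uniq4E !inE !negb_or xny znw andbT.
  by rewrite (eq_sym z) (eq_sym z) (eq_sym w) (eq_sym w) => /andP[-> ->] /andP[-> ->].
rewrite andb_addr (parity_eq D xy zw u) => ->; xor_ring.
Qed.

(** [parity_eq] is additive along walks, since the terms at inner vertices cancel; this
    is how subdivided edges behave like edges. *)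
Lemma walk_parity x s z t : path adj x s -> path adj z t ->
  ~~ has (mem (x :: s)) (z :: t) ->
  walk_sgn x s && walk_sgn z t =
    walk_wind x s z (+) walk_wind x s (last z t)
    (+) walk_wind z t x (+) walk_wind z t (last x s)
    (+) tour D x z (+) tour D x (last z t)
    (+) tour D (last x s) z (+) tour D (last x s) (last z t).
Proof.
elim: s x => [x _ _ _|y s IHs x] /=.
  by xor_ring.
move=> /andP[xy ys] zt; rewrite -/(has _ (z :: t)) => nd.
have nd1 : ~~ has (mem [:: x; y]) (z :: t).
  apply: contra nd => /hasP[v vt vxy]; apply/hasP; exists v => //.
  by move: vxy; rewrite /= !inE => /orP[->|->]; rewrite ?orbT.
have nd2 : ~~ has (mem (y :: s)) (z :: t).
  apply: contra nd => /hasP[v vt vxy]; apply/hasP; exists v => //.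
  by move: vxy; rewrite /= !inE => ->; rewrite orbT.
rewrite andb_addl (edge_walk_parity xy zt nd1) (IHs y ys zt nd2).
xor_ring.
Qed.

End Walks.

Lemma parity_restrict (m : bool) (V : eqType) (adj : rel V) (n : nat)
    (f : nat -> V) (e : rel nat) :
  parity_data m adj -> {in gtn n &, injective f} ->
  (forall i j, e i j -> [/\ (i < n)%N, (j < n)%N & adj (f i) (f j)]) ->
  inhabited (parity_data m e).
Proof.
move=> D finj fe.
pose tr i j := if f i == f j then (i < j)%N else tour D (f i) (f j).
constructor; apply: (@ParityData m _ e (fun i j => sgn D (f i) (f j))
  (fun i j k => wind D (f i) (f j) (f k)) tr).
- by move=> m0 i j; exact: sgn_planar.
- by move=> i j; exact: sgn_sym.
- by move=> i j k; exact: wind_sym.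
- move=> i j ij; rewrite /tr eq_sym; case: eqVneq => [_|fij].
    by case: ltngtP ij => // ->; rewrite eqxx.
  exact: tour_anti.
move=> i j k l /fe[i_n j_n eij] /fe[k_n l_n ekl] u.
have al : all (gtn n) [:: i; j; k; l] by rewrite /= i_n j_n k_n l_n.
have ufs : uniq [seq f z | z <- [:: i; j; k; l]].
  rewrite map_inj_in_uniq // => a b ha hb; apply: finj.
    exact: (allP al _ ha).
  exact: (allP al _ hb).
rewrite (parity_eq D eij ekl ufs) /tr.
move: ufs; rewrite /= !inE !negb_or => /and4P[/and3P[_ /negbTE-> /negbTE->]].
by move=> /andP[/negbTE-> /negbTE->] _ _.
Qed.

(** The effect of replacing the vectors of the vertices in [g] by their antipodes. *)
Lemma switch (V : eqType) (adj : rel V) (g : V -> bool)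
    (D : parity_data true adj) :
  exists D' : parity_data true adj,
    forall x y, sgn D' x y = sgn D x y (+) (g x (+) g y).
Proof.
unshelve eexists.
  apply: (@ParityData true _ adj (fun x y => sgn D x y (+) (g x (+) g y))
    (fun x y z => wind D x y z (+) (g z && sgn D x y))
    (fun x y => tour D x y (+) (g x && g y))) => //.
  - by move=> x y; rewrite (sgn_sym D) [g y (+) _]addbC.
  - by move=> x y z; rewrite (wind_sym D) (sgn_sym D).
  - by move=> x y xy; rewrite (tour_anti D xy) andbC addNb.
  move=> x y z w xy zw u; have := parity_eq D xy zw u.
  rewrite !andb_addl !andb_addr => ->; xor_ring.
by move=> x y.
Qed.

(** Edges are listed from the leaves to the root: [y] occurs in no later edge, so the
    value at [y] can be chosen after those at the vertices of the later edges. *)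
Fixpoint potential (h : nat -> nat -> bool) (t : seq (nat * nat)) (v : nat) : bool :=
  if t is (x, y) :: t' then
    if v == y then potential h t' x (+) h x y else potential h t' v
  else false.

Fixpoint growing_tree (t : seq (nat * nat)) : bool :=
  if t is (x, y) :: t' then
    [&& x != y, all (fun p => (p.1 != y) && (p.2 != y)) t' & growing_tree t']
  else true.

Lemma potential_tree h t x y : growing_tree t -> (x, y) \in t ->
  potential h t y = potential h t x (+) h x y.
Proof.
elim: t => //= -[x' y'] t IHt /and3P[xy' /allP t_y' gt].
rewrite inE => /orP[/eqP[-> ->]|xyt]; first by rewrite eqxx (negbTE xy').
have /= /andP[nx ny] := t_y' _ xyt.
by rewrite (negbTE nx) (negbTE ny) IHt.
Qed.

Fixpoint all_bits (n : nat) (p : seq bool -> bool) : bool :=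
  if n is n'.+1 then
    all_bits n' (fun s => p (true :: s)) && all_bits n' (fun s => p (false :: s))
  else p [::].

Lemma all_bitsP n p s : all_bits n p -> size s = n -> p s.
Proof.
elim: n p s => [|n IHn] p [|b s] //= /andP[pt pf] [sn].
by case: b; [apply: (IHn (fun s => p (true :: s))) | apply: (IHn (fun s => p (false :: s)))].
Qed.

Section Certificate.
Variables (tree free : seq (nat * nat)) (tests : seq (seq (seq nat))).

Definition edge_in (s : seq (nat * nat)) : rel nat :=
  fun i j => ((i, j) \in s) || ((j, i) \in s).

(** A test is a list of nine walks, the one from the [i]-th to the [j]-th branch vertex
    being at position [3 * i + j]. *)
Definition walk_of (t : seq (seq nat)) (i j : nat) : seq nat :=
  nth [::] t (3 * i + j).

Definition subdivided_k33 (e : rel nat) (t : seq (seq nat)) : bool :=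
  let w := walk_of t in
  all (fun i => all (fun j =>
    [&& w i j != [::], head 0 (w i j) == head 0 (w i 0),
      last 0 (w i j) == last 0 (w 0 j) & path e (head 0 (w i j)) (behead (w i j))])
    (iota 0 3)) (iota 0 3) &&
  all (fun i => all (fun j => all (fun i' => all (fun j' =>
    (i < i') ==> (j != j') ==> ~~ has (mem (w i j)) (w i' j'))
    (iota 0 3)) (iota 0 3)) (iota 0 3)) (iota 0 3).

Fixpoint seq_sgn (h : nat -> nat -> bool) (x : nat) (s : seq nat) : bool :=
  if s is y :: s' then h x y (+) seq_sgn h y s' else false.

Definition test_form (h : nat -> nat -> bool) (t : seq (seq nat)) : bool :=
  k33_form (fun i j => seq_sgn h (head 0 (walk_of t i j)) (behead (walk_of t i j))).

(** The edges outside [free] are those of the tree; their code falls off the end of every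
    list of signs, and the default [false] is their sign. *)
Definition edge_code (x y : nat) : nat :=
  index (if (x, y) \in free then (x, y) else (y, x)) free.

Definition lookup (bits : seq bool) (x y : nat) : bool := nth false bits (edge_code x y).

Fixpoint walk_code (x : nat) (s : seq nat) : seq nat :=
  if s is y :: s' then edge_code x y :: walk_code y s' else [::].

(** Replacing walks by edge codes once and for all makes the test of all signs feasible. *)
Definition compile (t : seq (seq nat)) : seq (seq nat) :=
  [seq walk_code (head 0 w) (behead w) | w <- t].

Definition compiled_form (bits : seq bool) (t : seq (seq nat)) : bool :=
  let v := [seq foldr (fun k b => nth false bits k (+) b) false w | w <- t] in
  k33_form (fun i j => nth false v (3 * i + j)).

(** After switching, the signs vanish on [tree]; whatever the signs on [free] are, some
    test, a subdivided K_{3,3}, contradicts them. *)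
Definition certificate : bool :=
  [&& growing_tree tree,
    all (fun p => (p.1 != p.2)) (tree ++ free),
    all (subdivided_k33 (edge_in (tree ++ free))) tests &
    let ts := map compile tests in
    all_bits (size free) (fun bits => has (fun t => ~~ compiled_form bits t) ts)].

Lemma compiled_formE bits t :
  compiled_form bits (compile t) = test_form (lookup bits) t.
Proof.
have E i j : nth false [seq foldr (fun k b => nth false bits k (+) b) false w |
      w <- compile t] (3 * i + j) =
    seq_sgn (lookup bits) (head 0 (walk_of t i j)) (behead (walk_of t i j)).
  have F x s : foldr (fun k b => nth false bits k (+) b) false (walk_code x s) =
      seq_sgn (lookup bits) x s by elim: s x => //= y s IHs x; rewrite IHs.
  rewrite -map_comp -F /walk_of; case: (ltnP (3 * i + j) (size t)) => h.
    by rewrite (nth_map [::]).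
  by rewrite !nth_default // size_map.
by rewrite /compiled_form /test_form /k33_form !E.
Qed.

Lemma test_form_true m (e : rel nat) (D : parity_data m e) t : irreflexive e ->
  subdivided_k33 e t -> test_form (sgn D) t.
Proof.
move=> eirr /andP[/allP tw /allP td].
set w := walk_of t in tw td.
have tw' i j : i < 3 -> j < 3 -> [&& w i j != [::], head 0 (w i j) == head 0 (w i 0),
      last 0 (w i j) == last 0 (w 0 j) & path e (head 0 (w i j)) (behead (w i j))].
  move=> i3 j3; have := tw i; rewrite mem_iota i3 => /(_ isT) /allP /(_ j).
  by rewrite mem_iota j3 => /(_ isT).
have td' i j i' j' : i < i' -> i' < 3 -> j < 3 -> j' < 3 -> j != j' ->
    ~~ has (mem (w i j)) (w i' j').
  move=> ii' i3' j3 j3' jj'; have i3 := ltn_trans ii' i3'.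
  have := td i; rewrite mem_iota i3 => /(_ isT) /allP /(_ j).
  rewrite mem_iota j3 => /(_ isT) /allP /(_ i').
  rewrite mem_iota i3' => /(_ isT) /allP /(_ j').
  by rewrite mem_iota j3' ii' jj' => /(_ isT).
have hw x s : walk_sgn D x s = seq_sgn (sgn D) x s.
  by elim: s x => //= y s IHs x; rewrite IHs.
pose a i := head 0 (w i 0); pose b j := last 0 (w 0 j).
have wE i j : i < 3 -> j < 3 -> w i j = a i :: behead (w i j).
  by move=> i3 j3; have /and4P[] := tw' i j i3 j3; case: (w i j) => //= x s _ /eqP->.
have wl i j : i < 3 -> j < 3 -> last (a i) (behead (w i j)) = b j.
  move=> i3 j3; have /and4P[_ _ /eqP E _] := tw' i j i3 j3.
  by rewrite /b -E [in RHS](wE i j).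
have wp i j : i < 3 -> j < 3 -> path e (a i) (behead (w i j)).
  by move=> i3 j3; rewrite /a; have /and4P[_ /eqP <- _] := tw' i j i3 j3.
have haw i j : i < 3 -> j < 3 -> head 0 (w i j) = a i.
  by move=> i3 j3; rewrite /a; have /and4P[_ /eqP ->] := tw' i j i3 j3.
rewrite /test_form -/w; apply: (@k33_form_true _
  (fun i j i' => walk_wind D (a i) (behead (w i j)) (a i'))
  (fun i j j' => walk_wind D (a i) (behead (w i j)) (b j'))
  (fun i i' => tour D (a i) (a i')) (fun i j => tour D (a i) (b j))
  (fun j i => tour D (b j) (a i)) (fun j j' => tour D (b j) (b j'))).
  move=> j j' /andP[jj' j3']; have j3 := ltn_trans jj' j3'.
  apply: tour_anti; have := td' 0 j 1 j' isT isT j3 j3' ltac:(by rewrite neq_ltn jj').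
  apply: contra => /eqP bb; apply/hasP; exists (b j').
    by rewrite (wE 1 j') // -(wl 1 j') // mem_last.
  by rewrite /= -bb (wE 0 j) // -(wl 0 j) // mem_last.
move=> i i' j j' /andP[ii' i3'] j3 j3' jj'; have i3 := ltn_trans ii' i3'.
have nd := td' i j i' j' ii' i3' j3 j3' jj'.
rewrite !haw // -!hw walk_parity ?wp //; last by rewrite -!wE.
by rewrite !wl.
Qed.

Lemma certificate_obstruction (e : rel nat) : certificate ->
  (forall i j, edge_in (tree ++ free) i j -> e i j) ->
  parity_data true e -> False.
Proof.
case/and4P=> gt /allP irr tk bits ee D0.
pose e0 := edge_in (tree ++ free).
have [D1] : inhabited (parity_data true e0).
  constructor; apply: (@ParityData true _ e0 (sgn D0) (wind D0) (tour D0)) => //;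
    [exact: sgn_sym|exact: wind_sym|exact: tour_anti|].
  by move=> x y z w /ee xy /ee zw; exact: parity_eq.
have [D DE] := switch (potential (sgn D1) tree) D1.
have eirr : irreflexive e0.
  move=> x; apply/negP; rewrite /e0 /edge_in orbb => /irr /=.
  by rewrite eqxx.
have tree0 x y : (x, y) \in tree -> sgn D x y = false.
  move=> xy; rewrite DE (potential_tree _ gt xy).
  by case: (sgn D1 x y); case: (potential _ _ _).
pose bs := [seq sgn D p.1 p.2 | p <- free].
have lk x y : e0 x y -> lookup bs x y = sgn D x y.
  have inF u v : (u, v) \in free -> nth false bs (index (u, v) free) = sgn D u v.
    by move=> uv; rewrite /bs (nth_map (0, 0)) ?index_mem // nth_index.
  rewrite /lookup /edge_code /e0 /edge_in !mem_cat.
  case: ifP => [/inF //|_]; case: (boolP ((y, x) \in free)) => [/inF-> _|yx /=].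
    exact: sgn_sym.
  rewrite !orbF nth_default; last by rewrite size_map leqNgt index_mem.
  by case/orP => /tree0; rewrite ?(sgn_sym D x y) => ->.
have := all_bitsP bits (s := bs); rewrite size_map => /(_ erefl) /hasP[_ /mapP[t t_in ->]].
rewrite compiled_formE => /negP[]; have tk33 := allP tk _ t_in.
suff -> : test_form (lookup bs) t = test_form (sgn D) t by apply: test_form_true.
have ss x s : path e0 x s -> seq_sgn (lookup bs) x s = seq_sgn (sgn D) x s.
  by elim: s x => //= y s IHs x /andP[xy ys]; rewrite lk // IHs.
have hh i j : i < 3 -> j < 3 ->
    seq_sgn (lookup bs) (head 0 (walk_of t i j)) (behead (walk_of t i j)) =
    seq_sgn (sgn D) (head 0 (walk_of t i j)) (behead (walk_of t i j)).
  move=> i3 j3; apply: ss; move: tk33 => /andP[/allP tw _].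
  have := tw i; rewrite mem_iota i3 => /(_ isT) /allP /(_ j).
  by rewrite mem_iota j3 => /(_ isT) /and4P[].
by rewrite /test_form /k33_form !hh.
Qed.

End Certificate.

(** * Seven nonprojective graphs, K_{3,3} and K_5 *)

(** The tree and the free edges of a certificate form a subgraph that is already
    nonprojective. *)

Definition K35_tree := [:: (3, 2); (3, 1); (0, 7); (0, 6); (0, 5); (0, 4); (0, 3)].
Definition K35_free := [:: (1, 4); (1, 5); (1, 6); (1, 7); (2, 4); (2, 5); (2, 6); (2, 7)].
Definition K35_tests := [::
  [:: [:: 0; 3]; [:: 0; 4]; [:: 0; 5]; [:: 1; 3]; [:: 1; 4]; [:: 1; 5]; [:: 2; 3]; [:: 2; 4]; [:: 2; 5]];
  [:: [:: 0; 5]; [:: 0; 6]; [:: 0; 7]; [:: 1; 5]; [:: 1; 6]; [:: 1; 7]; [:: 2; 5]; [:: 2; 6]; [:: 2; 7]];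
  [:: [:: 0; 3]; [:: 0; 6]; [:: 0; 7]; [:: 1; 3]; [:: 1; 6]; [:: 1; 7]; [:: 2; 3]; [:: 2; 6]; [:: 2; 7]];
  [:: [:: 0; 4]; [:: 0; 6]; [:: 0; 7]; [:: 1; 4]; [:: 1; 6]; [:: 1; 7]; [:: 2; 4]; [:: 2; 6]; [:: 2; 7]]].
Lemma K35_certificate : certificate K35_tree K35_free K35_tests.
Proof. by vm_compute. Qed.

Definition K44_tree := [:: (4, 3); (4, 2); (4, 1); (0, 7); (0, 6); (0, 5); (0, 4)].
Definition K44_free := [:: (1, 5); (1, 7); (2, 5); (2, 6); (2, 7); (3, 5); (3, 6); (3, 7)].
Definition K44_tests := [::
  [:: [:: 1; 4]; [:: 1; 5]; [:: 1; 7]; [:: 2; 4]; [:: 2; 5]; [:: 2; 7]; [:: 3; 4]; [:: 3; 5]; [:: 3; 7]];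
  [:: [:: 0; 5]; [:: 0; 6]; [:: 0; 7]; [:: 3; 5]; [:: 3; 6]; [:: 3; 7]; [:: 4; 1; 5]; [:: 4; 2; 6]; [:: 4; 2; 7]];
  [:: [:: 1; 4]; [:: 1; 5]; [:: 1; 7; 0; 6]; [:: 2; 4]; [:: 2; 5]; [:: 2; 6]; [:: 3; 4]; [:: 3; 5]; [:: 3; 6]];
  [:: [:: 0; 4]; [:: 0; 5]; [:: 0; 6]; [:: 1; 4]; [:: 1; 5]; [:: 1; 7; 2; 6]; [:: 3; 4]; [:: 3; 5]; [:: 3; 6]];
  [:: [:: 0; 4]; [:: 0; 5]; [:: 0; 7]; [:: 1; 4]; [:: 1; 5]; [:: 1; 7]; [:: 3; 4]; [:: 3; 5]; [:: 3; 7]]].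
Lemma K44_certificate : certificate K44_tree K44_free K44_tests.
Proof. by vm_compute. Qed.

Definition K7_tree := [:: (0, 6); (0, 5); (0, 4); (0, 3); (0, 2); (0, 1)].
Definition K7_free := [:: (1, 4); (1, 5); (1, 6); (2, 3); (2, 4); (2, 5); (3, 4); (3, 5); (3, 6); (4, 5); (4, 6); (5, 6)].
Definition K7_tests := [::
  [:: [:: 0; 1]; [:: 0; 2]; [:: 0; 6]; [:: 4; 1]; [:: 4; 2]; [:: 4; 6]; [:: 5; 1]; [:: 5; 2]; [:: 5; 6]];
  [:: [:: 0; 4]; [:: 0; 5]; [:: 0; 6]; [:: 1; 4]; [:: 1; 5]; [:: 1; 6]; [:: 3; 4]; [:: 3; 5]; [:: 3; 6]];
  [:: [:: 0; 1]; [:: 0; 3]; [:: 0; 5]; [:: 2; 4; 1]; [:: 2; 3]; [:: 2; 5]; [:: 6; 1]; [:: 6; 3]; [:: 6; 5]];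
  [:: [:: 0; 1]; [:: 0; 3]; [:: 0; 4]; [:: 2; 5; 1]; [:: 2; 3]; [:: 2; 4]; [:: 6; 1]; [:: 6; 3]; [:: 6; 4]];
  [:: [:: 1; 0; 2]; [:: 1; 0; 3]; [:: 1; 6]; [:: 4; 2]; [:: 4; 3]; [:: 4; 6]; [:: 5; 2]; [:: 5; 3]; [:: 5; 6]];
  [:: [:: 0; 1]; [:: 0; 2]; [:: 0; 5]; [:: 3; 6; 1]; [:: 3; 2]; [:: 3; 5]; [:: 4; 1]; [:: 4; 2]; [:: 4; 5]];
  [:: [:: 0; 2]; [:: 0; 4]; [:: 0; 6]; [:: 3; 2]; [:: 3; 4]; [:: 3; 6]; [:: 5; 2]; [:: 5; 4]; [:: 5; 6]]].
Lemma K7_certificate : certificate K7_tree K7_free K7_tests.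
Proof. by vm_compute. Qed.

Definition C6x2_tree := [:: (6, 2); (3, 10); (4, 7); (4, 6); (11, 3); (9, 5); (8, 4); (8, 1); (0, 11); (0, 9); (0, 8)].
Definition C6x2_free := [:: (1, 9); (1, 11); (2, 10); (3, 6); (3, 7); (5, 6); (5, 7)].
Definition C6x2_tests := [::
  [:: [:: 0; 8]; [:: 0; 9]; [:: 0; 11]; [:: 1; 8]; [:: 1; 9]; [:: 1; 11]; [:: 6; 4; 8]; [:: 6; 5; 9]; [:: 6; 3; 11]];
  [:: [:: 0; 9; 5; 6]; [:: 0; 9; 5; 7]; [:: 0; 11]; [:: 1; 8; 4; 6]; [:: 1; 8; 4; 7]; [:: 1; 11]; [:: 2; 6]; [:: 2; 10; 3; 7]; [:: 2; 10; 3; 11]];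
  [:: [:: 0; 8; 4; 6]; [:: 0; 8; 4; 7]; [:: 0; 9]; [:: 5; 6]; [:: 5; 7]; [:: 5; 9]; [:: 11; 3; 6]; [:: 11; 3; 7]; [:: 11; 1; 9]];
  [:: [:: 0; 11; 3; 7]; [:: 0; 8]; [:: 0; 9]; [:: 1; 11; 3; 7]; [:: 1; 8]; [:: 1; 9]; [:: 4; 7]; [:: 4; 8]; [:: 4; 6; 5; 9]];
  [:: [:: 0; 11; 3]; [:: 0; 8; 4]; [:: 0; 9; 5]; [:: 6; 3]; [:: 6; 4]; [:: 6; 5]; [:: 7; 3]; [:: 7; 4]; [:: 7; 5]]].
Lemma C6x2_certificate : certificate C6x2_tree C6x2_free C6x2_tests.
Proof. by vm_compute. Qed.

Definition K2K5_tree := [:: (3, 7); (2, 5); (9, 1); (6, 4); (6, 3); (6, 2); (0, 9); (0, 8); (0, 6)].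
Definition K2K5_free := [:: (1, 5); (1, 7); (2, 8); (3, 5); (3, 9); (4, 7); (4, 8)].
Definition K2K5_tests := [::
  [:: [:: 0; 9; 1]; [:: 0; 6]; [:: 0; 8]; [:: 2; 5; 1]; [:: 2; 6]; [:: 2; 8]; [:: 4; 7; 1]; [:: 4; 6]; [:: 4; 8]];
  [:: [:: 1; 5]; [:: 1; 9; 0; 6]; [:: 1; 7]; [:: 3; 5]; [:: 3; 6]; [:: 3; 7]; [:: 4; 8; 2; 5]; [:: 4; 6]; [:: 4; 7]];
  [:: [:: 0; 8; 2]; [:: 0; 6]; [:: 0; 9]; [:: 1; 5; 2]; [:: 1; 7; 4; 6]; [:: 1; 9]; [:: 3; 5; 2]; [:: 3; 6]; [:: 3; 9]];
  [:: [:: 1; 5]; [:: 1; 7; 4; 6]; [:: 1; 9]; [:: 2; 5]; [:: 2; 6]; [:: 2; 8; 0; 9]; [:: 3; 5]; [:: 3; 6]; [:: 3; 9]];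
  [:: [:: 0; 9; 3]; [:: 0; 6]; [:: 0; 8]; [:: 2; 5; 3]; [:: 2; 6]; [:: 2; 8]; [:: 4; 7; 3]; [:: 4; 6]; [:: 4; 8]]].
Lemma K2K5_certificate : certificate K2K5_tree K2K5_free K2K5_tests.
Proof. by vm_compute. Qed.

Definition K2K3K3_tree := [:: (7, 11); (7, 9); (8, 10); (2, 15); (2, 12); (17, 4); (16, 5); (16, 3); (14, 7); (14, 1); (13, 8); (13, 2); (0, 17); (0, 16); (0, 14); (0, 13)].
Definition K2K3K3_free := [:: (1, 12); (1, 17); (3, 10); (3, 11); (3, 17); (4, 9); (4, 15); (5, 15)].
Definition K2K3K3_tests := [::
  [:: [:: 2; 13; 8; 10; 3]; [:: 2; 15; 4; 9]; [:: 2; 12; 1; 14]; [:: 7; 11; 3]; [:: 7; 9]; [:: 7; 14]; [:: 17; 3]; [:: 17; 4; 9]; [:: 17; 1; 14]];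
  [:: [:: 2; 15; 5]; [:: 2; 12; 1; 14; 7; 11]; [:: 2; 15; 4; 17]; [:: 3; 16; 5]; [:: 3; 11]; [:: 3; 17]; [:: 13; 0; 16; 5]; [:: 13; 0; 14; 7; 11]; [:: 13; 0; 17]];
  [:: [:: 2; 13; 8; 10]; [:: 2; 12]; [:: 2; 15]; [:: 5; 16; 3; 10]; [:: 5; 16; 0; 17; 1; 12]; [:: 5; 15]; [:: 9; 7; 11; 3; 10]; [:: 9; 7; 14; 1; 12]; [:: 9; 4; 15]];
  [:: [:: 1; 12; 2]; [:: 1; 14]; [:: 1; 17]; [:: 5; 16; 0; 13; 2]; [:: 5; 16; 0; 14]; [:: 5; 16; 0; 17]; [:: 9; 7; 11; 3; 10; 8; 13; 2]; [:: 9; 7; 14]; [:: 9; 7; 11; 3; 17]];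
  [:: [:: 0; 14; 7; 9; 4]; [:: 0; 13; 2; 12]; [:: 0; 16]; [:: 15; 4]; [:: 15; 2; 12]; [:: 15; 5; 16]; [:: 17; 4]; [:: 17; 3; 10; 8; 13; 2; 12]; [:: 17; 3; 16]]].
Lemma K2K3K3_certificate : certificate K2K3K3_tree K2K3K3_free K2K3K3_tests.
Proof. by vm_compute. Qed.

Definition K3K4_tree := [:: (4, 3); (2, 8); (9, 6); (9, 4); (7, 2); (7, 1); (0, 11); (0, 9); (0, 7)].
Definition K3K4_free := [:: (1, 4); (1, 6); (2, 9); (2, 11); (3, 8); (4, 11); (6, 8); (6, 11)].
Definition K3K4_tests := [::
  [:: [:: 2; 8]; [:: 2; 9]; [:: 2; 11]; [:: 4; 3; 8]; [:: 4; 9]; [:: 4; 11]; [:: 6; 8]; [:: 6; 9]; [:: 6; 11]];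
  [:: [:: 1; 4]; [:: 1; 6]; [:: 1; 7]; [:: 2; 9; 4]; [:: 2; 8; 6]; [:: 2; 7]; [:: 11; 4]; [:: 11; 6]; [:: 11; 0; 7]];
  [:: [:: 1; 4]; [:: 1; 6]; [:: 1; 7]; [:: 2; 11; 4]; [:: 2; 8; 6]; [:: 2; 7]; [:: 9; 4]; [:: 9; 6]; [:: 9; 0; 7]];
  [:: [:: 0; 9; 4]; [:: 0; 7]; [:: 0; 11]; [:: 6; 9; 4]; [:: 6; 1; 7]; [:: 6; 11]; [:: 8; 3; 4]; [:: 8; 2; 7]; [:: 8; 2; 11]];
  [:: [:: 1; 7; 2]; [:: 1; 4]; [:: 1; 6]; [:: 9; 2]; [:: 9; 4]; [:: 9; 6]; [:: 11; 2]; [:: 11; 4]; [:: 11; 6]]].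
Lemma K3K4_certificate : certificate K3K4_tree K3K4_free K3K4_tests.
Proof. by vm_compute. Qed.

Definition K3K3_k33 := [:: [:: 2; 3]; [:: 2; 4]; [:: 2; 7]; [:: 6; 1; 3]; [:: 6; 4]; [:: 6; 5; 7]; [:: 8; 3]; [:: 8; 4]; [:: 8; 0; 7]].

Lemma planar_k33_obstruction (e : rel nat) t : irreflexive e ->
  subdivided_k33 e t -> parity_data false e -> False.
Proof.
move=> eirr kt D; have := test_form_true D eirr kt.
have s0 x s : seq_sgn (sgn D) x s = false.
  by elim: s x => //= y s IHs x; rewrite IHs (sgn_planar D).
by rewrite /test_form /k33_form !s0.
Qed.

(** The 15 pairs of disjoint edges of K_5. Every [W i j k] occurs for two values of [l],
    and every [T] occurs, in one order or the other, six times: for the six pairs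
    [T b c], ..., [T d e] that antisymmetry concerns, this leaves an odd number of
    ones. *)
Lemma k5_sum (I : Type) (W : I -> I -> I -> bool) (T : I -> I -> bool) (a b c d e : I) :
  let R i j k l := W i j k (+) W i j l (+) W k l i (+) W k l j
    (+) T i k (+) T i l (+) T j k (+) T j l in
  T c b = ~~ T b c -> T d b = ~~ T b d -> T e b = ~~ T b e -> T d c = ~~ T c d ->
  T e c = ~~ T c e -> T e d = ~~ T d e ->
  R a b c d (+) R a c b d (+) R a d b c (+) R a b c e (+) R a c b e
  (+) R a e b c (+) R a b d e (+) R a d b e (+) R a e b d (+) R a c d e
  (+) R a d c e (+) R a e c d (+) R b c d e (+) R b d c e (+) R b e c d = true.
Proof.
move=> R; rewrite /R.
move=> -> -> -> -> -> ->.
xor_ring.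
Qed.

Lemma planar_k5_obstruction (e : rel nat) : (forall i j, i < 5 -> j < 5 -> i != j -> e i j) ->
  parity_data false e -> False.
Proof.
move=> ee D.
have eqn i j k l : i < 5 -> j < 5 -> k < 5 -> l < 5 -> uniq [:: i; j; k; l] ->
    false = wind D i j k (+) wind D i j l (+) wind D k l i (+) wind D k l j
    (+) tour D i k (+) tour D i l (+) tour D j k (+) tour D j l.
  move=> i5 j5 k5 l5 u; rewrite -(parity_eq D _ _ u) ?(sgn_planar D) //.
    by apply: ee => //; move: u; rewrite uniq4E => /andP[].
  by apply: ee => //; move: u; rewrite uniq4E => u4; split_andb.
have := @k5_sum nat (wind D) (tour D) 0 1 2 3 4.
rewrite -!(tour_anti D) // => /(_ erefl erefl erefl erefl erefl erefl) H.
by rewrite !(=^~ eqn) in H.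
Qed.

From mathcomp Require Import all_classical all_analysis.
From mathcomp Require Import zify ring lra.
Import Order.TTheory GRing.Theory Num.Theory.
Import numFieldTopology.Exports numFieldNormedType.Exports.
Local Open Scope classical_set_scope.
Local Open Scope ring_scope.

(** * From arcs to chains *)

(** A point of the surface is represented by a unit vector [r a], which in the projective
    plane is determined up to sign and cannot be chosen continuously; this is why
    continuity is required of the affinity only. *)
Section ArcsToChains.
Variables (K : realType) (m : bool) (X : topologicalType) (r : X -> 'rV[K]_3).
Hypothesis r_unit : forall a, dot3 (r a) (r a) = 1.
Hypothesis r_inj : forall a b, affinity m (r a) (r b) = 1 -> a = b.
Hypothesis r_cont : continuous (fun ab : X * X => affinity m (r ab.1) (r ab.2)).

Lemma dot3_norm_le1 (u w : 'rV[K]_3) :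
  dot3 u u = 1 -> dot3 w w = 1 -> `|dot3 u w| <= 1.
Proof.
move=> u1 w1; rewrite ler_norml dot3_le1 // andbT -lerN2 opprK.
have -> : - dot3 u w = dot3 u (- w) by rewrite /dot3 !mxE; ring.
by apply: dot3_le1 => //; rewrite -w1 /dot3 !mxE; ring.
Qed.

Lemma affinity_le1 (u w : 'rV[K]_3) :
  dot3 u u = 1 -> dot3 w w = 1 -> affinity m u w <= 1.
Proof.
move=> u1 w1; rewrite /affinity; case: m; last exact: dot3_le1.
have := dot3_norm_le1 u1 w1; rewrite -(@ler_pXn2r _ 2) ?nnegrE //.
by rewrite real_normK ?num_real // expr1n.
Qed.

Lemma affinity_self a : affinity m (r a) (r a) = 1.
Proof. by rewrite /affinity r_unit expr1n; case: m. Qed.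

Lemma separated_arcs (A B : set X) : compact A -> compact B -> A !=set0 -> B !=set0 ->
  A `&` B = set0 ->
  exists2 d : K, 0 < d & forall a b, A a -> B b -> affinity m (r a) (r b) <= 1 - d.
Proof.
move=> cA cB [a0 Aa0] [b0 Bb0] AB0.
have cAB := compact_setX cA cB.
have AB_neq0 : (A `*` B) !=set0 by exists (a0, b0).
have [[a b] /= /set_mem[Aa Bb] abmax] :=
  compact_EVT_max AB_neq0 cAB (continuous_subspaceT r_cont).
exists (1 - affinity m (r a) (r b)).
  rewrite subr_gt0 lt_neqAle affinity_le1 // andbT; apply/negP => /eqP /r_inj ab.
  by have : set0 a by rewrite -AB0; split => //; rewrite ab.
move=> a' b' Aa' Bb'; rewrite subKr.
by apply: (abmax (a', b')); rewrite inE.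
Qed.

(** Uniform continuity, in the form of a Lebesgue number of the compact interval. *)
Lemma fine_mesh (c : K -> X) (eta : K) : {within `[0, 1], continuous c} -> 0 < eta ->
  exists n : nat, forall s t, s \in `[0, 1] -> t \in `[0, 1] ->
    `|s - t| <= n.+1%:R^-1 -> 1 - eta < affinity m (r (c s)) (r (c t)).
Proof.
move=> cc eta0.
pose P (n : nat) (s : K) := forall t, t \in `[0, 1] -> `|s - t| <= n.+1%:R^-1 ->
  1 - eta < affinity m (r (c s)) (r (c t)).
suff [n _ Pn] : \forall n \near \oo, `[0, 1]%classic `<=` P n.
  by exists n => s t s01; apply: (Pn n); rewrite /= ?leqnn.
have /compact_near_coveringP/near_covering_withinP ncov := @segment_compact K 0 1.
apply: ncov => x x01.
have := r_cont (x := (c x, c x)).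
move=> /(_ [set y | 1 - eta < y]) /=.
rewrite affinity_self => cnt.
have {cnt} : nbhs (c x, c x) [set p | 1 - eta < affinity m (r p.1) (r p.2)].
  apply: cnt; apply: (open_nbhs_nbhs); split; first exact: open_gt.
  by rewrite /= ltrBlDr ltrDl.
case=> -[U U'] /= [nU nU'] UU.
move/subspace_continuousP : cc => /(_ x x01) cx.
have : nbhs x [set s | `[0, 1]%classic s -> (U `&` U') (c s)].
  by apply: (cx (U `&` U')); apply: filterI.
case/nbhs_ballP => e /= e0 be.
have e20 : 0 < e / 2 by rewrite divr_gt0.
near=> s n => s01 t t01 st.
have sx : ball x (e / 2) s by near: s; exact: nbhsx_ballx.
have ne : n.+1%:R^-1 < e / 2.
  by near: n; exact: near_infty_natSinv_lt (PosNum e20).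
have [Us _] : (U `&` U') (c s).
  by apply: be => //; apply: le_ball sx; lra.
have [_ Ut] : (U `&` U') (c t).
  apply: be => //; rewrite (splitr e); apply: ball_triangle sx _.
  by rewrite /ball /= (le_lt_trans st).
exact: (UU (c s, c t)).
Unshelve. all: by end_near. Qed.

Lemma near_of_dot (e : K) (u w : 'rV[K]_3) : 0 <= e ->
  dot3 u u = 1 -> dot3 w w = 1 -> 1 - e ^+ 2 / 2 <= dot3 u w -> nearby e u w.
Proof.
move=> e0 u1 w1 uw l; rewrite -(@ler_pXn2r _ 2) ?nnegrE // real_normK ?num_real //.
have : dot3 (w - u) (w - u) <= e ^+ 2 by rewrite dot3_sub u1 w1; lra.
apply: le_trans; rewrite /dot3 !mxE.
have := sqr_ge0 (w 0 0 - u 0 0); have := sqr_ge0 (w 0 1 - u 0 1).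
have := sqr_ge0 (w 0 2%:R - u 0 2%:R); rewrite !expr2.
by have [->|->|->] := ord3P l; lra.
Qed.

Definition lifted_chain (c : K -> X) (e : K) (n : nat) (s : nat -> bool) (t : nat -> K) :=
  [/\ [/\ s 0%N = false, forall i, s i -> m, t 0%N = 0 & t n = 1],
    forall i, (i <= n)%N -> t i \in `[0, 1] &
    forall i, (i < n)%N ->
     nearby e ((-1) ^+ s i *: r (c (t i))) ((-1) ^+ s i.+1 *: r (c (t i.+1)))].

(** The signs [s] lift the arc to the sphere: each one is chosen so that the next vector
    is the closer one of the two antipodes. *)
Lemma arc_chain (c : K -> X) (e : K) : {within `[0, 1], continuous c} -> 0 < e -> e <= 1 ->
  exists n s t, lifted_chain c e n.+1 s t.
Proof.
move=> cc e0 e1.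
have [|n cn] := @fine_mesh c (e ^+ 2 / 2) cc; first by rewrite divr_gt0 // exprn_gt0.
pose t (i : nat) : K := i%:R / n.+1%:R.
pose flip i := m && (dot3 (r (c (t i))) (r (c (t i.+1))) < 0).
pose s i := \big[addb/false]_(j < i) flip j.
have n0 : 0 < n.+1%:R :> K by rewrite ltr0n.
have t01 i : (i <= n.+1)%N -> t i \in `[0, 1].
  by move=> i_n; rewrite in_itv /= divr_ge0 ?ler0n //= ler_pdivrMr // mul1r ler_nat.
exists n, s, t; split => //.
  split; [by rewrite /s big_ord0| |by rewrite /t mul0r|by rewrite /t divff // gt_eqF].
  move=> i; rewrite /s; case: (boolP m) => // m0.
  by rewrite big1 // => j _; rewrite /flip (negbTE m0).
move=> i i_n; have := cn (t i) (t i.+1) (t01 _ (ltnW i_n)) (t01 _ i_n).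
have -> : t i - t i.+1 = - n.+1%:R^-1.
  by rewrite /t -mulrBl -natr1 opprD addrA subrr add0r mulN1r.
rewrite normrN ger0_norm ?invr_ge0 ?ler0n // => /(_ (lexx _)) aff.
have -> : s i.+1 = s i (+) flip i by rewrite /s big_ord_recr.
rewrite signr_addb -scalerA; apply: near_sign.
move: aff; set u := r (c (t i)); rewrite /flip -/u; set w := r (c (t i.+1)) => aff.
apply: near_of_dot; rewrite ?(ltW e0) ?dot3_sign ?r_unit //.
have -> (b : bool) : dot3 u ((-1) ^+ b *: w) = (if b then - dot3 u w else dot3 u w).
  by case: b; rewrite /dot3 !mxE ?expr1 ?expr0; ring.
have := dot3_norm_le1 (r_unit (c (t i))) (r_unit (c (t i.+1))); rewrite -/u -/w.
move: aff; rewrite /affinity; case: (m) => [aff|aff _]; last exact: ltW.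
by rewrite andTb ler_norml => /andP[d1 d2]; case: ltP => d0; nra.
Qed.

(** Arcs of disjoint edges are disjoint compact sets, so a common positive distance [dmin]
    separates all of them, and the mesh of the chains is chosen with respect to it. *)
Lemma arcs_parity (G : simple_graph) : embeds_in K G X ->
  inhabited (parity_data m (@adj G)).
Proof.
case=> p [e [pinj earc evert edisj]].
have : forall xy : G * G, exists c : K -> X, adj xy.1 xy.2 ->
    [/\ {within `[0, 1], continuous c}, c 0 = p xy.1, c 1 = p xy.2 &
     e xy.1 xy.2 = c @` `[0, 1]].
  move=> -[x y] /=.
  have [xy|nxy] := boolP (adj x y); last by exists (fun=> p x).
  by have [_ [c [cc _ c0 c1 ce]]] := earc x y xy; exists c.
case/boolp.choice=> c cP.
have disj x y z w : adj x y -> adj z w -> uniq [:: x; y; z; w] ->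
    e x y `&` e z w = set0.
  rewrite uniq4E => xy zw u4; split_andb; apply/eqP/negPn/negP => /set0P[a [Aa Ba]].
  have nq : ~ ((x = z /\ y = w) \/ (x = w /\ y = z)).
    by case=> -[E1 E2]; subst; match goal with
      Hn : is_true (?b != ?b) |- _ => by rewrite eqxx in Hn end.
  have [v _ va] := edisj x y z w xy zw nq a (conj Aa Ba); subst a.
  by have [] := evert x y v xy Aa; have [] := evert z w v zw Ba; move=> -> E; subst;
   match goal with Hn : is_true (?b != ?b) |- _ => by rewrite eqxx in Hn end.
have : forall q : G * G * (G * G), exists d : K, 0 < d /\
   (adj q.1.1 q.1.2 -> adj q.2.1 q.2.2 -> uniq [:: q.1.1; q.1.2; q.2.1; q.2.2] ->
   forall a b, e q.1.1 q.1.2 a -> e q.2.1 q.2.2 b -> affinity m (r a) (r b) <= 1 - d).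
  move   => -[[x y] [z w]] /=.
  have [/and3P[xy zw u]|no] := boolP [&& adj x y, adj z w & uniq [:: x; y; z; w]]; last first.
    by exists 1; split => // xy zw u; case/negP: no; apply/and3P.
  have cpt x' y' : adj x' y' -> compact (e x' y') /\ e x' y' !=set0.
    move=> xy'; have [/= cc c0 _ ->] := cP (x', y') xy'; split.
      exact: continuous_compact cc (@segment_compact _ _ _).
    by exists (c (x', y') 0); exists 0 => //=; rewrite in_itv /= lexx ler01.
  have [c1 n1] := cpt x y xy; have [c2 n2] := cpt z w zw.
  have [d d0 dP] := separated_arcs c1 c2 n1 n2 (disj x y z w xy zw u).
  by exists d; split => // _ _ _ a b; exact: dP.
case/boolp.choice=> d dP; pose dmin := \big[Order.min/1]_q d q.
have dmin0 : 0 < dmin.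
  by rewrite /dmin; apply: lt_bigmin => // q _; have [] := dP q.
have dminP q : dmin <= d q by rewrite /dmin bigmin_le_cond.
pose eps := Order.min (dmin / 64) 32^-1.
have eps0 : 0 < eps by rewrite lt_min !divr_gt0 //= invr_gt0.
have eps1 : 64 * eps <= dmin by rewrite mulrC -ler_pdivlMr // ge_min lexx.
have eps2 : eps <= 32^-1 by rewrite ge_min lexx orbT.
have : forall xy : G * G, exists chain : nat * (nat -> bool) * (nat -> K),
    adj xy.1 xy.2 -> lifted_chain (c xy) eps chain.1.1.+1 chain.1.2 chain.2.
  move => xy.
  have [/cP[cc _ _ _]|] := boolP (adj xy.1 xy.2); last first.
    by exists (0%N, (fun=> false), (fun=> 0)).
  have eps1' : eps <= 1 by lra.
  have [n [s [t H]]] := arc_chain cc eps0 eps1'.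
  by exists (n, s, t).
case/boolp.choice=> chain chP.
pose len x y := (chain (x, y)).1.1.+1; pose s x y := (chain (x, y)).1.2.
pose t x y := (chain (x, y)).2.
have chE x y : adj x y -> lifted_chain (c (x, y)) eps (len x y) (s x y) (t x y).
  exact: chP (x, y).
have inarc x y i : adj x y -> (i <= len x y)%N -> e x y (c (x, y) (t x y i)).
  move=> xy il; have [_ _ _ ->] := cP (x, y) xy; exists (t x y i) => //=.
  by have [_ + _] := chE x y xy; exact.
apply: (@chains_parity K m G (@adj G) dmin eps (fun x => r (p x))
  (fun x y => m && s x y (len x y)) len
  (fun x y i => (-1) ^+ s x y i *: r (c (x, y) (t x y i)))) => //.
- exact: adj_sym.
- exact: adj_irrefl.
- by move=> ->.
- move=> x y xy; have [[s0 sm t0 t1] _ _] := chE x y xy; have [_ c0 c1 _] := cP (x, y) xy.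
  split => //; first by rewrite s0 t0 c0 scale1r.
  by rewrite t1 c1; case: (s x y (len x y)) (sm (len x y)) => [/(_ isT) ->|]; rewrite ?andbF.
- by move=> x y i xy il; rewrite dot3_sign.
- by move=> x y i xy il; have [_ _ +] := chE x y xy; exact.
- move=> x y z w i j xy zw u il jl.
  have [[_ sm _ _] _ _] := chE x y xy; have [[_ sm' _ _] _ _] := chE z w zw.
  rewrite affinity_sign; [|exact: sm|exact: sm'].
  have [_ dq] := dP ((x, y), (z, w)).
  rewrite (le_trans (dq xy zw u _ _ (inarc x y i xy il) (inarc z w j zw jl))) //.
  by rewrite lerB.
Qed.

End ArcsToChains.

(** * The sphere and the projective plane *)
Section CrosscapModels.
Variable K : realType.

Lemma dotp_dot3 (u v : 'rV[K]_3) : dotp u v = dot3 u v.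
Proof. by rewrite dotpE. Qed.

Section Rep.
Variable k : nat.
Local Notation X := (crosscap_sphere K k).
Local Notation S := (@holed_sphere K k).

Definition rep (a : X) : 'rV[K]_3 := val (repr a : S).

Lemma rep_unit a : dot3 (rep a) (rep a) = 1.
Proof. by rewrite -dotp_dot3; have /set_mem[] := valP (repr a : S). Qed.

(** The chosen representative is not a continuous function of the point, but a continuous
    function of it that is compatible with the gluing is. *)
Lemma rep_coord_continuous (g : 'rV[K]_3 -> K) : continuous g ->
  (forall p q : S, Defs.glue p q -> g (val p) = g (val q)) ->
  continuous (fun a : X => g (rep a)).
Proof.
move=> gc gg; have := @repr_comp_continuous S {eq_quot (glue_equiv K k)}%qT K
  (fun p : S => g (val p)).
apply.
  have vc : continuous (fun p : S => val p : 'rV[K]_3).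
    exact: (@initial_continuous S 'rV[K]_3 set_val).
  by move=> p; apply: continuous_comp; [exact: vc|exact: gc].
by move=> p q /eqP/eqmodP/gg /eqP.
Qed.

End Rep.

Lemma continuous_sum (T : topologicalType) n (f : 'I_n -> T -> K) :
  (forall i, continuous (f i)) -> continuous (fun t => \sum_(i < n) f i t).
Proof.
elim: n f => [|n IHn] f fc t.
  under eq_fun do rewrite big_ord0.
  exact: cvg_cst.
under eq_fun do rewrite big_ord_recr.
apply: cvgD; last exact: fc.
by apply: (IHn (fun i => f (widen_ord (leqnSn n) i))) => i.
Qed.

Lemma coord3_continuous (l : 'I_3) : continuous (fun u : 'rV[K]_3 => u 0 l).
Proof. exact: coord_continuous. Qed.

Lemma glue_sphere (p q : @holed_sphere K 0) : Defs.glue p q -> p = q.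
Proof. by case/orP => [/eqP//|/existsP[[]]]. Qed.

Lemma glue_projective (p q : @holed_sphere K 1) : Defs.glue p q ->
  val q = val p \/ val q = - val p.
Proof.
case/orP => [/eqP ->|/existsP[i /andP[_ /eqP ->]]]; first by left.
right; rewrite /cap_antipode /cap_height muln1.
by rewrite cos_pihalf mulr0 scale0r sub0r.
Qed.

Lemma projective_glue (p q : @holed_sphere K 1) : val q = - val p -> Defs.glue p q.
Proof.
move=> qp; rewrite /Defs.glue; apply/orP; right; apply/existsP; exists (ord0 : 'I_1).
have h0 : cap_height K 1 = 0 by rewrite /cap_height muln1 cos_pihalf.
rewrite /cap_antipode h0 mulr0 scale0r sub0r qp eqxx andbT.
have /set_mem[_ /(_ ord0)] := valP p; have /set_mem[_ /(_ ord0)] := valP q.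
rewrite h0 qp (_ : dotp (- val p) _ = - dotp (val p) (@cap_center K 1 ord0)).
  by rewrite oppr_le0 => h1 h2; apply/eqP/le_anti; rewrite h1 h2.
by rewrite !dotpE !mxE; ring.
Qed.

Lemma dot3_eq0 (v : 'rV[K]_3) : dot3 v v = 0 -> v = 0.
Proof.
rewrite /dot3 -!expr2 => e.
have := sqr_ge0 (v 0 0); have := sqr_ge0 (v 0 1); have := sqr_ge0 (v 0 2%:R) => a b c.
have sq0 (x : K) : x ^+ 2 = 0 -> x = 0 by move/eqP; rewrite sqrf_eq0 => /eqP.
by apply: row3P; rewrite mxE; apply: sq0; lra.
Qed.

Lemma dot3_eq1 (u w : 'rV[K]_3) : dot3 u u = 1 -> dot3 w w = 1 ->
  dot3 u w = 1 -> u = w.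
Proof.
move=> u1 w1 uw; apply/esym/subr0_eq/dot3_eq0.
by rewrite dot3_sub u1 w1 uw; ring.
Qed.

Lemma sphere_parity (G : simple_graph) : embeds_in K G (crosscap_sphere K 0) ->
  inhabited (parity_data false (@adj G)).
Proof.
apply: (@arcs_parity K false (crosscap_sphere K 0) (@rep 0)).
- exact: rep_unit.
- move=> a b /= /(dot3_eq1 (rep_unit a) (rep_unit b)) /val_inj E.
  by rewrite -[a]reprK -[b]reprK E.
- have rc (l : 'I_3) : continuous (fun a : crosscap_sphere K 0 => rep a 0 l).
    apply: (@rep_coord_continuous 0 (fun u => u 0 l)); first exact: coord3_continuous.
    by move=> p q /glue_sphere ->.
  have c1 l : continuous (fun ab : crosscap_sphere K 0 * crosscap_sphere K 0 =>
     rep ab.1 0 l * rep ab.2 0 l).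
    move=> ab; apply: continuousM.
      apply: (@continuous_comp _ _ _ fst (fun a => rep a 0 l));
        [exact: cvg_fst|exact: rc].
    apply: (@continuous_comp _ _ _ snd (fun a => rep a 0 l));
      [exact: cvg_snd|exact: rc].
  rewrite (_ : (fun ab => _) = (fun ab : crosscap_sphere K 0 * crosscap_sphere K 0 =>
     \sum_(l < 3) rep ab.1 0 l * rep ab.2 0 l)).
    by apply: continuous_sum => l; exact: c1.
  by apply/funext => ab /=; rewrite -dotp_dot3.
Qed.

(** The squared scalar product is a sum of products of the functions [u 0 l * u 0 l'], which
    do not distinguish [u] from [- u]. *)
Lemma projective_parity (G : simple_graph) : embeds_in K G (crosscap_sphere K 1) ->
  inhabited (parity_data true (@adj G)).
Proof.
apply: (@arcs_parity K true (crosscap_sphere K 1) (@rep 1)).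
- exact: rep_unit.
- move=> a b /= /eqP; rewrite sqrf_eq1 => /orP[] /eqP ab.
    have /val_inj E := dot3_eq1 (rep_unit a) (rep_unit b) ab.
    by rewrite -[a]reprK -[b]reprK E.
  have E : rep b = - rep a.
    have aN : dot3 (- rep a) (- rep a) = 1 by rewrite -(rep_unit a) /dot3 !mxE; ring.
    apply/esym/dot3_eq1 => //; first exact: rep_unit.
    by rewrite -[RHS]opprK -ab /dot3 !mxE; ring.
  rewrite -[a]reprK -[b]reprK; apply/eqmodP; exact: projective_glue.
- have rc (l l' : 'I_3) : continuous (fun a : crosscap_sphere K 1 => rep a 0 l * rep a 0 l').
    apply: (@rep_coord_continuous 1 (fun u => u 0 l * u 0 l')).
      by move=> u; apply: continuousM; exact: coord3_continuous.
    by move=> p q /glue_projective[] ->; rewrite ?mxE ?mulrNN.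
  have c1 l l' : continuous (fun ab : crosscap_sphere K 1 * crosscap_sphere K 1 =>
     (rep ab.1 0 l * rep ab.1 0 l') * (rep ab.2 0 l * rep ab.2 0 l')).
    move=> ab; apply: cvgM.
      apply: (@continuous_comp _ _ _ fst (fun a => rep a 0 l * rep a 0 l'));
        [exact: cvg_fst|exact: rc].
    apply: (@continuous_comp _ _ _ snd (fun a => rep a 0 l * rep a 0 l'));
      [exact: cvg_snd|exact: rc].
  rewrite (_ : (fun ab => _) = (fun ab : crosscap_sphere K 1 * crosscap_sphere K 1 =>
     \sum_(l < 3) \sum_(l' < 3)
       (rep ab.1 0 l * rep ab.1 0 l') * (rep ab.2 0 l * rep ab.2 0 l'))).
    by do 2![apply: continuous_sum => ?]; exact: c1.
  apply/funext => ab /=; rewrite -dotp_dot3 /dotp expr2 mulr_suml.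
  apply: eq_bigr => l _; rewrite mulr_sumr; apply: eq_bigr => l' _; ring.
Qed.

End CrosscapModels.

(** * Radial projection to the sphere and to the projective plane *)
Section RadialProjection.
Variable K : realType.
Implicit Types u v w : 'rV[K]_3.

Lemma dot3_gt0 v : v != 0 -> 0 < dot3 v v.
Proof. by rewrite lt_def dot3_ge0 andbT; apply: contraNneq => /dot3_eq0 ->. Qed.

Definition radius v : K := Num.sqrt (dot3 v v).

Lemma radius_gt0 v : v != 0 -> 0 < radius v.
Proof. by move=> v0; rewrite sqrtr_gt0 dot3_gt0. Qed.

Definition unit_vec v : 'rV[K]_3 := (radius v)^-1 *: v.

Lemma unit_vec_unit v : v != 0 -> dot3 (unit_vec v) (unit_vec v) = 1.
Proof.
move=> v0; have r0 := radius_gt0 v0.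
have -> : dot3 (unit_vec v) (unit_vec v) = (radius v ^+ 2)^-1 * dot3 v v.
  by rewrite /dot3 !mxE -exprVn; ring.
by rewrite /radius sqr_sqrtr ?dot3_ge0 // mulVf // gt_eqF // dot3_gt0.
Qed.

Lemma unit_vecN v : unit_vec (- v) = - unit_vec v.
Proof.
rewrite /unit_vec /radius scalerN; congr (- (_^-1 *: _)); congr Num.sqrt.
by rewrite /dot3 !mxE; ring.
Qed.

Lemma unit_vec_inj u v : u != 0 -> v != 0 -> unit_vec u = unit_vec v ->
  exists2 s, 0 < s & u = s *: v.
Proof.
move=> u0 v0 e; exists (radius u / radius v); first by rewrite divr_gt0 ?radius_gt0.
by rewrite -scalerA -[_ *: v]e /unit_vec scalerA divff ?scale1r // gt_eqF // radius_gt0.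
Qed.

Lemma dot3_continuous : continuous (fun w : 'rV[K]_3 => dot3 w w).
Proof.
have c1 (l : 'I_3) : continuous (fun w : 'rV[K]_3 => w 0 l * w 0 l).
  by move=> v; apply: continuousM; exact: coord3_continuous.
have -> : (fun w : 'rV[K]_3 => dot3 w w) = (fun w => \sum_(l < 3) w 0 l * w 0 l).
  by apply/funext => w; rewrite -dotp_dot3.
exact: continuous_sum.
Qed.

Lemma rowvec_continuous (T : topologicalType) (f : T -> 'rV[K]_3) (x : T) :
  (forall l, {for x, continuous (fun y => f y 0 l)}) -> {for x, continuous f}.
Proof.
move=> fc U [P nP PU].
have : \forall y \near x, forall l, P 0 l (f y 0 l).
  by apply: filter_forall => l; apply: fc; exact: nP.
by apply: filterS => y Py; apply: PU => i l; rewrite ord1.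
Qed.

Lemma unit_vec_continuous v : v != 0 -> {for v, continuous unit_vec}.
Proof.
move=> v0.
have cr : {for v, continuous radius}.
  apply: (@continuous_comp _ _ _ (fun w => dot3 w w) Num.sqrt).
    exact: dot3_continuous.
  exact: sqrt_continuous.
have r0 : radius v != 0 by rewrite gt_eqF // radius_gt0.
have cg := continuousV r0 cr.
apply: rowvec_continuous => l; rewrite (_ : (fun w => _) =
  (fun w => (radius w)^-1 * w 0 l)); last by apply/funext => w; rewrite mxE.
exact: (continuousM cg (@coord3_continuous K l v)).
Qed.

(** A name for [nbhs] that hides the filters of row vectors from unification. *)
Definition around (T : topologicalType) (x : T) : set_system T := nbhs x.

Lemma around_gt (T : topologicalType) (f : T -> K) (x : T) a :
  {for x, continuous f} -> a < f x -> around x [set y | a < f y].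
Proof. by move=> fc ax; exact: (cvgr_gt _ fc). Qed.

Lemma around_lt (T : topologicalType) (f : T -> K) (x : T) a :
  {for x, continuous f} -> f x < a -> around x [set y | f y < a].
Proof. by move=> fc ax; exact: (cvgr_lt _ fc). Qed.

Lemma aroundS (T : topologicalType) (x : T) (A B : set T) :
  A `<=` B -> around x A -> around x B.
Proof. exact: filterS. Qed.

Lemma aroundS2 (T : topologicalType) (x : T) (A B C : set T) :
  (forall y, A y -> B y -> C y) -> around x A -> around x B -> around x C.
Proof. by move=> ABC xA xB; exact: filterS2 ABC xA xB. Qed.

Lemma near_nonzero v : v != 0 -> around v [set w | w != 0].
Proof.
move=> v0; have := around_gt (@dot3_continuous v) (dot3_gt0 v0).
apply: aroundS => w /=; apply: contraTneq => ->.
by rewrite /dot3 !mxE !mul0r !addr0 ltxx.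
Qed.

Lemma holed_sphere0 u : dot3 u u = 1 -> @holed_sphere K 0 u.
Proof. by rewrite -dotp_dot3 => u1; split => // -[]. Qed.

Lemma holed_sphere1 u : dot3 u u = 1 -> u 0 0 <= 0 -> @holed_sphere K 1 u.
Proof.
rewrite -dotp_dot3 => u1 u0; split => // i.
rewrite /cap_height muln1 cos_pihalf dotp_center /cap_angle.
have -> : (2 * i = 0)%N by case: i => -[].
by rewrite mulr0 mul0r cos0 sin0 mulr0 addr0 mulr1.
Qed.

Definition pole_vec : 'rV[K]_3 := vec3 0 0 1.

Lemma pole_unit : dot3 pole_vec pole_vec = 1.
Proof. by rewrite /dot3 !vec3E; ring. Qed.

Lemma pole_low : pole_vec 0 0 <= 0.
Proof. by rewrite vec3E. Qed.

Definition sphere_base : @holed_sphere K 0 :=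
  exist _ pole_vec (mem_set (holed_sphere0 pole_unit)).

Definition projective_base : @holed_sphere K 1 :=
  exist _ pole_vec (mem_set (holed_sphere1 pole_unit pole_low)).

Definition to_sphere v : crosscap_sphere K 0 :=
  \pi%qT (insubd sphere_base (unit_vec v)).

(** The projective plane is a closed hemisphere with antipodal points of its rim glued. *)
Definition lower u : 'rV[K]_3 := if u 0 0 <= 0 then u else - u.

Definition to_projective v : crosscap_sphere K 1 :=
  \pi%qT (insubd projective_base (lower (unit_vec v))).

Lemma open_crosscap k (O : set (crosscap_sphere K k)) : open O ->
  exists2 W : set 'rV[K]_3, open W &
    forall p : @holed_sphere K k, W (val p) <-> O (\pi%qT p).
Proof.
case=> W oW WO; exists W => // p.
by have := congr1 (fun S : set (@holed_sphere K k) => S p) WO => /= ->.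
Qed.

Lemma val_to_sphere w : w != 0 -> val (insubd sphere_base (unit_vec w)) = unit_vec w.
Proof. by move=> w0; rewrite insubdK // inE; apply/holed_sphere0/unit_vec_unit. Qed.

Lemma to_sphere_continuous v : v != 0 -> {for v, continuous to_sphere}.
Proof.
move=> v0 U; rewrite nbhsE => -[Q [oQ Qv] QU].
have [W oW WO] := open_crosscap oQ.
have Wv : W (unit_vec v) by rewrite -val_to_sphere //; apply/WO.
have nW : nbhs (unit_vec v) W by apply: open_nbhs_nbhs.
have uW : around v (unit_vec @^-1` W) by exact: (unit_vec_continuous v0 nW).
suff : around v (to_sphere @^-1` U) by [].
apply: aroundS2 (near_nonzero v0) uW => w w0 Ww.
by apply: QU; apply/WO; rewrite val_to_sphere.
Qed.

Lemma lower_unit u : dot3 u u = 1 -> @holed_sphere K 1 (lower u).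
Proof.
rewrite /lower; case: leP => u0 u1; first exact: holed_sphere1.
by apply: holed_sphere1; rewrite ?mxE ?oppr_le0 ?ltW // -u1 /dot3 !mxE; ring.
Qed.

Lemma val_to_projective w : dot3 w w = 1 ->
  val (insubd projective_base (lower w)) = lower w.
Proof. by move=> w1; rewrite insubdK // inE; apply/lower_unit. Qed.

(** On the rim, where [lower] jumps, a neighbourhood contains both antipodes since they
    are glued; so each side of the rim can be treated with its own sign. *)
Lemma to_projective_continuous v : v != 0 -> {for v, continuous to_projective}.
Proof.
move=> v0 U; rewrite nbhsE => -[Q [oQ Qv] QU].
have [W oW WO] := open_crosscap oQ.
have Wv : W (lower (unit_vec v)).
  by rewrite -val_to_projective ?unit_vec_unit //; apply/WO.
set q := unit_vec v in Wv.
have qu : dot3 q q = 1 by exact: unit_vec_unit.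
have uc := unit_vec_continuous v0.
have cc : {for v, continuous (fun w => unit_vec w 0 0)}.
  by apply: (@continuous_comp _ _ _ unit_vec (fun u => u 0 0)) => //; exact: coord3_continuous.
have cN : {for v, continuous (fun w => - unit_vec w)}.
  apply: rowvec_continuous => l; rewrite (_ : (fun w => _) =
    (fun w => - unit_vec w 0 l)); last by apply/funext => w; rewrite mxE.
  have uc' : {for v, continuous (fun w => unit_vec w 0 l)}.
    by apply: (@continuous_comp _ _ _ unit_vec (fun u => u 0 l)) => //; exact: coord3_continuous.
  exact: (continuousN uc').
have le_side : around v [set w | unit_vec w 0 0 <= 0 -> W (unit_vec w)].
  have [q0|q0] := leP (q 0 0) 0; last first.
    have := around_gt cc q0.
    by apply: aroundS => w /=; rewrite ltNge => /negbTE ->.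
  have nW : nbhs q W.
    by apply: open_nbhs_nbhs; split => //; move: Wv; rewrite /lower q0.
  have uW : around v (unit_vec @^-1` W) by exact: (uc W nW).
  by move: uW; apply: aroundS => w /= Ww _.
have gt_side : around v [set w | 0 < unit_vec w 0 0 -> W (- unit_vec w)].
  have [q0|q0] := ltP (q 0 0) 0.
    have := around_lt cc q0.
    by apply: aroundS => w /= w0 w1; have := lt_trans w0 w1; rewrite ltxx.
  have nW : nbhs (- q) W.
    apply: open_nbhs_nbhs; split => //; move: Wv; rewrite /lower.
    case: leP => // q0'; have q00 : q 0 0 = 0 by apply/le_anti; rewrite q0 q0'.
    have hq : @holed_sphere K 1 q by exact: holed_sphere1.
    have hNq : @holed_sphere K 1 (- q).
      apply: holed_sphere1; last by rewrite mxE oppr_le0.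
      by rewrite -qu /dot3 !mxE; ring.
    pose p1 : @holed_sphere K 1 := exist _ q (mem_set hq).
    pose p2 : @holed_sphere K 1 := exist _ (- q) (mem_set hNq).
    move=> Wq; have /WO Op1 : W (val p1) by [].
    have /WO : Q (\pi%qT p2).
      by rewrite (_ : \pi%qT p2 = \pi%qT p1) //; apply/eqmodP/projective_glue; rewrite opprK.
    by [].
  have uW : around v ((fun w => - unit_vec w) @^-1` W) by exact: (cN W nW).
  by move: uW; apply: aroundS => w /= Ww _.
suff : around v (to_projective @^-1` U) by [].
have := aroundS2 (fun w A B => conj A B) le_side gt_side.
apply: aroundS2 (near_nonzero v0) => w w0 [Wle Wgt].
apply: QU; apply/WO; rewrite val_to_projective ?unit_vec_unit // /lower.
by case: leP => w1; [exact: Wle|exact: Wgt].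
Qed.

Lemma to_sphere_inj u v : u != 0 -> v != 0 -> to_sphere u = to_sphere v ->
  exists2 s, 0 < s & u = s *: v.
Proof.
move=> u0 v0 /eqmodP/glue_sphere/(congr1 val); rewrite !val_to_sphere //.
exact: unit_vec_inj.
Qed.

Lemma to_projective_inj u v : u != 0 -> v != 0 -> to_projective u = to_projective v ->
  exists2 s, s != 0 & u = s *: v.
Proof.
have lowE w : exists b : bool, lower w = (-1) ^+ b *: w.
  rewrite /lower; case: ifP => _; [exists false|exists true].
    by rewrite scale1r.
  by rewrite scaleN1r.
move=> u0 v0 /eqmodP/glue_projective; rewrite !val_to_projective ?unit_vec_unit //.
have [b ->] := lowE (unit_vec u); have [c ->] := lowE (unit_vec v).
have base (e : bool) : unit_vec u = (-1) ^+ e *: unit_vec v ->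
    exists2 s, s != 0 & u = s *: v.
  move=> E; have {E} : unit_vec u = unit_vec ((-1) ^+ e *: v).
    by rewrite E; case: e {E}; rewrite ?scale1r ?scaleN1r ?unit_vecN.
  have n0 : (-1) ^+ e *: v != 0 by rewrite scaler_eq0 negb_or signr_eq0.
  case/(unit_vec_inj u0 n0) => s s0 ->; exists (s * (-1) ^+ e).
    by rewrite mulf_neq0 ?signr_eq0 // gt_eqF.
  by rewrite scalerA.
by case: b; case: c; rewrite ?expr1 ?expr0 ?scaleN1r ?scale1r ?opprK => -[] E;
  solve [ apply: (base false); rewrite scale1r ?E ?opprK //; apply/oppr_inj; rewrite ?E ?opprK //
        | apply: (base true); rewrite expr1 scaleN1r ?E ?opprK // -?E ?opprK //].
Qed.

Lemma to_projectiveN v : v != 0 -> to_projective (- v) = to_projective v.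
Proof.
move=> v0; rewrite /to_projective unit_vecN; apply/eqmodP.
have u1 := unit_vec_unit v0.
have Nu1 : dot3 (- unit_vec v) (- unit_vec v) = 1 by rewrite -u1 /dot3 !mxE; ring.
set p := insubd _ _; set q := insubd _ _.
have [pE qE] : val p = lower (- unit_vec v) /\ val q = lower (unit_vec v).
  by rewrite !val_to_projective.
have [e|e] : val q = val p \/ val q = - val p.
  rewrite pE qE /lower !mxE oppr_le0.
  by case: (0 <= _); case: (_ <= 0); rewrite ?opprK; solve [by left | by right].
- by rewrite (val_inj e); apply/eqmodP.
- exact: projective_glue.
Qed.

End RadialProjection.

(** * Drawings by geodesic segments *)

(** The edge [xy] is the image under the radial projection [Psi] of the segment from [P x]
    to [P y], or to [- P y] if [sg x y]. Two points have the same image when they are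
    proportional, so the conditions for an embedding are conditions on cones:
    [P_vertex] for vertices on edges, [P_cross] for disjoint edges, [P_fan] for edges with
    a common end. *)
Section GeodesicEmbedding.
Variables (K : realType) (m : bool) (X : topologicalType) (Psi : 'rV[K]_3 -> X).
Hypothesis Psi_cont : forall v, v != 0 -> {for v, continuous Psi}.
Hypothesis Psi_inj : forall u v, u != 0 -> v != 0 -> Psi u = Psi v ->
  exists s, [/\ s != 0, ~~ m -> 0 < s & u = s *: v].
Hypothesis PsiN : m -> forall v, v != 0 -> Psi (- v) = Psi v.
Variables (G : simple_graph) (P : G -> 'rV[K]_3) (sg : G -> G -> bool).
Hypothesis sg_sym : forall x y, sg y x = sg x y.
Hypothesis sg_m : forall x y, sg x y -> m.
Hypothesis P_neq0 : forall x, P x != 0.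
Hypothesis P_distinct : forall x y s, x != y -> s != 0 -> (~~ m -> 0 < s) ->
  P x <> s *: P y.
Hypothesis P_free : forall x y a b, adj x y -> a *: P x + b *: P y = 0 -> a = 0 /\ b = 0.
Hypothesis P_vertex : forall x y z a b s, adj x y -> z != x -> z != y ->
  0 <= a -> 0 <= b -> s != 0 -> (~~ m -> 0 < s) ->
  a *: P x + (b * (-1) ^+ sg x y) *: P y <> s *: P z.
Hypothesis P_cross : forall x y z w a b c d (e : bool), adj x y -> adj z w ->
  uniq [:: x; y; z; w] -> 0 <= a -> 0 <= b -> 0 <= c -> 0 <= d -> (e -> m) ->
  a *: P x + (b * (-1) ^+ sg x y) *: P y =
   (-1) ^+ e *: (c *: P z + (d * (-1) ^+ sg z w) *: P w) -> a = 0 /\ b = 0.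
Hypothesis P_fan : forall x y w a b c d (e : bool), adj x y -> adj x w ->
  y != w -> 0 <= a -> 0 <= b -> 0 <= c -> 0 <= d -> (e -> m) ->
  a *: P x + (b * (-1) ^+ sg x y) *: P y =
   (-1) ^+ e *: (c *: P x + (d * (-1) ^+ sg x w) *: P w) -> b = 0.

Definition geodesic x y (t : K) : 'rV[K]_3 :=
  (1 - t) *: P x + (t * (-1) ^+ sg x y) *: P y.

Definition geodesic_arc x y : set X := (fun t => Psi (geodesic x y t)) @` `[0, 1].

Lemma geodesic_neq0 x y t : adj x y -> geodesic x y t != 0.
Proof.
move=> xy; apply/eqP => /(P_free xy)[t1 /eqP]; rewrite mulf_eq0 signr_eq0 orbF => /eqP t0.
by move: t1; rewrite t0 subr0 => /eqP; rewrite oner_eq0.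
Qed.

Lemma geodesic_rev x y t : geodesic y x t = (-1) ^+ sg x y *: geodesic x y (1 - t).
Proof.
rewrite /geodesic sg_sym scalerDr !scalerA addrC; congr (_ *: _ + _ *: _).
  by rewrite subKr mulrC.
by rewrite mulrCA -signr_addb addbb mulr1.
Qed.

Lemma Psi_sign (b : bool) v : v != 0 -> (b -> m) -> Psi ((-1) ^+ b *: v) = Psi v.
Proof.
by case: b => [v0 /(_ isT) m1|_ _]; rewrite ?scaleN1r ?scale1r // PsiN.
Qed.

Lemma geodesic_arc_sub x y : adj x y -> geodesic_arc y x `<=` geodesic_arc x y.
Proof.
move=> xy _ [t /= t01 <-]; exists (1 - t).
  by move: t01; rewrite /= !in_itv /=; lra.
by rewrite (geodesic_rev x y t) Psi_sign ?geodesic_neq0 //; exact: sg_m.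
Qed.

Lemma geodesic_arc_sym x y : adj x y -> geodesic_arc y x = geodesic_arc x y.
Proof.
by move=> xy; apply/seteqP; split; apply: geodesic_arc_sub; rewrite // adj_sym.
Qed.

Lemma geodesic_continuous x y : continuous (geodesic x y).
Proof.
move=> t; apply: rowvec_continuous => l.
rewrite (_ : (fun _ => _) = (fun t => (1 - t) * P x 0 l + t * ((-1) ^+ sg x y * P y 0 l))).
  apply: cvgD; apply: cvgM; try exact: cvg_cst; last exact: cvg_id.
  by apply: cvgB; [exact: cvg_cst|exact: cvg_id].
by apply/funext => r; rewrite /geodesic !mxE mulrA.
Qed.

Lemma geodesic_simple_arc x y : adj x y ->
  simple_arc K (Psi (P x)) (Psi (P y)) (geodesic_arc x y).
Proof.
move=> xy; have xny : x != y by apply: contraTneq xy => ->; rewrite adj_irrefl.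
exists (fun t => Psi (geodesic x y t)); split => //.
- apply: continuous_in_subspaceT => t _.
  apply: (@continuous_comp _ _ _ (geodesic x y) Psi); first exact: geodesic_continuous.
  by apply: Psi_cont; exact: geodesic_neq0.
- move=> t t' _ _ /= /Psi_inj[||s [s0 sm]]; try exact: geodesic_neq0.
  rewrite /geodesic scalerDr !scalerA => /eqP; rewrite -subr_eq0 opprD addrACA.
  rewrite -!scalerBl => /eqP /(P_free xy)[h1 /eqP].
  rewrite mulrA -mulrBl mulf_eq0 signr_eq0 orbF => /eqP h2.
  have s1 : s = 1 by lra.
  by move: h2; rewrite s1 mul1r => /subr0_eq.
- by rewrite /geodesic subr0 scale1r mul0r scale0r addr0.
- rewrite /geodesic subrr scale0r add0r mul1r Psi_sign //; exact: sg_m.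
Qed.

Lemma arc_meets_sign u v : u != 0 -> v != 0 -> Psi u = Psi v ->
  exists (e : bool) (s : K), [/\ e -> m, 0 < s & u = (-1) ^+ e *: (s *: v)].
Proof.
move=> u0 v0 /(Psi_inj u0 v0)[s [s0 sm ->]].
case: (ltP 0 s) => hs; first by exists false, s; split => //; rewrite scale1r.
have {}hs : s < 0 by rewrite lt_neqAle s0.
exists true, (- s); split; rewrite ?oppr_gt0 // ?scaleN1r ?scaleNr ?opprK //.
by move=> _; apply/negPn/negP => /sm hs2; have := lt_trans hs hs2; rewrite ltxx.
Qed.

Lemma geodesic_disjoint x y z w a : adj x y -> adj z w -> uniq [:: x; y; z; w] ->
  geodesic_arc x y a -> geodesic_arc z w a -> False.
Proof.
move=> xy zw u [t /= t01 <-] [t' /= t01' /esym].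
case/arc_meets_sign; try exact: geodesic_neq0.
move=> e [s [em s0]]; rewrite {2}/geodesic scalerDr !scalerA (mulrA s) => E.
move: t01 t01'; rewrite !in_itv /= => /andP[t0 t1] /andP[t0' t1'].
have t1_ : 0 <= 1 - t by rewrite subr_ge0.
have st : 0 <= s * (1 - t') by rewrite mulr_ge0 ?subr_ge0 // ltW.
have st' : 0 <= s * t' by rewrite mulr_ge0 // ltW.
by have [h1 h2] := P_cross xy zw u t1_ t0 st st' em E; lra.
Qed.

Lemma geodesic_share x y w a : adj x y -> adj x w -> y != w ->
  geodesic_arc x y a -> geodesic_arc x w a -> a = Psi (P x).
Proof.
move=> xy xw yw [t /= t01 <-] [t' /= t01' /esym].
case/arc_meets_sign; try exact: geodesic_neq0.
move=> e [s [em s0]]; rewrite {2}/geodesic scalerDr !scalerA (mulrA s) => E.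
move: t01 t01'; rewrite !in_itv /= => /andP[t0 t1] /andP[t0' t1'].
have t00 : t = 0.
  have t1_ : 0 <= 1 - t by rewrite subr_ge0.
  have st : 0 <= s * (1 - t') by rewrite mulr_ge0 ?subr_ge0 // ltW.
  have st' : 0 <= s * t' by rewrite mulr_ge0 // ltW.
  exact: (P_fan xy xw yw t1_ t0 st st' em E).
by rewrite t00 /geodesic subr0 scale1r mul0r scale0r addr0.
Qed.

Lemma geodesic_embedding : embeds_in K G X.
Proof.
exists (fun x => Psi (P x)), geodesic_arc; split.
- move=> x y /Psi_inj[//|//|s [s0 sm E]]; apply/eqP/negPn/negP => xy.
  exact: (P_distinct xy s0 sm E).
- by move=> x y xy; rewrite geodesic_arc_sym //; split => //; exact: geodesic_simple_arc.
- move=> x y z xy [t /= t01]; case/Psi_inj => //; first exact: geodesic_neq0.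
  move=> s [s0 sm E]; case: (eqVneq z x) => [->|zx]; first by left.
  case: (eqVneq z y) => [->|zy]; first by right.
  move: t01; rewrite in_itv /= => /andP[t0 t1]; exfalso.
  by apply: (P_vertex xy zx zy _ t0 s0 sm E); rewrite subr_ge0.
move=> x y z w xy zw nsame a [Aa Ba].
have [u|] := boolP (uniq [:: x; y; z; w]).
  by case: (geodesic_disjoint xy zw u Aa Ba).
have xny : x != y by apply: contraTneq xy => ->; rewrite adj_irrefl.
have znw : z != w by apply: contraTneq zw => ->; rewrite adj_irrefl.
rewrite uniq4E xny znw andbT /= => H.
have yx : adj y x by rewrite adj_sym.
have wz : adj w z by rewrite adj_sym.
have Aa' : geodesic_arc y x a by rewrite geodesic_arc_sym.
have Ba' : geodesic_arc w z a by rewrite geodesic_arc_sym.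
have share x' y' w' : adj x' y' -> adj x' w' -> y' <> w' ->
    geodesic_arc x' y' a -> geodesic_arc x' w' a -> range (fun x => Psi (P x)) a.
  by move=> xy' xw' /eqP yw' Aa1 Ba1; exists x' => //; apply/esym/(geodesic_share xy' xw').
case: (eqVneq x z) H => [E _|_ H].
  by subst z; apply: (share x y w) => // E; apply: nsame; left.
case: (eqVneq x w) H => [E _|_ H].
  by subst w; apply: (share x y z) => // E; apply: nsame; right.
case: (eqVneq y z) H => [E _|_ H].
  by subst z; apply: (share y x w) => // E; apply: nsame; right.
case: (eqVneq y w) H => [E _|//].
by subst w; apply: (share y x z) => // E; apply: nsame; left.
Qed.

End GeodesicEmbedding.

(** * Straight drawings *)
Section Drawings.
Variable K : realType.
Implicit Types (u v : 'rV[K]_3).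

Lemma det3_comb1 (a b : K) u v (x y : 'rV[K]_3) :
  det3 u v (a *: x + b *: y) = a * det3 u v x + b * det3 u v y.
Proof. by rewrite !det3.unlock !mxE; ring. Qed.

Lemma det3Z (a : K) u v (x : 'rV[K]_3) : det3 u v (a *: x) = a * det3 u v x.
Proof. by rewrite !det3.unlock !mxE; ring. Qed.

Lemma det3_aa u v : (det3 u v u = 0) * (det3 u v v = 0).
Proof. by rewrite !det3.unlock; split; ring. Qed.

Lemma weighted_sum_eq0 (a b p q : K) : 0 <= a -> 0 <= b -> 0 < p * q ->
  a * p + b * q = 0 -> a = 0 /\ b = 0.
Proof.
move=> a0 b0 pq e.
have p0 : p != 0 by apply: contraTneq pq => ->; rewrite mul0r ltxx.
have e1 : a * p ^+ 2 + b * (p * q) = 0 by rewrite -[RHS](mul0r p) -e; ring.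
have p2 : 0 < p ^+ 2 by rewrite exprn_even_gt0.
have h1 : 0 <= a * p ^+ 2 by rewrite mulr_ge0 // ltW.
have h2 : 0 <= b * (p * q) by rewrite mulr_ge0 // ltW.
have z1 : a * p ^+ 2 = 0 by lra.
have z2 : b * (p * q) = 0 by lra.
split; apply/eqP.
  by move/eqP: z1; rewrite mulf_eq0 (gt_eqF p2) orbF.
by move/eqP: z2; rewrite mulf_eq0 (gt_eqF pq) orbF.
Qed.

Lemma sides_eq0 (a b c d p q r s : K) : 0 <= a -> 0 <= b -> 0 <= c -> 0 <= d ->
  0 <= p -> 0 <= q -> r < 0 -> s < 0 -> a * p + b * q = c * r + d * s ->
  c = 0 /\ d = 0.
Proof.
move=> a0 b0 c0 d0 p0 q0 r0 s0 e.
have rs : 0 < (- r) * (- s) by rewrite mulr_gt0 // oppr_gt0.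
have h1 := mulr_ge0 a0 p0; have h2 := mulr_ge0 b0 q0.
have h3 : 0 <= c * - r by rewrite mulr_ge0 // oppr_ge0 ltW.
have h4 : 0 <= d * - s by rewrite mulr_ge0 // oppr_ge0 ltW.
by apply: weighted_sum_eq0 rs _ => //; lra.
Qed.

Lemma free_of_det (a b : K) (x y z : 'rV[K]_3) : det3 x y z != 0 ->
  a *: x + b *: y = 0 -> a = 0 /\ b = 0.
Proof.
move=> g e.
have ea := congr1 (fun t => det3 y z t) e; have eb := congr1 (fun t => det3 z x t) e.
have z0 u v : det3 u v 0 = 0 by rewrite !det3.unlock !mxE; ring.
rewrite /= !det3_comb1 !z0 !det3_aa mulr0 addr0 in ea.
rewrite /= !det3_comb1 !z0 !det3_aa mulr0 add0r in eb.
rewrite (det3_rot x y z) in ea; rewrite (det3_rot y z x) (det3_rot x y z) in eb.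
by split; apply/eqP; [move/eqP: ea|move/eqP: eb]; rewrite mulf_eq0 (negbTE g) orbF.
Qed.

(** The line through [P i] and [P j] does not separate the ends of the segment [kl], which
    joins [P k] to [- P l] if [sg k l]. *)
Definition straight_pair (P : nat -> 'rV[K]_3) (sg : rel nat) i j k l :=
  0 < (-1) ^+ sg k l * (det3 (P i) (P j) (P k) * det3 (P i) (P j) (P l)).

(** Applying the linear form [det3 (P i) (P j)] to a common point of two segments, of which
    the second lies on one side of the line [ij], forces the coefficients on the second to
    vanish. *)
Lemma projective_drawing (G : simple_graph) (code : G -> nat) (n : nat)
    (P : nat -> 'rV[K]_3) (e sg : rel nat) :
  injective code -> (forall x, (code x < n)%N) -> (2 < n)%N ->
  (forall x y, adj x y -> e (code x) (code y)) ->
  (forall i j, sg i j = sg j i) ->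
  (forall i j k, (i < n)%N -> (j < n)%N -> (k < n)%N -> uniq [:: i; j; k] ->
     e i j -> gen3 (P i) (P j) (P k)) ->
  (forall i j, (i < n)%N -> (j < n)%N -> i != j ->
     exists k, gen3 (P i) (P j) (P k)) ->
  (forall i j k l, (i < n)%N -> (j < n)%N -> (k < n)%N -> (l < n)%N ->
     uniq [:: i; j; k; l] -> e i j -> e k l ->
     straight_pair P sg i j k l \/ straight_pair P sg k l i j) ->
  embeds_in K G (crosscap_sphere K 1).
Proof.
move=> cinj cn n2 ec sgs g3 g2 cross.
have cneq x y : x != y -> code x != code y by apply: contra => /eqP/cinj->.
have adj_neq (x y : G) : adj x y -> x != y.
  by apply: contraTneq => ->; rewrite adj_irrefl.
pose Q (x : G) := P (code x).
have Q0 x : Q x != 0.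
  have [j [jn jx]] : exists j, (j < n)%N /\ code x != j.
    by exists (code x == 0%N); case: (eqVneq (code x) 0%N) => [->|//]; split => //; lia.
  have [k] := g2 _ _ (cn x) jn jx.
  by apply: contraNneq => Qx; rewrite /gen3 -/(Q x) Qx !det3.unlock !mxE; apply/eqP; ring.
have free x y a b : adj x y -> a *: Q x + b *: Q y = 0 -> a = 0 /\ b = 0.
  move=> xy; have [k gk] := g2 _ _ (cn x) (cn y) (cneq x y (adj_neq x y xy)).
  exact: free_of_det gk.
have gen x y z : adj x y -> z != x -> z != y -> gen3 (Q x) (Q y) (Q z).
  move=> xy zx zy; apply: g3 => //; last exact: ec.
  by rewrite /= !inE negb_or andbT (cneq x y (adj_neq x y xy)) (cneq x z) 1?(cneq y z) // eq_sym.
apply: (@geodesic_embedding K true _ (@to_projective K) (@to_projective_continuous K)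
  _ _ G Q (fun x y => sg (code x) (code y))) => //.
- move=> u v u0 v0 /(to_projective_inj u0 v0)[s s0 ->].
  by exists s.
- by move=> _ v; exact: to_projectiveN.
- move=> x y s xy s0 _ E; have [k] := g2 _ _ (cn x) (cn y) (cneq x y xy).
  by rewrite /gen3 -/(Q x) -/(Q y) E !det3.unlock !mxE => /eqP[]; ring.
- move=> x y z a b s xy zx zy a0 b0 s0 _ /(congr1 (fun t => det3 (Q x) (Q y) t)).
  rewrite /= det3_comb1 det3Z !det3_aa !mulr0 addr0 => /esym/eqP.
  by rewrite mulf_eq0 (negbTE s0) (negbTE (gen x y z xy zx zy)).
- move=> x y z w a b c d eps xy zw u a0 b0 c0 d0 _ E.
  have u' : uniq [:: code x; code y; code z; code w].
    by rewrite -(map_inj_uniq cinj) in u.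
  have [h|h] := cross _ _ _ _ (cn x) (cn y) (cn z) (cn w) u' (ec _ _ xy) (ec _ _ zw).
    have := congr1 (fun t => det3 (Q x) (Q y) t) E.
    rewrite /= det3_comb1 det3Z !det3_aa !mulr0 addr0 det3_comb1 => /esym/eqP.
    rewrite mulf_eq0 signr_eq0 /= -mulrA => /eqP h0.
    have hp : 0 < det3 (Q x) (Q y) (Q z) *
        ((-1) ^+ sg (code z) (code w) * det3 (Q x) (Q y) (Q w)) by rewrite mulrCA.
    have [cz dz] := weighted_sum_eq0 c0 d0 hp h0.
    apply: (free _ _ _ _ xy) => //; move: E; rewrite cz dz mul0r !scale0r addr0 scaler0.
    by move=> /(free _ _ _ _ xy)[-> /eqP]; rewrite mulf_eq0 signr_eq0 orbF => /eqP->;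
       rewrite !scale0r addr0.
  have := congr1 (fun t => det3 (Q z) (Q w) t) E.
  rewrite /= det3_comb1 det3Z det3_comb1 !det3_aa !mulr0 addr0 mulr0 -mulrA => h0.
  by apply: weighted_sum_eq0 h0 => //; rewrite mulrCA.
- move=> x y w a b c d eps xy xw yw a0 b0 c0 d0 _.
  move/(congr1 (fun t => det3 (Q x) (Q w) t)).
  rewrite /= det3_comb1 det3Z det3_comb1 !det3_aa !mulr0 addr0 add0r mulr0.
  move/eqP; rewrite !mulf_eq0 signr_eq0 orbF => /orP[/eqP//|].
  have gg : gen3 (Q x) (Q w) (Q y) by apply: gen => //; rewrite eq_sym adj_neq.
  by rewrite (negbTE gg).
Qed.

Definition flat_point (X Y : nat -> K) (s : K) (i : nat) : 'rV[K]_3 :=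
  vec3 (X i + s) (Y i) 1.

Definition turn (X Y : nat -> K) (i j k : nat) : K :=
  det3 (flat_point X Y 0 i) (flat_point X Y 0 j) (flat_point X Y 0 k).

Lemma det3_flat X Y s i j k :
  det3 (flat_point X Y s i) (flat_point X Y s j) (flat_point X Y s k) = turn X Y i j k.
Proof. by rewrite /turn /flat_point !det3.unlock !vec3E; ring. Qed.

(** The copies of one drawing are placed side by side, at distance [S]. Edges of the same
    copy are compared by orientations, those of different copies by the linear form [sep],
    which vanishes on a line between the copies. *)
Lemma planar_copies_drawing (G : simple_graph) (comp code : G -> nat) (n : nat)
    (X Y : nat -> K) (S : K) (e : rel nat) :
  (forall x y, comp x = comp y -> code x = code y -> x = y) ->
  (forall x, (code x < n)%N) ->
  (forall x y, adj x y -> comp x = comp y /\ e (code x) (code y)) ->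
  (forall i, (i < n)%N -> 0 <= X i < S) ->
  (forall i j, (i < n)%N -> (j < n)%N -> X i = X j -> Y i = Y j -> i = j) ->
  (forall i j k, (i < n)%N -> (j < n)%N -> (k < n)%N -> uniq [:: i; j; k] ->
     e i j -> turn X Y i j k != 0) ->
  (forall i j k l, (i < n)%N -> (j < n)%N -> (k < n)%N -> (l < n)%N ->
     uniq [:: i; j; k; l] -> e i j -> e k l ->
     0 < turn X Y i j k * turn X Y i j l \/ 0 < turn X Y k l i * turn X Y k l j) ->
  embeds_in K G (crosscap_sphere K 0).
Proof.
move=> ccinj cn ec XS XYinj g3 cross.
have adj_neq (x y : G) : adj x y -> x != y.
  by apply: contraTneq => ->; rewrite adj_irrefl.
pose Q (x : G) := flat_point X Y (S * (comp x)%:R) (code x).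
have Q2 x : Q x 0 2%:R = 1 by rewrite vec3E.
have Q0 x : Q x != 0.
  by apply/eqP => /(congr1 (fun t : 'rV[K]_3 => t 0 2%:R))/eqP; rewrite Q2 mxE oner_eq0.
(* a linear form separating the copies with index below f from the others *)
pose sep (f : nat) (u : 'rV[K]_3) := u 0 0 - S * f%:R * u 0 2%:R.
have sep_comb f a b u v : sep f (a *: u + b *: v) = a * sep f u + b * sep f v.
  by rewrite /sep !mxE; ring.
have sepZ f a u : sep f (a *: u) = a * sep f u by rewrite /sep !mxE; ring.
have S0 (x : G) : 0 < S by have /andP[] := XS _ (cn x); exact: le_lt_trans.
have sep_lt x f : (comp x < f)%N -> sep f (Q x) < 0.
  move=> cf; rewrite /sep Q2 /Q vec3E mulr1.
  have /andP[_ xs] := XS _ (cn x).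
  have h : S * (comp x)%:R + S <= S * f%:R.
    by rewrite -{2}(mulr1 S) -mulrDr natr1 ler_pM2l ?ler_nat // (S0 x).
  by rewrite subr_lt0; apply: lt_le_trans h; rewrite addrC ltrD2l.
have sep_ge x f : (f <= comp x)%N -> 0 <= sep f (Q x).
  move=> cf; rewrite /sep Q2 /Q vec3E mulr1.
  have /andP[xs _] := XS _ (cn x).
  have h : S * f%:R <= S * (comp x)%:R by rewrite ler_pM2l ?ler_nat // (S0 x).
  by rewrite subr_ge0 (le_trans h) // lerDr.
have Q_inj x y : Q x = Q y -> x = y.
  move=> E; have cxy : comp x = comp y.
    case: (ltngtP (comp x) (comp y)) => // lt.
      by have := sep_lt x (comp y) lt; rewrite E ltNge sep_ge.
    by have := sep_lt y (comp x) lt; rewrite -E ltNge sep_ge.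
  apply: ccinj => //; apply: XYinj => //.
    have := congr1 (fun t : 'rV[K]_3 => t 0 0) E.
    by rewrite /= !vec3E cxy => /addIr.
  by have := congr1 (fun t : 'rV[K]_3 => t 0 1) E; rewrite /= !vec3E.
have free x y a b : x != y -> a *: Q x + b *: Q y = 0 -> a = 0 /\ b = 0.
  move=> xy E; have := congr1 (fun t : 'rV[K]_3 => t 0 2%:R) E.
  rewrite /= mxE [in X in X + _]mxE [in X in _ + X]mxE !Q2 !mulr1 mxE => ab.
  have ba : b = - a by apply/eqP; rewrite -addr_eq0 addrC ab.
  move/eqP: E; rewrite ba scaleNr -scalerBr scaler_eq0 subr_eq0.
  case/orP => [/eqP a0|/eqP/Q_inj E]; first by rewrite a0 oppr0.
  by rewrite E eqxx in xy.
have code_neq x y : comp x = comp y -> x != y -> code x != code y.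
  by move=> cxy; apply: contra => /eqP/(ccinj _ _ cxy)->.
have turnE x y z : comp x = comp y -> comp z = comp y ->
    det3 (Q x) (Q y) (Q z) = turn X Y (code x) (code y) (code z).
  by move=> c1 c2; rewrite /Q c1 c2 det3_flat.
have gen x y z : adj x y -> comp z = comp x -> z != x -> z != y ->
    det3 (Q x) (Q y) (Q z) != 0.
  move=> xy czx zx zy; have [cxy exy] := ec x y xy.
  rewrite turnE //; last by rewrite czx.
  apply: g3 => //; rewrite /= !inE negb_or andbT code_neq ?adj_neq //=.
  by rewrite !code_neq //= ?czx // 1?eq_sym // -?cxy ?czx.
apply: (@geodesic_embedding K false _ (@to_sphere K) (@to_sphere_continuous K)
  _ _ G Q (fun _ _ => false)) => //.
- move=> u v u0 v0 /(to_sphere_inj u0 v0)[s s0 ->].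
  by exists s; split => //; rewrite gt_eqF.
- move=> x y s xy s0 _ E; have := congr1 (fun t : 'rV[K]_3 => t 0 2%:R) E.
  rewrite /= [in RHS]mxE !Q2 mulr1 => s1; move: E; rewrite -s1 scale1r => /Q_inj E.
  by rewrite E eqxx in xy.
- by move=> x y a b /adj_neq; exact: free.
- move=> x y z a b s xy zx zy a0 b0 s0 /(_ isT) sp; rewrite expr0 mulr1 => E.
  have [cxy exy] := ec x y xy.
  have [czx|] := eqVneq (comp z) (comp x).
    have := congr1 (fun t => det3 (Q x) (Q y) t) E.
    rewrite /= det3_comb1 det3Z !det3_aa !mulr0 addr0 => /esym/eqP.
    by rewrite mulf_eq0 (negbTE s0) (negbTE (gen x y z xy czx zx zy)).
  have z2 := congr1 (fun t : 'rV[K]_3 => t 0 2%:R) E.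
  rewrite /= mxE [in X in X + _]mxE [in X in _ + X]mxE [in RHS]mxE !Q2 !mulr1 in z2.
  rewrite neq_ltn => /orP[] lt.
    have := congr1 (sep (comp x)) E; rewrite sep_comb sepZ.
    have h1 := sep_lt _ _ lt; have h2 := sep_ge x _ (leqnn _).
    have h3 : 0 <= sep (comp x) (Q y) by apply: sep_ge; rewrite cxy.
    move=> h5; have : 0 <= s * sep (comp x) (Q z) by rewrite -h5 addr_ge0 // mulr_ge0.
    by rewrite leNgt pmulr_rlt0 // h1.
  have := congr1 (sep (comp z)) E; rewrite sep_comb sepZ.
  have h1 := sep_lt _ _ lt; have h2 := sep_ge z _ (leqnn _).
  have h3 : sep (comp z) (Q y) < 0 by apply: sep_lt; rewrite -cxy.
  have h4 : 0 <= s * sep (comp z) (Q z) by rewrite mulr_ge0 // ltW.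
  move=> h5; have [az bz] : a = 0 /\ b = 0.
    apply: (@sides_eq0 s 0 a b (sep (comp z) (Q z)) 0 _ _ (ltW sp) (lexx _) a0 b0 h2 (lexx _) h1 h3).
    by rewrite mul0r addr0.
  by move: z2; rewrite az bz addr0 => z2; rewrite -z2 eqxx in s0.
- move=> x y z w a b c d eps xy zw u a0 b0 c0 d0 epsm.
  have -> : eps = false by case: eps epsm => // /(_ isT).
  rewrite !expr0 scale1r !mulr1 => E.
  have [cxy exy] := ec x y xy; have [czw ezw] := ec z w zw.
  have [czx|] := eqVneq (comp z) (comp x).
    have u' : uniq [:: code x; code y; code z; code w].
      move: u; rewrite !uniq4E => u; split_andb.
      by rewrite !code_neq //; rewrite -?czw ?czx -?cxy.
    have [h|h] := cross _ _ _ _ (cn x) (cn y) (cn z) (cn w) u' exy ezw.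
      have := congr1 (fun t => det3 (Q x) (Q y) t) E.
      rewrite /= !det3_comb1 !det3_aa !mulr0 addr0 => /esym h0.
      rewrite -!turnE // -?cxy ?czx -?czw ?czx // in h.
      have [cz dz] := weighted_sum_eq0 c0 d0 h h0.
      apply: (free _ _ _ _ (adj_neq _ _ xy)).
      by rewrite E cz dz !scale0r addr0.
    have := congr1 (fun t => det3 (Q z) (Q w) t) E.
    rewrite /= !det3_comb1 !det3_aa !mulr0 addr0 => h0.
    rewrite -!turnE // -?czw -?cxy ?czx // in h.
    exact: weighted_sum_eq0 h h0.
  rewrite neq_ltn => /orP[] lt.
    have := congr1 (sep (comp x)) E; rewrite !sep_comb.
    have h1 := sep_lt _ _ lt; have h2 := sep_ge x _ (leqnn _).
    have h3 : 0 <= sep (comp x) (Q y) by apply: sep_ge; rewrite cxy.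
    have h4 : sep (comp x) (Q w) < 0 by apply: sep_lt; rewrite -czw.
    move=> h5; have [cz dz] : c = 0 /\ d = 0.
      exact: (sides_eq0 a0 b0 c0 d0 h2 h3 h1 h4 h5).
    apply: (free _ _ _ _ (adj_neq _ _ xy)).
    by rewrite E cz dz !scale0r addr0.
  have := congr1 (sep (comp z)) E; rewrite !sep_comb.
  have h1 := sep_lt _ _ lt; have h2 := sep_ge z _ (leqnn _).
  have h3 : sep (comp z) (Q y) < 0 by apply: sep_lt; rewrite -cxy.
  have h4 : 0 <= sep (comp z) (Q w) by apply: sep_ge; rewrite czw.
  by move=> /esym h5; exact: (sides_eq0 c0 d0 a0 b0 h2 h4 h1 h3 h5).
- move=> x y w a b c d eps xy xw yw a0 b0 c0 d0 epsm.
  have -> : eps = false by case: eps epsm => // /(_ isT).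
  rewrite !expr0 scale1r !mulr1 => /(congr1 (fun t => det3 (Q x) (Q w) t)).
  rewrite /= !det3_comb1 !det3_aa !mulr0 addr0 add0r => /eqP.
  rewrite mulf_eq0 => /orP[/eqP//|].
  have [cxy exy] := ec x y xy.
  have gg : det3 (Q x) (Q w) (Q y) != 0 by apply: gen => //; rewrite eq_sym adj_neq.
  by rewrite (negbTE gg).
Qed.

End Drawings.

(** * Drawings with integer coordinates *)
Section IntegerDrawings.

Definition int3 := (int * int * int)%type.

Definition det_int (a b c : int3) : int :=
  a.1.1 * (b.1.2 * c.2 - b.2 * c.1.2) - a.1.2 * (b.1.1 * c.2 - b.2 * c.1.1)
  + a.2 * (b.1.1 * c.1.2 - b.1.2 * c.1.1).

Definition point (pts : seq int3) (i : nat) : int3 := nth (0, 0, 0) pts i.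

Definition det_at pts i j k := det_int (point pts i) (point pts j) (point pts k).

(** The computational form of [straight_pair]. *)
Definition same_side pts (sg : rel nat) i j k l : bool :=
  (det_at pts i j k < 0) (+) (det_at pts i j l < 0) == sg k l.

(** The second clause asks that any two points be linearly independent, which a third point
    witnesses; the first and the last one are the conditions on edges. *)
Definition drawing_check pts (e sg : rel nat) : bool :=
  let r := iota 0 (size pts) in
  [&& all (fun i => all (fun j => e i j ==> all (fun k =>
        uniq [:: i; j; k] ==> (det_at pts i j k != 0)) r) r) r,
    all (fun i => all (fun j => (i != j) ==> has (fun k => det_at pts i j k != 0) r) r) r &
    all (fun i => all (fun j => e i j ==> all (fun k => all (fun l =>
       e k l ==> uniq [:: i; j; k; l] ==>
       (same_side pts sg i j k l || same_side pts sg k l i j)) r) r) r) r].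

Variable K : realType.

Definition cast3 (a : int3) : 'rV[K]_3 := vec3 a.1.1%:~R a.1.2%:~R a.2%:~R.

Lemma det3_cast a b c : det3 (cast3 a) (cast3 b) (cast3 c) = (det_int a b c)%:~R.
Proof. by rewrite det3.unlock !vec3E /det_int; ring. Qed.

Lemma all_iotaP (p : pred nat) n i : all p (iota 0 n) -> (i < n)%N -> p i.
Proof. by move=> /allP a i_n; apply: a; rewrite mem_iota. Qed.

Lemma drawing_check_gen pts e sg i j k : drawing_check pts e sg ->
  (i < size pts)%N -> (j < size pts)%N -> (k < size pts)%N ->
  uniq [:: i; j; k] -> e i j -> det_at pts i j k != 0.
Proof.
case/and3P=> c1 _ _ i_n jn kn u eij.
have := all_iotaP (all_iotaP c1 i_n) jn; rewrite eij => c.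
by have := all_iotaP c kn; rewrite u.
Qed.

Lemma same_side_gt0 pts (sg : rel nat) i j k l : det_at pts i j k != 0 ->
  det_at pts i j l != 0 -> same_side pts sg i j k l ->
  0 < (-1) ^+ sg k l * ((det_at pts i j k)%:~R * (det_at pts i j l)%:~R) :> K.
Proof.
rewrite /same_side; move: (det_at pts i j k) (det_at pts i j l) => a b a0 b0 /eqP <-.
rewrite -intrM; case: (ltrgt0P a) a0 => // a_ _; case: (ltrgt0P b) b0 => // b_ _;
 rewrite /= ?expr0 ?expr1 ?mul1r ?mulN1r ?oppr_gt0 ?ltr0z ?ltrz0;
 solve [ by rewrite mulr_gt0 | by rewrite nmulr_rgt0 | by rewrite pmulr_rlt0
       | by rewrite nmulr_rlt0 ].
Qed.

Lemma straight_pair_check pts e sg i j k l : drawing_check pts e sg ->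
  (i < size pts)%N -> (j < size pts)%N -> (k < size pts)%N -> (l < size pts)%N ->
  uniq [:: i; j; k; l] -> e i j -> e k l ->
  0 < (-1) ^+ sg k l * ((det_at pts i j k)%:~R * (det_at pts i j l)%:~R) :> K \/
  0 < (-1) ^+ sg i j * ((det_at pts k l i)%:~R * (det_at pts k l j)%:~R) :> K.
Proof.
move=> chk i_n jn kn ln u eij ekl.
have [u1 u2 u3 u4] : [/\ uniq [:: i; j; k], uniq [:: i; j; l], uniq [:: k; l; i] &
    uniq [:: k; l; j]].
  move: u; rewrite uniq4E => u; split_andb.
  by split; rewrite /= !inE negb_or andbT 1?[k == i]eq_sym 1?[l == i]eq_sym
     1?[k == j]eq_sym 1?[l == j]eq_sym; do ![apply/andP; split].
case/and3P: (chk) => _ _ c3.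
have := all_iotaP (all_iotaP c3 i_n) jn; rewrite eij => c.
have := all_iotaP (all_iotaP c kn) ln; rewrite ekl u => /orP[] s; [left|right];
  by apply: same_side_gt0 => //; apply: (drawing_check_gen chk).
Qed.

Lemma integer_projective_drawing (G : simple_graph) (code : G -> nat) pts (e sg : rel nat) :
  injective code -> (forall x, (code x < size pts)%N) -> (2 < size pts)%N ->
  (forall x y, adj x y -> e (code x) (code y)) ->
  (forall i j, sg i j = sg j i) -> drawing_check pts e sg ->
  embeds_in K G (crosscap_sphere K 1).
Proof.
move=> cinj cn n2 ec sgs chk; case/and3P: (chk) => _ c2 _.
apply: (@projective_drawing K G code (size pts) (fun i => cast3 (point pts i)) e sg) => //.
- move=> i j k i_n jn kn u eij; rewrite /gen3 det3_cast intr_eq0.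
  exact: (drawing_check_gen chk).
- move=> i j i_n jn ij; have := all_iotaP (all_iotaP c2 i_n) jn; rewrite ij => /hasP[k _ kP].
  by exists k; rewrite /gen3 det3_cast intr_eq0.
- move=> i j k l i_n jn kn ln u eij ekl; rewrite /straight_pair !det3_cast.
  exact: (straight_pair_check chk).
Qed.

Lemma integer_planar_copies (G : simple_graph) (comp code : G -> nat) pts (e : rel nat) :
  (forall x y, comp x = comp y -> code x = code y -> x = y) ->
  (forall x, (code x < size pts)%N) ->
  (forall x y, adj x y -> comp x = comp y /\ e (code x) (code y)) ->
  all (fun p => [&& 0 <= p.1.1, p.1.1 < 100 & p.2 == 1]) pts -> uniq pts ->
  drawing_check pts e (fun _ _ => false) ->
  embeds_in K G (crosscap_sphere K 0).
Proof.
move=> cinj cn ec /allP box up chk.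
pose X i : K := (point pts i).1.1%:~R; pose Y i : K := (point pts i).1.2%:~R.
have ptP i : (i < size pts)%N -> 
    [/\ 0 <= (point pts i).1.1, (point pts i).1.1 < 100 & (point pts i).2 = 1].
  by move=> i_n; have /and3P[h1 h2 /eqP h3] := box _ (mem_nth (0, 0, 0) i_n).
have tE i j k : (i < size pts)%N -> (j < size pts)%N -> (k < size pts)%N ->
    turn X Y i j k = (det_at pts i j k)%:~R.
  move=> i_n jn kn; rewrite /det_at -det3_cast /turn /flat_point /cast3.
  have [_ _ ->] := ptP i i_n; have [_ _ ->] := ptP j jn; have [_ _ ->] := ptP k kn.
  by rewrite !addr0.
apply: (@planar_copies_drawing K G comp code (size pts) X Y 100 e) => //.
- move=> i i_n; have [h1 h2 _] := ptP i i_n.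
  by rewrite /X ler0z h1 -[100]/(100%:~R) ltr_int.
- move=> i j i_n jn /intr_inj xx /intr_inj yy.
  have [_ _ zi] := ptP i i_n; have [_ _ zj] := ptP j jn.
  apply/eqP; rewrite -(nth_uniq (0, 0, 0) i_n jn up); apply/eqP.
  move: xx yy zi zj; rewrite /point.
  by case: (nth _ _ i) => [[? ?] ?]; case: (nth _ _ j) => [[? ?] ?] /= -> -> -> ->.
- move=> i j k i_n jn kn u eij; rewrite tE // intr_eq0.
  exact: (drawing_check_gen chk).
- move=> i j k l i_n jn kn ln u eij ekl; rewrite !tE //.
  have := straight_pair_check chk i_n jn kn ln u eij ekl.
  by rewrite !expr0 !mul1r.
Qed.

End IntegerDrawings.

Definition z3 (a b c : int) : int3 := (a, b, c).

(** Five of the six axes of an icosahedron, with 2 in the place of the golden ratio. *)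
Definition K5_points : seq int3 :=
  [:: z3 0 1 2; z3 0 1 (-2); z3 1 2 0; z3 1 (-2) 0; z3 2 0 1].
Definition K5_flips : rel nat := fun i j =>
  ((minn i j, maxn i j) \in [:: (0, 1); (0, 3); (1, 3); (1, 4); (2, 3)])%N.

Lemma K5_drawing : drawing_check K5_points (fun i j => i != j) K5_flips.
Proof. by vm_compute. Qed.

(** Only the signs of the determinants of these points matter. *)
Definition K3K3_points : seq int3 :=
  [:: z3 (-3) (-1) 2; z3 0 (-3) 3; z3 (-1) 1 0; z3 1 3 1; z3 (-3) 3 1;
      z3 (-2) (-2) 3; z3 3 0 2; z3 3 (-2) 3; z3 (-1) 0 (-2)].
Definition K3K3_flips : rel nat := fun i j =>
  ((minn i j, maxn i j) \in [:: (1, 3); (1, 6); (2, 6); (4, 6); (5, 6);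
     (2, 7); (3, 7); (0, 8); (3, 8); (4, 8)])%N.
Definition K3K3_adj : rel nat := fun i j => (i %/ 3 != j %/ 3)%N && (i %% 3 != j %% 3)%N.

Lemma K3K3_drawing : drawing_check K3K3_points K3K3_adj K3K3_flips.
Proof. by vm_compute. Qed.

(** An outer and an inner square; the bits of a vertex are its coordinates in the cube. *)
Definition cube_points : seq int3 :=
  [:: z3 0 0 1; z3 10 1 1; z3 1 11 1; z3 11 10 1;
      z3 3 4 1; z3 7 3 1; z3 4 8 1; z3 8 7 1].
Definition cube_adj : rel nat := fun i j =>
  let d := (maxn i j - minn i j)%N in
  [|| (d == 1) && (i %/ 2 == j %/ 2), (d == 2) && (i %/ 4 == j %/ 4) | d == 4]%N.

Lemma cube_drawing : drawing_check cube_points cube_adj (fun _ _ => false).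
Proof. by vm_compute. Qed.

Definition K4_points : seq int3 := [:: z3 0 0 1; z3 3 1 1; z3 1 3 1; z3 1 1 1].

Lemma K4_drawing : drawing_check K4_points (fun i j => i != j) (fun _ _ => false).
Proof. by vm_compute. Qed.

(** * Rings with at most three units *)
Section FewUnits.
Variables (K : realType) (R : finComUnitRingType).
Implicit Types (x y z u v : R) (H : {set R}).

Let sphere := crosscap_sphere K 0.

(** An additive subgroup [H] that contains the units cuts the Cayley graph into copies of
    its restriction to [H], one for each coset. *)
Lemma coset_copies H (c : R -> nat) (e : rel nat) : 0 \in H ->
  {in H &, forall a b, a - b \in H} -> units R \subset H -> {in H &, injective c} ->
  {in H &, forall a b, a - b \is a GRing.unit -> e (c a) (c b)} ->
  exists comp code : R -> nat,
    [/\ forall x y, comp x = comp y -> code x = code y -> x = y,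
        forall x, exists2 a, a \in H & code x = c a
      & forall x y, unitary_adj x y -> comp x = comp y /\ e (code x) (code y)].
Proof.
move=> H0 HB /fintype.subsetP UH cinj ce.
exists (fun x => enum_rank (residue H x) : nat), (fun x => c (x - residue H x)); split.
- move=> x y /val_inj/enum_rank_inj exy.
  rewrite exy; move/cinj => h; apply: (addIr (- residue H y)); apply: h.
    by rewrite -exy residue_sub.
  exact: residue_sub.
- by move=> x; exists (x - residue H x) => //; exact: residue_sub.
move=> x y /andP[_ xyu].
have exy : residue H x = residue H y by apply: residue_congr => //; apply: UH; rewrite inE.
rewrite exy; split=> //; apply: ce; [by rewrite -exy residue_sub|exact: residue_sub|].
by have -> : x - residue H y - (y - residue H y) = x - y by ring.
Qed.

Lemma unit_neq0 x : x \is a GRing.unit -> x != 0.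
Proof. by apply: contraTneq => ->; rewrite unitr0. Qed.

Lemma small_subgroup_planar (s : seq R) : (size s <= 4)%N -> 0 \in s ->
  {in s &, forall a b, a - b \in s} -> {subset units R <= s} ->
  embeds_in K (unitary_cayley R) sphere.
Proof.
move=> s4 s0 sB Us.
have [||||| comp [code [inj cE ec]]] :=
    @coset_copies [set x in s] (index^~ s) (fun i j => i != j).
- by rewrite inE.
- by move=> a b; rewrite !inE; exact: sB.
- by apply/fintype.subsetP => u /Us; rewrite inE.
- by move=> a b; rewrite !inE => aS bS; exact: (index_inj 0).
- move=> a b; rewrite !inE => aS bS /unit_neq0; rewrite subr_eq0; apply: contraNneq => h.
  by rewrite (index_inj 0 aS bS h).
apply: (@integer_planar_copies K (unitary_cayley R) comp code K4_points _ inj _ ec _ _ K4_drawing) => //.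
by move=> x; have [a] := cE x; rewrite inE => aS ->; rewrite (leq_trans _ s4) // index_mem.
Qed.

Lemma klein_planar u : (1 + 1 = 0 :> R) -> {subset units R <= [:: 0; 1; u; 1 + u]} ->
  embeds_in K (unitary_cayley R) sphere.
Proof.
move=> ch2 Us; have xx x : x + x = 0 by rewrite -[x]mulr1 -mulrDr ch2 mulr0.
have nx x : - x = x by apply/eqP; rewrite eq_sym -addr_eq0 xx.
apply: small_subgroup_planar Us => // [|a b]; first exact: mem_head.
have h1 : 1 + (1 + u) = u by rewrite addrA ch2 add0r.
have h2 : u + (1 + u) = 1 by rewrite addrCA xx addr0.
rewrite !inE nx => /or4P[] /eqP-> /or4P[] /eqP->;
  by rewrite ?add0r ?addr0 ?xx ?h1 ?h2 ?[u + 1]addrC ?[1 + u + 1]addrC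
     ?[1 + u + u]addrC ?h1 ?h2 ?eqxx ?orbT.
Qed.

Definition comb u v (p : bool * bool * bool) : R :=
  p.1.1%:R + p.1.2%:R * u + p.2%:R * v.

Definition bit_code (p : bool * bool * bool) : nat := (p.1.1 + 2 * p.1.2 + 4 * p.2)%N.

(** In characteristic 2 with three units 1, [u], [v] that are linearly independent over the
    field with two elements, the subgroup that they generate carries a cube. *)
Lemma cube_planar u v : (1 + 1 = 0 :> R) -> u \is a GRing.unit -> v \is a GRing.unit ->
  1 + u != 0 -> 1 + v != 0 -> u + v != 0 -> 1 + u + v != 0 ->
  (forall x, x \is a GRing.unit -> [\/ x = 1, x = u | x = v]) ->
  embeds_in K (unitary_cayley R) sphere.
Proof.
move=> ch2 uu vu u1 v1 uv uv1 only.
have xx x : x + x = 0 by rewrite -[x]mulr1 -mulrDr ch2 mulr0.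
have nx x : - x = x by apply/eqP; rewrite eq_sym -addr_eq0 xx.
(* addition of bits modulo 2 *)
pose D (p q : bool * bool * bool) := (p.1.1 (+) q.1.1, p.1.2 (+) q.1.2, p.2 (+) q.2).
have combB p q : comb u v p - comb u v q = comb u v (D p q).
  have bB (a b : bool) : a%:R + b%:R = (a (+) b)%:R :> R.
    by case: a; case: b; rewrite ?addr0 ?add0r.
  by rewrite nx /comb /D /= -!bB; ring.
have comb0 p : comb u v p = 0 -> p = (false, false, false).
  case: p => [[[] []] []]; rewrite /comb /= ?mul1r ?mul0r ?addr0 ?add0r //= => /eqP h;
    by move: h; rewrite ?oner_eq0 ?(negbTE u1) ?(negbTE v1) ?(negbTE uv) ?(negbTE uv1)
      ?(negbTE (unit_neq0 uu)) ?(negbTE (unit_neq0 vu)).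
have combI : injective (comb u v).
  move=> p q /eqP; rewrite -subr_eq0 combB => /eqP/comb0.
  by case: p => [[a b] c]; case: q => [[a' b'] c'] []; move: a b c a' b' c' => [] [] [] [] [] [].
pose c x := if [pick p | comb u v p == x] is Some p then bit_code p else 0%N.
have cE p : c (comb u v p) = bit_code p.
  by rewrite /c; case: pickP => [q /eqP/combI -> //|/(_ p)]; rewrite eqxx.
have [||||| comp [code [inj codeE ec]]] :=
    @coset_copies [set comb u v p | p : bool * bool * bool] c cube_adj.
- by apply/imsetP; exists (false, false, false); rewrite // /comb !mul0r !addr0.
- by move=> _ _ /imsetP[p _ ->] /imsetP[q _ ->]; rewrite combB imset_f.
- apply/fintype.subsetP => x; rewrite inE => /only[] ->; apply/imsetP.
  + by exists (true, false, false); rewrite // /comb !mul0r !addr0.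
  + by exists (false, true, false); rewrite // /comb mul0r mul1r addr0 add0r.
  + by exists (false, false, true); rewrite // /comb mul0r mul1r !add0r.
- move=> _ _ /imsetP[p _ ->] /imsetP[q _ ->]; rewrite !cE => h; congr comb.
  by move: p q h => [[[] []] []] [[[] []] []].
- move=> _ _ /imsetP[p _ ->] /imsetP[q _ ->]; rewrite combB !cE => /only h.
  have : D p q \in [:: (true, false, false); (false, true, false); (false, false, true)].
    rewrite !inE; case: h => h.
    + have -> : D p q = (true, false, false); last by [].
      by apply: combI; rewrite h /comb !mul0r !addr0.
    + have -> : D p q = (false, true, false); last by [].
      by apply: combI; rewrite h /comb mul0r mul1r addr0 add0r.
    + have -> : D p q = (false, false, true); last by [].
      by apply: combI; rewrite h /comb mul0r mul1r !add0r.
  by rewrite /D; clear; move: p q => [[[] []] []] [[[] []] []].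
apply: (@integer_planar_copies K (unitary_cayley R) comp code cube_points _ inj _ ec _ _ cube_drawing) => //.
move=> x; have [_ /imsetP[p _ ->] ->] := codeE x; rewrite cE.
by case: p => [[[] []] []].
Qed.

Definition cycle_adj (n : nat) : rel nat := fun i j =>
  [|| j == i.+1, i == j.+1, (i == 0) && (j == n.-1) | (j == 0) && (i == n.-1)]%N.

(** A Vandermonde determinant: points of a parabola are in convex position. *)
Lemma turn_parabola i j k :
  turn (fun i => i%:R : K) (fun i => i%:R ^+ 2) i j k =
  (j%:R - i%:R) * ((k%:R - i%:R) * (k%:R - j%:R)).
Proof. by rewrite /turn /flat_point det3.unlock !vec3E; ring. Qed.

(** A cycle is drawn as a convex polygon, so all other vertices are on one side of an
    edge. *)
Lemma cycle_copies_planar (G : simple_graph) (comp code : G -> nat) n :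
  (forall g h, comp g = comp h -> code g = code h -> g = h) ->
  (forall g, (code g < n)%N) ->
  (forall g h, adj g h -> comp g = comp h /\ cycle_adj n (code g) (code h)) ->
  embeds_in K G sphere.
Proof.
move=> inj cn ec.
have nat_neq (i j : nat) : i != j -> j%:R - i%:R != 0 :> K.
  by move=> ij; rewrite subr_eq0 eqr_nat eq_sym.
apply: (@planar_copies_drawing K G comp code n (fun i => i%:R) (fun i => i%:R ^+ 2) n%:R
  (cycle_adj n) inj cn ec).
- by move=> i i_n; rewrite ler0n ltr_nat.
- by move=> i j _ _ /eqP; rewrite eqr_nat => /eqP.
- move=> i j k _ _ _; rewrite /= !inE negb_or !andbT => /andP[/andP[ij ik] jk] _.
  by rewrite turn_parabola !mulf_neq0 ?nat_neq.
move=> i j k l i_n jn kn ln; rewrite uniq4E => u eij _; split_andb; left.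
rewrite !turn_parabola mulrACA pmulr_rgt0; last first.
  by rewrite -expr2 exprn_even_gt0 ?nat_neq.
have pos (p : nat) : ((p < i) && (p < j) || (i < p) && (j < p))%N ->
    0 < (p%:R - i%:R) * (p%:R - j%:R) :> K.
  case/orP => /andP[h1 h2]; last by rewrite mulr_gt0 // subr_gt0 ltr_nat.
  by rewrite nmulr_rgt0 subr_lt0 ltr_nat.
have neg (p : nat) : ((p < i) && (j < p) || (i < p) && (p < j))%N ->
    (p%:R - i%:R) * (p%:R - j%:R) < 0 :> K.
  case/orP => /andP[h1 h2].
    by rewrite nmulr_rlt0 ?subr_lt0 ?subr_gt0 ltr_nat.
  by rewrite pmulr_rlt0 ?subr_lt0 ?subr_gt0 ltr_nat.
case/or4P: eij => [/eqP h|/eqP h|/andP[/eqP h1 /eqP h2]|/andP[/eqP h1 /eqP h2]].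
- by rewrite mulr_gt0 // pos; lia.
- by rewrite mulr_gt0 // pos; lia.
- by rewrite nmulr_rgt0 neg; lia.
- by rewrite nmulr_rgt0 neg; lia.
Qed.

(** The multiples of 1 form the subgroup generated by the units, and each is adjacent to the
    next and the previous one. *)
Lemma sign_units_planar : 1 + 1 != 0 :> R ->
  (forall x, x \is a GRing.unit -> x = 1 \/ x = -1) ->
  embeds_in K (unitary_cayley R) sphere.
Proof.
move=> ch2 only.
have ex : exists n, (0 < n)%N && (n%:R == 0 :> R).
  by exists #|R|; rewrite card_natr0 eqxx andbT; apply/card_gt0P; exists 0.
(* the characteristic of R *)
case: (ex_minnP ex) => n /andP[n0 /eqP n0R] nmin.
have inj (i j : nat) : (i < n)%N -> (j < n)%N -> i%:R = j%:R :> R -> i = j.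
  wlog ij : i j / (i <= j)%N.
    by move=> h i_n jn e; case/orP: (leq_total i j) => ij; [|symmetry]; apply: h.
  move=> i_n jn e; apply/eqP/negPn/negP => nij.
  have : (0 < j - i)%N && ((j - i)%:R == 0 :> R).
    by rewrite natrB // e subrr eqxx andbT; lia.
  by move/nmin; lia.
pose H := [set (val k)%:R | k : 'I_n] : {set R}.
have inH (k : nat) : k%:R \in H.
  rewrite -(natr_modn _ n0R); apply/imsetP; by exists (Ordinal (ltn_pmod k n0)).
pose c x := if [pick k : 'I_n | k%:R == x] is Some k then val k else 0%N.
have cE (k : 'I_n) : c k%:R = k.
  rewrite /c; case: pickP => [q /eqP/inj|/(_ k)]; last by rewrite eqxx.
  by move=> /(_ (ltn_ord _) (ltn_ord _)).
have succ (i j : 'I_n) : (i : nat)%:R - (j : nat)%:R = 1 :> R ->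
    (i == j.+1 :> nat) || (i == 0%N :> nat) && (j == n.-1 :> nat).
  move=> e; have {}e : (i : nat)%:R = (j.+1)%:R :> R by apply/eqP; rewrite -subr_eq0 -natr1 opprD addrA e subrr.
  have [jn|jn] := ltnP j.+1 n.
    by rewrite (inj _ _ _ jn e) ?eqxx.
  have jE : j.+1 = n by apply/eqP; rewrite eqn_leq jn ltn_ord.
  move: e; rewrite jE n0R -(mulr0n 1) => /(inj _ _ (ltn_ord i) n0) ->.
  by apply/orP; right; rewrite eqxx /= -(eqn_add2r 1) !addn1 jE prednK.
have [||||| comp [code [cinj codeE ec]]] := @coset_copies H c (cycle_adj n).
- exact: (inH 0%N).
- move=> _ _ /imsetP[i _ ->] /imsetP[j _ ->].
  have -> : (i : nat)%:R - (j : nat)%:R = (i + (n - j))%:R :> R.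
    by rewrite natrD natrB ?n0R ?sub0r // ltnW.
  exact: inH.
- apply/fintype.subsetP => x; rewrite inE => /only[] ->; first exact: (inH 1%N).
  suff -> : -1 = (n.-1)%:R :> R by exact: inH.
  by apply/eqP; rewrite eq_sym -addr_eq0 natr1 prednK // n0R.
- by move=> _ _ /imsetP[i _ ->] /imsetP[j _ ->]; rewrite !cE /= => ->.
- move=> _ _ /imsetP[i _ ->] /imsetP[j _ ->] /only h; rewrite !cE /cycle_adj.
  case: h => [/succ /orP[->|->]|h]; rewrite ?orbT //.
  have /succ /orP[->|->] : (j : nat)%:R - (i : nat)%:R = 1 :> R by rewrite -opprB h opprK.
    by [].
  by rewrite !orbT.
apply: (@cycle_copies_planar (unitary_cayley R) comp code n cinj _ ec) => x.
by have [_ /imsetP[k _ ->] ->] := codeE x; rewrite cE.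
Qed.

(** If 2 <> 0, a third unit [x] would come with a fourth, [- x]. If 2 = 0, the subgroup
    generated by the units has order 2, 4 or 8. *)
Theorem few_units_planar : (#|units R| <= 3)%N -> embeds_in K (unitary_cayley R) sphere.
Proof.
move=> U3.
have few (s : seq R) : uniq s -> (forall x, x \in s -> x \is a GRing.unit) -> (size s <= 3)%N.
  move=> us sU; rewrite (leq_trans _ U3) // cardE; apply: uniq_leq_size => // x /sU.
  by rewrite mem_enum inE.
have [ch2|ch2] := eqVneq (1 + 1 : R) 0; last first.
  apply: sign_units_planar => // x xu; apply: contrapT => h.
  have nn y : y \is a GRing.unit -> (y == - y) = false.
    move=> yu; apply: contraNF ch2 => /eqP e; apply/eqP/(mulrI yu).
    by rewrite mulrDr mulr1 mulr0 {2}e subrr.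
  have x1 : (1 == x) = false by apply/eqP => e; apply: h; left.
  have xN1 : (-1 == x) = false by apply/eqP => e; apply: h; right.
  suff : (size [:: 1; -1; x; - x]%R <= 3)%N by [].
  apply: few => [|y]; last by rewrite !inE => /or4P[] /eqP->; rewrite ?unitrN ?unitr1.
  have x1N : (1 == - x) = false by apply/eqP => e; apply: h; right; rewrite e opprK.
  by rewrite /= !inE !nn ?unitr1 // eqr_opp x1 x1N xN1.
have xx x : x + x = 0 by rewrite -[x]mulr1 -mulrDr ch2 mulr0.
have [u /andP[uu u1]|only1] := pickP (fun u : R => (u \is a GRing.unit) && (u != 1)); last first.
  apply: (@klein_planar 0) => // x; rewrite inE => xu; have := only1 x.
  by rewrite xu /= => /negbFE/eqP ->; rewrite !inE eqxx orbT.
have [v /and3P[vu v1 vu']|only2] := pickP (fun v : R => [&& v \is a GRing.unit, v != 1 & v != u]); last first.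
  apply: (@klein_planar u) => // x; rewrite inE => xu; have := only2 x.
  by rewrite xu /=; case: eqVneq => [-> _|_ /negbFE/eqP ->]; rewrite !inE eqxx /= ?orbT.
have only x : x \is a GRing.unit -> [\/ x = 1, x = u | x = v].
  move=> xu; case: (eqVneq x 1) => [|x1]; first by constructor.
  case: (eqVneq x u) => [|xu']; first by constructor.
  case: (eqVneq x v) => [|xv']; first by constructor.
  suff : (size [:: 1; u; v; x]%R <= 3)%N by [].
  apply: few => [|y]; last by rewrite !inE => /or4P[] /eqP->; rewrite ?unitr1.
  by rewrite /= !inE !negb_or ![1 == _]eq_sym u1 v1 x1 ![u == _]eq_sym vu' xu' eq_sym xv'.
have add_neq0 x y : x != y -> x + y != 0.
  by apply: contra => /eqP e; apply/eqP/(addIr y); rewrite e xx.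
have [uv|uv] := eqVneq (1 + u + v) 0.
  apply: (@klein_planar u) => // x; rewrite inE => /only[] ->; rewrite !inE ?eqxx ?orbT //.
  have -> : v = 1 + u by apply: (addIr v); rewrite uv xx.
  by rewrite eqxx !orbT.
by apply: (@cube_planar u v) => //; apply: add_neq0; rewrite eq_sym.
Qed.
End FewUnits.

(** * Projective unitary Cayley graphs *)
Section Obstructions.
Variables (K : realType) (R : finComUnitRingType).

Lemma hosts_parity m n e : hosts R n e -> inhabited (parity_data m (@unitary_adj R)) ->
  inhabited (parity_data m (fun i j => [&& (i < n)%N, (j < n)%N & e i j])).
Proof.
move=> [f finj fe] [D]; apply: (parity_restrict D finj) => i j /and3P[i_n jn eij].
have fij := fe i j i_n jn eij; split=> //.
by rewrite /unitary_adj fij andbT -subr_eq0 unit_neq0.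
Qed.

Lemma obstructed_not_projective :
  obstructed R -> ~ embeds_in K (unitary_cayley R) (crosscap_sphere K 1).
Proof.
move=> [n [e [obs host]]] /projective_parity/(hosts_parity host)[D].
have edges (s : seq (nat * nat)) : all (fun p => [&& (p.1 < n)%N, (p.2 < n)%N,
      e p.1 p.2 & e p.2 p.1]) s ->
    forall i j, edge_in s i j -> [&& (i < n)%N, (j < n)%N & e i j].
  by move=> /allP h i j /orP[] /h /and4P[/= -> -> h1 h2].
case: obs D edges => D edges;
  [apply: (certificate_obstruction K35_certificate _ D)
  |apply: (certificate_obstruction K44_certificate _ D)
  |apply: (certificate_obstruction K7_certificate _ D)
  |apply: (certificate_obstruction C6x2_certificate _ D)
  |apply: (certificate_obstruction K2K5_certificate _ D)
  |apply: (certificate_obstruction K2K3K3_certificate _ D)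
  |apply: (certificate_obstruction K3K4_certificate _ D)];
  by apply: edges; vm_compute.
Qed.

Lemma projective_of_genus :
  embeds_in K (unitary_cayley R) (crosscap_sphere K 1) ->
  ~ embeds_in K (unitary_cayley R) (crosscap_sphere K 0) ->
  projective K (unitary_cayley R).
Proof. by move=> e1 e0; split=> // -[|j] // /e0. Qed.

Lemma isomorphic_unit (S : unitRingType) (f : {rmorphism R -> S}) x : bijective f ->
  f x \is a GRing.unit -> x \is a GRing.unit.
Proof.
move=> [g fK gK] fxu; apply/unitrPr; exists (g (f x)^-1).
by apply: (can_inj fK); rewrite rmorphM gK rmorph1 divrr.
Qed.

(** In Z_5 every nonzero difference is a unit, so the graph is K_5. *)
Lemma Z5_projective : ring_isomorphic R 'Z_5 -> projective K (unitary_cayley R).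
Proof.
move=> [f bf]; have [g fK gK] := bf; apply: projective_of_genus.
  apply: (@integer_projective_drawing K (unitary_cayley R) (fun x => f x : nat)
    K5_points (fun i j => i != j) K5_flips).
  - by move=> x y /val_inj; exact: (can_inj fK).
  - by move=> x; exact: (ltn_ord (f x)).
  - by [].
  - by move=> x y /andP[xy _]; apply: contra xy => /eqP/val_inj/(can_inj fK) ->.
  - by move=> i j; rewrite /K5_flips minnC maxnC.
  - exact: K5_drawing.
move=> /sphere_parity D.
have host : hosts R 5 (fun i j => i != j).
  have lift_inj (i j : nat) : (i < 5)%N -> (j < 5)%N -> inZp i = inZp j :> 'Z_5 -> i = j.
    by move=> i5 j5 /(congr1 val); rewrite /= !modn_small.
  exists (fun i => g (inZp i)) => [i j /[!inE] i5 j5 /(can_inj gK)|i j i5 j5 ij].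
    exact: lift_inj.
  apply: (isomorphic_unit bf); rewrite rmorphB !gK.
  have : inZp i - inZp j != 0 :> 'Z_5.
    by rewrite subr_eq0; apply: contra ij => /eqP/(lift_inj _ _ i5 j5)->.
  by case: (_ - _) => [[|[|[|[|[|]]]]]].
have [D'] := hosts_parity host D.
by apply: (planar_k5_obstruction _ D') => i j -> ->.
Qed.

(** The number [3 * a + b] encodes the pair [(a, b)]; pairs are adjacent when both entries
    differ. *)
Lemma Z3Z3_projective :
  ring_isomorphic R ('Z_3 * 'Z_3)%type -> projective K (unitary_cayley R).
Proof.
move=> [f bf]; have [g fK gK] := bf; apply: projective_of_genus.
  pose code x : nat := ((f x).1 * 3 + (f x).2)%N.
  have div_code x : (code x %/ 3 = (f x).1)%N.
    by rewrite divnMDl // divn_small ?addn0 // (ltn_ord (f x).2).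
  have mod_code x : (code x %% 3 = (f x).2)%N.
    by rewrite modnMDl modn_small // (ltn_ord (f x).2).
  apply: (@integer_projective_drawing K (unitary_cayley R) code
    K3K3_points K3K3_adj K3K3_flips).
  - move=> x y e; apply: (can_inj fK); rewrite [LHS]surjective_pairing [RHS]surjective_pairing.
    by congr (_, _); apply: val_inj; rewrite /= -?div_code -?mod_code e.
  - move=> x; rewrite (_ : size _ = (3 * 3)%N) // -ltn_divLR // div_code.
    exact: (ltn_ord (f x).1).
  - by [].
  - move=> x y /andP[_ /(rmorph_unit f)]; rewrite rmorphB => /andP[/= h1 h2].
    rewrite /K3K3_adj !div_code !mod_code; apply/andP; split.
      by apply: contraTneq h1 => /val_inj ->; rewrite subrr unitr0.
    by apply: contraTneq h2 => /val_inj ->; rewrite subrr unitr0.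
  - by move=> i j; rewrite /K3K3_flips minnC maxnC.
  - exact: K3K3_drawing.
move=> /sphere_parity D.
have host : hosts R 9 K3K3_adj.
  have lift_inj (i j : nat) : (i < 3)%N -> (j < 3)%N -> inZp i = inZp j :> 'Z_3 -> i = j.
    by move=> i3 j3 /(congr1 val); rewrite /= !modn_small.
  have lift_unit (i j : nat) : (i < 3)%N -> (j < 3)%N -> i != j ->
      inZp i - inZp j \is a @GRing.unit 'Z_3.
    move=> i3 j3 ij; have : inZp i - inZp j != 0 :> 'Z_3.
      by rewrite subr_eq0; apply: contra ij => /eqP/(lift_inj _ _ i3 j3)->.
    by case: (_ - _) => [[|[|[|]]]].
  exists (fun i => g (inZp (i %/ 3), inZp (i %% 3))) =>
      [i j /[!inE]/= i9 j9 /(can_inj gK) ij|i j i9 j9 /andP[ij1 ij2]].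
    have [h1 h2] := (congr1 fst ij, congr1 snd ij).
    by apply: (@digits2_inj 3); apply: lift_inj; rewrite ?ltn_mod ?ltn_divLR.
  apply: (isomorphic_unit bf); rewrite rmorphB !gK; apply/andP; split => /=;
    by apply: lift_unit; rewrite ?ltn_divLR ?ltn_mod.
have [D'] := hosts_parity host D.
apply: (planar_k33_obstruction (t := K3K3_k33) _ _ D'); last by vm_compute.
by move=> i; rewrite /K3K3_adj eqxx !andbF.
Qed.

End Obstructions.

Theorem corollary4p13 (K : realType) (R : finComUnitRingType) :
  projective K (unitary_cayley R) <->
  ring_isomorphic R 'Z_5 \/ ring_isomorphic R ('Z_3 * 'Z_3)%type.
Proof.
split=> [[emb genus]|[/Z5_projective|/Z3Z3_projective]] //.
have [U3|U4] := leqP #|units R| 3.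
  by have := genus 0%N (few_units_planar K U3).
case: (ring_classification U4) => [obs|iso|iso]; [|by left|by right].
by case: (obstructed_not_projective obs emb).
Qed.
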